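(* Let $\alpha=(A_+,A_-,D)$ be a T-datum of size $r$, with associated matrices $N_0,N_+,N_-$, permutation $\sigma$ and integers $p_a$, and let $R_{\mathrm{in}}=\{(a,p)\in[1,r]\times\mathbb{Z}\mid 0\le p<p_a\}$. Let $x=(x_{a,p})_{(a,p)\in R_{\mathrm{in}}}$ be an $R_{\mathrm{in}}$-tuple of algebraically independent commuting variables. Then there exists a unique $R_{\mathrm{in}}\times R_{\mathrm{in}}$ skew-symmetrizable integer matrix $B$ such that (1) there exists a unique injective ring homomorphism $\iota:\mathscr{T}^{\circ}(\alpha)\hookrightarrow\mathcal{A}(B,x)$ such that $\iota(T_a(p))=x_{a,p}$ for any $(a,p)\in R_{\mathrm{in}}$; (2) $\iota(T_a(u))$ is a cluster variable in $\mathcal{A}(B,x)$ for any $(a,u)\in[1,r]\times\mathbb{Z}$; (3) for any $(a,u)\in[1,r]\times\mathbb{Z}$, the image under $\iota$ of the T-system relation $$\prod_{b=1}^{r}\prod_{p\ge0}T_b(u+p)^{n^0_{ba;p}}=\prod_{b=1}^{r}\prod_{p\ge0}T_b(u+p)^{n^+_{ba;p}}+\prod_{b=1}^{r}\prod_{p\ge0}T_b(u+p)^{n^-_{ba;p}}$$ is an exchange relation in $\mathcal{A}(B,x)$.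
   Context: Notation: $[1,r]=\{1,\dots,r\}$; $\mathfrak{S}_r$ is the group of permutations of $[1,r]$; $\delta$ is the Kronecker delta; $[x]_+=\max(0,x)$. For a square matrix $A$ with entries in $\mathbb{Z}[z^{\pm1}]$, $A^\dagger:=(A|_{z=z^{-1}})^{\mathsf T}$. T-datum: consider triples $(N_0,N_+,N_-)$ of matrices in $\mathrm{Mat}_{r\times r}(\mathbb{Z}[z])$, $N_\varepsilon=(\sum_{p\ge0}n^\varepsilon_{ab;p}z^p)_{a,b\in[1,r]}$, satisfying (N1) $n^0_{ab;p}=\delta_{ab}\delta_{p0}+\delta_{a\sigma(b)}\delta_{pp_a}$ for some $\sigma\in\mathfrak{S}_r$ and $p_a\in\mathbb{Z}_{>0}$; (N2) $n^\pm_{ab;p}\ge0$ for all $a,b,p$; (N3) $n^\pm_{ab;p}=0$ unless $0<p<p_a$; (N4) $n^+_{ab;p}n^-_{ab;p}=0$ for all $a,b,p$. A T-datum of size $r$ is a triple $\alpha=(A_+,A_-,D)$ such that $A_\pm=N_0-N_\pm$ for some $(N_0,N_+,N_-)$ satisfying (N1)-(N4) (this triple is uniquely determined by $(A_+,A_-)$) and $D$ is a positive integer diagonal matrix with $N_0D=DN_0$, $D^{-1}N_\pm D\in\mathrm{Mat}_{r\times r}(\mathbb{Z}[z])$, and $A_+DA_-^\dagger=A_-DA_+^\dagger$. By (N1) the left-hand side of the T-system relation equals $T_a(u)T_{\sigma(a)}(u+p_{\sigma(a)})$. T-algebra: $\mathscr{T}(\alpha)$ is the commutative ring generated by indeterminates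 $T_a(u)^{\pm1}$, $(a,u)\in[1,r]\times\mathbb{Z}$, subject to the T-system relations for all $(a,u)$ and $T_a(u)T_a(u)^{-1}=1$. $\mathscr{T}^\circ(\alpha)$ is the subring generated by all $T_a(u)$. Cluster algebras (trivial coefficients): let $I$ be a finite set. An integer matrix $B=(B_{ij})_{i,j\in I}$ is skew-symmetrizable if there are positive integers $d_i$ with $B_{ij}d_j=-B_{ji}d_i$. The mutation at $k\in I$ sends $(B,x)$ to $(B',x')$ with $B'_{ij}=-B_{ij}$ if $i=k$ or $j=k$, $B'_{ij}=B_{ij}+[B_{ik}]_+[B_{kj}]_+-[-B_{ik}]_+[-B_{kj}]_+$ otherwise, $x'_i=x_i$ for $i\ne k$, and $x_kx'_k=\prod_jx_j^{[B_{jk}]_+}+\prod_jx_j^{[-B_{jk}]_+}$; this last relation is called the exchange relation. The pairs obtained from $(B,x)$ by finite sequences of mutations are called seeds, and the entries of their tuples are called cluster variables. $\mathcal{A}(B,x)$ is the subring of $\mathbb{Q}(x_i)_{i\in I}$ generated by all cluster variables; the exchange relations in $\mathcal{A}(B,x)$ are those attached to the mutations of these seeds. *)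

(* Defs.v *)
From HB Require Import structures.
From mathcomp Require Import all_boot all_order all_fingroup all_algebra.
From mathcomp Require Import generic_quotient.
From mathcomp Require Import boolp.
From mathcomp Require Import -(notations) monalg mpoly.

Set Implicit Arguments.
Unset Strict Implicit.
Unset Printing Implicit Defensive.

Import GRing.Theory Num.Theory.
Local Open Scope ring_scope.
Local Open Scope quotient_scope.

Section GeneratedSubring.
Variables (R : comPzRingType) (S : R -> Prop).

Inductive in_subring : R -> Prop :=
| SubringGen x : S x -> in_subring x
| SubringOne : in_subring 1
| SubringSub x y : in_subring x -> in_subring y -> in_subring (x - y)
| SubringMul x y : in_subring x -> in_subring y -> in_subring (x * y).

Definition gen_subring : {pred R} := fun x => `[< in_subring x >].

Lemma gen_subringP x : reflect (in_subring x) (x \in gen_subring).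
Proof. exact: asboolP. Qed.

Fact gen_subring_closed : subring_closed gen_subring.
Proof.
split; first by apply/gen_subringP; constructor.
- by move=> x y /gen_subringP Sx /gen_subringP Sy; apply/gen_subringP; constructor.
- by move=> x y /gen_subringP Sx /gen_subringP Sy; apply/gen_subringP; constructor.
Qed.

HB.instance Definition _ :=
  GRing.isSubringClosed.Build R gen_subring gen_subring_closed.

Record subring_of : predArgType :=
  Subring { subring_val : R; _ : subring_val \in gen_subring }.

HB.instance Definition _ := [isSub for subring_val].
HB.instance Definition _ := [Choice of subring_of by <:].
HB.instance Definition _ := GRing.SubChoice_isSubComPzRing.Build
  R gen_subring subring_of gen_subring_closed.

Definition subring_gen x (Sx : S x) : subring_of :=
  Subring (introT (gen_subringP x) (SubringGen Sx)).

End GeneratedSubring.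

(* The quotient of P by the ideal generated by all f - g with E f g.  It is only
   a comPzRingType, since 1 may lie in the ideal for a general E. *)
Section IdealQuotient.
Variables (P : comPzRingType) (E : P -> P -> Prop).

Inductive in_ideal : P -> Prop :=
| IdealGen f g : E f g -> in_ideal (f - g)
| IdealZero : in_ideal 0
| IdealAdd f g : in_ideal f -> in_ideal g -> in_ideal (f + g)
| IdealMul h f : in_ideal f -> in_ideal (h * f).

Definition eqv_ideal : rel P := fun f g => `[< in_ideal (f - g) >].

Lemma in_idealN f : in_ideal f -> in_ideal (- f).
Proof. by move=> If; rewrite -mulN1r; constructor. Qed.

Lemma in_idealB f g : in_ideal f -> in_ideal g -> in_ideal (f - g).
Proof. by move=> If Ig; constructor=> //; apply: in_idealN. Qed.

Fact eqv_ideal_equiv : equiv_class_of eqv_ideal.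
Proof.
split=> [f|f g|g f h].
- by apply/asboolP; rewrite subrr; constructor.
- by apply/asboolP/asboolP => /in_idealN; rewrite opprB.
- move=> /asboolP fg /asboolP gh; apply/asboolP.
  by rewrite -(subrKA g); constructor.
Qed.

Canonical eqv_ideal_rel := EquivRelPack eqv_ideal_equiv.

Definition ideal_quotient : Type := {eq_quot eqv_ideal}%qT.

HB.instance Definition _ : EqQuotient P eqv_ideal ideal_quotient :=
  EqQuotient.on ideal_quotient.
HB.instance Definition _ := Choice.on ideal_quotient.

Local Notation Q := ideal_quotient.

Definition quot_zero : Q := lift_cst Q 0.
Definition quot_one : Q := lift_cst Q 1.
Definition quot_opp := lift_op1 Q -%R.
Definition quot_add := lift_op2 Q +%R.
Definition quot_mul := lift_op2 Q *%R.

Canonical pi_quot_zero_morph := PiConst quot_zero.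
Canonical pi_quot_one_morph := PiConst quot_one.

Lemma quot_modP f g : reflect (in_ideal (f - g)) (f == g %[mod Q]).
Proof. by rewrite piE; apply: asboolP. Qed.

Lemma quot_rep f : in_ideal (repr (\pi_Q f) - f).
Proof. by apply/quot_modP; rewrite reprK. Qed.

Lemma pi_quot_opp : {morph \pi_Q : f / - f >-> quot_opp f}.
Proof.
move=> f; unlock quot_opp; apply/eqP/quot_modP.
by rewrite -opprD; apply/in_idealN; rewrite -opprB; apply/in_idealN/quot_rep.
Qed.
Canonical pi_quot_opp_morph := PiMorph1 pi_quot_opp.

Lemma pi_quot_add : {morph \pi_Q : f g / f + g >-> quot_add f g}.
Proof.
move=> f g; unlock quot_add; apply/esym/eqP/quot_modP.
by rewrite opprD addrACA; constructor; apply: quot_rep.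
Qed.
Canonical pi_quot_add_morph := PiMorph2 pi_quot_add.

Lemma pi_quot_mul : {morph \pi_Q : f g / f * g >-> quot_mul f g}.
Proof.
move=> f g; unlock quot_mul; apply/esym/eqP/quot_modP.
set f' := repr _; set g' := repr _.
have -> : f' * g' - f * g = f' * (g' - g) + g * (f' - f).
  by rewrite !mulrBr [g * f']mulrC [g * f]mulrC subrKA.
by do 2!constructor; apply: quot_rep.
Qed.
Canonical pi_quot_mul_morph := PiMorph2 pi_quot_mul.

Fact quot_addA : associative quot_add.
Proof. by move=> x y z; rewrite -[x]reprK -[y]reprK -[z]reprK !piE addrA. Qed.
Fact quot_addC : commutative quot_add.
Proof. by move=> x y; rewrite -[x]reprK -[y]reprK !piE addrC. Qed.
Fact quot_add0 : left_id quot_zero quot_add.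
Proof. by move=> x; rewrite -[x]reprK !piE add0r. Qed.
Fact quot_addN : left_inverse quot_zero quot_opp quot_add.
Proof. by move=> x; rewrite -[x]reprK !piE addNr. Qed.
HB.instance Definition _ :=
  GRing.isZmodule.Build Q quot_addA quot_addC quot_add0 quot_addN.

Fact quot_mulA : associative quot_mul.
Proof. by move=> x y z; rewrite -[x]reprK -[y]reprK -[z]reprK !piE mulrA. Qed.
Fact quot_mulC : commutative quot_mul.
Proof. by move=> x y; rewrite -[x]reprK -[y]reprK !piE mulrC. Qed.
Fact quot_mul1 : left_id quot_one quot_mul.
Proof. by move=> x; rewrite -[x]reprK !piE mul1r. Qed.
Fact quot_mulDl : left_distributive quot_mul +%R.
Proof.
by move=> x y z; rewrite -[x]reprK -[y]reprK -[z]reprK !piE mulrDl.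
Qed.
HB.instance Definition _ := GRing.Zmodule_isComPzRing.Build Q
  quot_mulA quot_mulC quot_mul1 quot_mulDl.

End IdealQuotient.

Section TData.
Variable r : nat.
Implicit Types A N : 'M[{poly int}]_r.

(* Z[z^{+-1}] is realised inside Frac(Z[z]), where z is the image of 'X. *)
Definition laurent_mx A : 'M[{fraction {poly int}}]_r :=
  map_mx (fun f => tofrac f) A.

Definition dagger A : 'M[{fraction {poly int}}]_r :=
  \matrix_(a, b) (map_poly (fun c : int => c%:~R) (A b a)).[(tofrac 'X)^-1].

Definition const_poly_mx (D : 'M[int]_r) : 'M[{poly int}]_r :=
  map_mx polyC D.

(* The period p is attached to the row index a, not to the column index b. *)
Record T_triple (N0 Np Nm : 'M[{poly int}]_r) (sigma : 'S_r) (p : 'I_r -> nat) : Prop := {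
  T_period_gt0 : forall a, (0 < p a)%N;
  T_N1 : forall a b k, (N0 a b)`_k =
    ((a == b) && (k == 0%N))%:R + ((a == sigma b) && (k == p a))%:R;
  T_N2 : forall a b k, 0 <= (Np a b)`_k /\ 0 <= (Nm a b)`_k;
  T_N3 : forall a b k, ~~ (0 < k < p a)%N ->
    (Np a b)`_k = 0 /\ (Nm a b)`_k = 0;
  T_N4 : forall a b k, (Np a b)`_k * (Nm a b)`_k = 0 }.

Definition conj_integral (D : 'M[int]_r) N : Prop :=
  let DL := laurent_mx (const_poly_mx D) in
  exists M, invmx DL *m laurent_mx N *m DL = laurent_mx M.

Record T_datum (Ap Am : 'M[{poly int}]_r) (D : 'M[int]_r)
    (N0 Np Nm : 'M[{poly int}]_r) (sigma : 'S_r) (p : 'I_r -> nat) : Prop := {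
  T_datum_triple : T_triple N0 Np Nm sigma p;
  T_datum_Ap : Ap = N0 - Np;
  T_datum_Am : Am = N0 - Nm;
  T_datum_diag : is_diag_mx D;
  T_datum_pos : forall a, 0 < D a a;
  T_datum_comm : N0 *m const_poly_mx D = const_poly_mx D *m N0;
  T_datum_conj_p : conj_integral D Np;
  T_datum_conj_m : conj_integral D Nm;
  T_datum_sympl :
    let DL := laurent_mx (const_poly_mx D) in
    laurent_mx Ap *m DL *m dagger Am = laurent_mx Am *m DL *m dagger Ap }.

End TData.

Section TAlgebra.
Variable r : nat.
Variables N0 Np Nm : 'M[{poly int}]_r.

(* prod_b prod_(k >= 0) t_b(u + k)^(n_(ba;k)); all exponents are nonnegative
   for the matrices of a T-datum, so taking absolute values is harmless. *)
Definition T_monomial (R : comPzRingType) (t : 'I_r -> int -> R)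
    (N : 'M[{poly int}]_r) (a : 'I_r) (u : int) : R :=
  \prod_(b < r) \prod_(k < size (N b a)) t b (u + k%:Z) ^+ absz (N b a)`_k.

(* inl (a, u) stands for T_a(u) and inr (a, u) for T_a(u)^-1. *)
Definition T_gen : Type := (('I_r * int) + ('I_r * int))%type.
HB.instance Definition _ := Choice.on T_gen.

Definition T_poly : Type := monalg.malg (monalg.cmonom T_gen) int.
HB.instance Definition _ := GRing.ComNzRing.on T_poly.

Definition T_var (g : T_gen) : T_poly := monalg.mkmalgU (monalg.ucm g) 1.
Definition T_pos a u : T_poly := T_var (inl (a, u)).
Definition T_neg a u : T_poly := T_var (inr (a, u)).

Variant T_relation : T_poly -> T_poly -> Prop :=
| T_system a u : T_relation (T_monomial T_pos N0 a u)
    (T_monomial T_pos Np a u + T_monomial T_pos Nm a u)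
| T_inverse a u : T_relation (T_pos a u * T_neg a u) 1.

Definition T_algebra : comPzRingType := ideal_quotient T_relation.

Definition T_elt (a : 'I_r) (u : int) : T_algebra := \pi_T_algebra%qT (T_pos a u).

Definition is_T_elt (t : T_algebra) : Prop := exists a u, t = T_elt a u.

Definition T_circ : comPzRingType := subring_of is_T_elt.

Definition T_circ_elt a u : T_circ :=
  subring_gen (ex_intro _ a (ex_intro _ u (erefl (T_elt a u)))).

End TAlgebra.

(* The left-hand side of a T-system relation has exactly two factors; they are
   the two variables exchanged by the mutation. *)
Lemma T_monomial_N0 (r : nat) (N0 Np Nm : 'M[{poly int}]_r) (sigma : 'S_r)
    (p : 'I_r -> nat) (R : comPzRingType) (t : 'I_r -> int -> R) a u :
  T_triple N0 Np Nm sigma p ->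
  T_monomial t N0 a u = t a u * t (sigma a) (u + (p (sigma a))%:Z).
Proof.
case=> p_gt0 N1 _ _ _; rewrite /T_monomial.
transitivity (\prod_(b < r) ((if b == a then t b u else 1) *
    (if b == sigma a then t b (u + (p b)%:Z) else 1))).
  apply: eq_bigr => b _; set M := maxn (size (N0 b a)) (p b).+1.
  transitivity (\prod_(k < M) t b (u + k%:Z) ^+ absz (N0 b a)`_k).
    rewrite (big_ord_widen_cond M xpredT
      (fun k => t b (u + k%:Z) ^+ absz (N0 b a)`_k)) ?leq_maxl //.
    by rewrite big_mkcond /=; apply: eq_bigr => k _; case: ltnP => // /(nth_default 0) ->.
  have M0 : (0 < M)%N by rewrite leq_max orbT.
  have Mp : (p b < M)%N by rewrite leq_max ltnSn orbT.
  transitivity (\prod_(k < M) ((if (b == a) && (k == Ordinal M0) then t b u else 1) *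
     (if (b == sigma a) && (k == Ordinal Mp) then t b (u + (p b)%:Z) else 1))).
    apply: eq_bigr => k _; rewrite N1 -!val_eqE /= -natrD natz absz_nat exprD.
    congr (_ * _); case: eqP => //= _; case: eqP => [->|_] //=.
    by rewrite addr0.
  rewrite big_split /=; congr (_ * _); case: eqP => _ /=; rewrite ?big1_eq //.
    by rewrite -big_mkcond big_pred1_eq.
  by rewrite -big_mkcond big_pred1_eq.
by rewrite big_split /= -!big_mkcond !big_pred1_eq.
Qed.

Section ClusterAlgebra.
Variables (I : finType) (F : fieldType).
Implicit Types (B : {ffun I * I -> int}) (x : {ffun I -> F}).

Definition pos_part (z : int) : int := Num.max 0 z.

Definition skew_symmetrizable B : Prop :=
  exists2 d : I -> int, (forall i, 0 < d i) &
    forall i j, B (i, j) * d j = - (B (j, i) * d i).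

Definition mut_matrix (k : I) B : {ffun I * I -> int} :=
  [ffun ij => let: (i, j) := ij in
    if (i == k) || (j == k) then - B (i, j)
    else B (i, j) + pos_part (B (i, k)) * pos_part (B (k, j))
         - pos_part (- B (i, k)) * pos_part (- B (k, j))].

Definition exch_pos B x (k : I) : F :=
  \prod_j x j ^+ absz (pos_part (B (j, k))).
Definition exch_neg B x (k : I) : F :=
  \prod_j x j ^+ absz (pos_part (- B (j, k))).

Definition mut_cluster (k : I) B x : {ffun I -> F} :=
  [ffun i => if i == k then (exch_pos B x k + exch_neg B x k) / x k else x i].

Section Seeds.
Variables (B : {ffun I * I -> int}) (x : {ffun I -> F}).

Inductive seed : {ffun I * I -> int} -> {ffun I -> F} -> Prop :=
| SeedInit : seed B x
| SeedMut B' x' k : seed B' x' -> seed (mut_matrix k B') (mut_cluster k B' x').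

Definition cluster_variable (y : F) : Prop :=
  exists B' x' i, seed B' x' /\ y = x' i.

Definition cluster_algebra : comPzRingType := subring_of cluster_variable.

(* "y * y' = m + m'" is the exchange relation of the mutation of some seed
   (B', x') at some k.  Factors and terms are matched in order: y is x'_k, y' is
   the variable replacing it, and m, m' are the products over [B'_jk]_+ and
   [- B'_jk]_+.  The order matters: B and - B have the same seeds up to sign,
   hence the same exchange relations if the factors or terms may be swapped. *)
Definition exchange_relation (y y' m m' : F) : Prop :=
  exists B' x' k, seed B' x' /\
    [/\ y = x' k, y' = mut_cluster k B' x' k,
        m = exch_pos B' x' k & m' = exch_neg B' x' k].

End Seeds.
End ClusterAlgebra.

Definition rat_fun (I : finType) : fieldType :=
  {fraction (mpoly.mpoly #|I| rat)}.

Definition indets (I : finType) : {ffun I -> rat_fun I} :=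
  [ffun i => tofrac (mpoly.mpolyX rat (mpoly.mnm1 (enum_rank i)))].

Definition R_in (r : nat) (p : 'I_r -> nat) : finType := {a : 'I_r & 'I_(p a)}.

(* Main.v *)
Require Import Defs.
From HB Require Import structures.
From mathcomp Require Import all_boot all_order all_fingroup all_algebra.
From mathcomp Require Import finmap generic_quotient boolp.
From mathcomp Require Import -(notations) monalg mpoly.
From mathcomp Require Import ring zify.
Set Implicit Arguments.
Unset Strict Implicit.
Unset Printing Implicit Defensive.
Import Order.TTheory GRing.Theory Num.Theory.
Local Open Scope ring_scope.

(* Shifting the window of the T_a(v) with u <= v < u + p_a by one step is the composite
   of commuting mutations at the variables (a, 0), followed by a relabelling; the
   condition A_+ D A_-^dagger = A_- D A_+^dagger says that this operation restores the
   exchange matrix B.  Hence every T_a(u) goes to a cluster variable, and every T-system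
   relation to an exchange relation.  Up to an invertible factor, every T_a(u) is an integer
   polynomial in the initial ones, whose images are algebraically independent; hence
   injectivity.

   Conversely, suppose that a variable of a given cluster is exchanged in some seed, and
   that both exchange monomials are monomials in the given cluster; then they determine
   its column in the exchange matrix of the given seed.  Applied to all T-system
   relations, this gives the columns at (a, 0) at all times, and the shift carries
   every other column to such a position. *)

(** Condition (3) only asserts that some seed realises each relation: nothing is known about its
    other variables or its matrix. Moreover [B] may be singular, and then exchange binomials need
    not be coprime and say little about the columns. Principal coefficients, one frozen variable per
    column, cure this: the columns of the extended matrix are part of a lattice basis, mutation
    preserves this property, and the Laurent phenomenon is proved in that setting only. Monomials in
    the original cluster lift to the extended one because all expressions involved are
    subtraction-free.

    The ring theory of Laurent polynomials is replaced by weights. A derivation acting diagonally on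
    monomials separates homogeneous parts, so lowest and highest parts of lists of terms behave like
    faces of Newton polytopes, and unique factorisation is never invoked. *)

Definition char0 (F : fieldType) := forall z : int, z%:~R = 0 :> F -> z = 0.

(** * Derivations and Laurent polynomials *)

Section Derivations.
Variable F : fieldType.

Definition derivation (D : F -> F) :=
  (forall x y, D (x + y) = D x + D y) /\
  (forall x y, D (x * y) = D x * y + x * D y).

Definition dlog (D : F -> F) (x : F) := D x / x.

Section OneDerivation.
Variable D : F -> F.
Hypothesis dD : derivation D.

Lemma der0 : D 0 = 0.
Proof. by have := dD.1 0 0; rewrite addr0 => /eqP; rewrite -subr_eq subrr eq_sym => /eqP. Qed.

Lemma der1 : D 1 = 0.
Proof. by have := dD.2 1 1; rewrite !mulr1 mul1r => /eqP; rewrite -subr_eq subrr eq_sym => /eqP. Qed.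

Lemma derN x : D (- x) = - D x.
Proof. by apply/eqP; rewrite -addr_eq0 -dD.1 addNr der0. Qed.

Lemma der_sum (T : Type) (s : seq T) (f : T -> F) :
  D (\sum_(t <- s) f t) = \sum_(t <- s) D (f t).
Proof. by elim: s => [|t s IH]; rewrite ?big_nil ?der0 // !big_cons dD.1 IH. Qed.

Lemma der_int (z : int) : D z%:~R = 0.
Proof.
have Hn n : D n%:R = 0 by elim: n => [|n IH]; rewrite ?der0 // mulrSr dD.1 IH der1 addr0.
by case: z => n; rewrite ?NegzE ?mulrNz ?derN -pmulrn Hn ?oppr0.
Qed.

Lemma der_intM (z : int) x : D (z%:~R * x) = z%:~R * D x.
Proof. by rewrite dD.2 der_int mul0r add0r. Qed.

Lemma der_dlog x : x != 0 -> D x = dlog D x * x.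
Proof. by move=> x0; rewrite /dlog divfK. Qed.

Lemma dlogM x y : x != 0 -> y != 0 -> dlog D (x * y) = dlog D x + dlog D y.
Proof. by move=> x0 y0; rewrite /dlog dD.2; field; rewrite x0 y0. Qed.

Lemma dlog1 : dlog D 1 = 0.
Proof. by rewrite /dlog der1 mul0r. Qed.

Lemma dlogV x : x != 0 -> dlog D x^-1 = - dlog D x.
Proof.
move=> x0; apply/eqP; rewrite -addr_eq0 -dlogM ?invr_eq0 //.
by rewrite mulVf // dlog1.
Qed.

Lemma dlog_exprn x n : x != 0 -> dlog D (x ^+ n) = n%:R * dlog D x.
Proof.
move=> x0; elim: n => [|n IH]; first by rewrite expr0 dlog1 mul0r.
by rewrite exprS dlogM ?expf_neq0 // IH -[n.+1]add1n natrD mulrDl mul1r.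
Qed.

Lemma dlog_exprz x (z : int) : x != 0 -> dlog D (x ^ z) = z%:~R * dlog D x.
Proof.
move=> x0; case: z => n; first by rewrite -exprnP dlog_exprn.
by rewrite NegzE -exprnN dlogV ?expf_neq0 // dlog_exprn // mulrNz mulNr.
Qed.

Lemma dlog_prod (T : Type) (s : seq T) (f : T -> F) :
  (forall t, f t != 0) -> dlog D (\prod_(t <- s) f t) = \sum_(t <- s) dlog D (f t).
Proof.
move=> f0; elim: s => [|t s IH]; first by rewrite !big_nil dlog1.
rewrite !big_cons dlogM ?IH //.
by elim: s {IH} => [|u s IH]; rewrite ?big_nil ?oner_eq0 // big_cons mulf_neq0.
Qed.

(** Eigenvectors for distinct eigenvalues are independent: applying [D - d0] removes the term of
    [d0] and multiplies every other term by [d - d0], which stays nonzero in characteristic 0. *)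
Lemma eigen_indep (c0 : char0 F) (ds : seq int) (y : int -> F) :
  uniq ds -> (forall d, d \in ds -> D (y d) = d%:~R * y d) ->
  \sum_(d <- ds) y d = 0 -> forall d, d \in ds -> y d = 0.
Proof.
elim: ds y => [//|d0 ds IH] y /= /andP[d0n uds] eig sum0.
have eig' d : d \in ds -> D (y d) = d%:~R * y d by move=> dds; apply: eig; rewrite inE dds orbT.
have sub0 d : d \in ds -> y d = 0.
  move=> dds; have: (d - d0)%:~R * y d = 0.
    move: d dds; apply: (IH (fun d => (d - d0)%:~R * y d)) => //.
      by move=> d dds; rewrite der_intM eig' //; ring.
    transitivity (D (\sum_(d <- d0 :: ds) y d) - d0%:~R * \sum_(d <- d0 :: ds) y d).
      rewrite !big_cons dD.1 eig ?mem_head // der_sum mulrDr opprD addrACA subrr add0r.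
      rewrite mulr_sumr -sumrB big_seq [RHS]big_seq; apply: eq_bigr => d dds.
      by rewrite eig' // rmorphB /= mulrBl.
    by rewrite sum0 der0 mulr0 subr0.
  move/eqP; rewrite mulf_eq0 => /orP[/eqP /c0 /eqP|/eqP //].
  by rewrite subr_eq0 => /eqP ed; move: d0n; rewrite -ed dds.
have y0 : y d0 = 0.
  by move: sum0; rewrite big_cons big_seq big1 ?addr0.
by move=> d; rewrite inE => /orP[/eqP ->|/sub0].
Qed.

End OneDerivation.

Lemma derivation_comb (T : finType) (D : T -> F -> F) (c : T -> F) :
  (forall j, derivation (D j)) -> derivation (fun z => \sum_j c j * D j z).
Proof.
move=> dD; split=> x y.
  by rewrite -big_split; apply: eq_bigr => j _; rewrite (dD j).1 mulrDr.
rewrite mulr_suml mulr_sumr -big_split; apply: eq_bigr => j _.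
by rewrite (dD j).2 /= mulrDr !mulrA [x * c j]mulrC.
Qed.

End Derivations.

Section Laurent.
Variables (I : finType) (F : fieldType).
Implicit Types (X : {ffun I -> F}) (m l : {ffun I -> int}) (s t : seq (int * {ffun I -> int})).

Definition mono X m : F := \prod_j X j ^ m j.

Definition unit_exp (i : I) : {ffun I -> int} := [ffun j => (j == i)%:Z].

Lemma expDE m1 m2 i : (m1 + m2) i = m1 i + m2 i. Proof. by rewrite ffunE. Qed.
Lemma expNE m i : (- m) i = - m i. Proof. by rewrite ffunE. Qed.
Lemma expMnE m n i : (m *+ n) i = m i * n%:Z.
Proof. by rewrite ffunMnE -mulr_natr natz. Qed.
Lemma unit_expE i j : unit_exp i j = (j == i)%:Z. Proof. by rewrite ffunE. Qed.
Definition expE := (expDE, expNE, expMnE, unit_expE).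

Definition wt l m : int := \sum_j l j * m j.

Definition nonzero X := forall j, X j != 0.

(* Algebraic independence, in the differential form that mutation preserves
   visibly. *)
Definition free_tuple X := nonzero X /\
  exists D : I -> F -> F, (forall j, derivation (D j)) /\
    forall j i, D j (X i) = (j == i)%:R * X i.

Lemma mono0 X : mono X 0 = 1.
Proof. by rewrite /mono big1 // => j _; rewrite ffunE expr0z. Qed.

Lemma mono_neq0 X m : nonzero X -> mono X m != 0.
Proof. by move=> X0; apply/prodf_neq0 => j _; rewrite expfz_neq0. Qed.

Lemma monoD X m1 m2 : nonzero X -> mono X (m1 + m2) = mono X m1 * mono X m2.
Proof. by move=> X0; rewrite -big_split; apply: eq_bigr => j _; rewrite ffunE expfzDr. Qed.

Lemma monoN X m : nonzero X -> mono X (- m) = (mono X m)^-1.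
Proof. by move=> X0; rewrite -prodfV; apply: eq_bigr => j _; rewrite ffunE -invr_expz. Qed.

Lemma monoB X m1 m2 : nonzero X -> mono X (m1 - m2) = mono X m1 / mono X m2.
Proof. by move=> X0; rewrite monoD // monoN. Qed.

Lemma mono_unit X i : mono X (unit_exp i) = X i.
Proof.
rewrite /mono (bigD1 i) //= ffunE eqxx expr1z big1 ?mulr1 // => j /negPf ji.
by rewrite ffunE ji expr0z.
Qed.

Lemma mono_exprn X m n : mono X m ^+ n = mono X (m *+ n).
Proof.
rewrite /mono -prodrXl; apply: eq_bigr => j _.
by rewrite ffunMnE [LHS]exprnP exprz_exp -mulr_natr natz.
Qed.

Lemma wtD l m1 m2 : wt l (m1 + m2) = wt l m1 + wt l m2.
Proof. by rewrite /wt -big_split; apply: eq_bigr => j _; rewrite ffunE mulrDr. Qed.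

Lemma wtN l m : wt l (- m) = - wt l m.
Proof. by rewrite /wt -sumrN; apply: eq_bigr => j _; rewrite ffunE mulrN. Qed.

Lemma wtB l m1 m2 : wt l (m1 - m2) = wt l m1 - wt l m2.
Proof. by rewrite wtD wtN. Qed.

Lemma wt0 l : wt l 0 = 0.
Proof. by rewrite /wt big1 // => j _; rewrite ffunE mulr0. Qed.

Lemma wtNl l m : wt (- l) m = - wt l m.
Proof. by rewrite /wt -sumrN; apply: eq_bigr => j _; rewrite ffunE mulNr. Qed.

Lemma wt_unitl i m : wt (unit_exp i) m = m i.
Proof.
rewrite /wt (bigD1 i) //= ffunE eqxx mul1r big1 ?addr0 // => j /negPf ji.
by rewrite ffunE ji mul0r.
Qed.

Definition ev X s : F := \sum_(a <- s) a.1%:~R * mono X a.2.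

Definition lopp s : seq (int * {ffun I -> int}) := [seq (- a.1, a.2) | a <- s].

Definition lmul s t : seq (int * {ffun I -> int}) :=
  [seq (a.1 * b.1, a.2 + b.2) | a <- s, b <- t].

Lemma ev_nil X : ev X [::] = 0.
Proof. exact: big_nil. Qed.

Lemma ev_cons X a s : ev X (a :: s) = a.1%:~R * mono X a.2 + ev X s.
Proof. exact: big_cons. Qed.

Lemma ev_seq1 X a : ev X [:: a] = a.1%:~R * mono X a.2.
Proof. by rewrite ev_cons ev_nil addr0. Qed.

Lemma ev_cat X s t : ev X (s ++ t) = ev X s + ev X t.
Proof. exact: big_cat. Qed.

Lemma ev_opp X s : ev X (lopp s) = - ev X s.
Proof. by rewrite /ev big_map -sumrN; apply: eq_bigr => a _; rewrite mulrNz mulNr. Qed.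

Lemma ev_mul X s t : nonzero X -> ev X (lmul s t) = ev X s * ev X t.
Proof.
move=> X0; rewrite /ev big_allpairs_dep mulr_suml; apply: eq_bigr => a _.
rewrite mulr_sumr; apply: eq_bigr => b _ /=.
by rewrite rmorphM /= monoD //; ring.
Qed.

Definition laurent X (z : F) := exists s, z = ev X s.

Section LaurentRing.
Variable X : {ffun I -> F}.
Hypothesis X0 : nonzero X.

Lemma laurent_mono m : laurent X (mono X m).
Proof. by exists [:: (1, m)]; rewrite ev_seq1 mul1r. Qed.

Lemma laurent_int (z : int) : laurent X z%:~R.
Proof. by exists [:: (z, 0)]; rewrite ev_seq1 mono0 mulr1. Qed.

Lemma laurent0 : laurent X 0. Proof. exact: (laurent_int 0). Qed.
Lemma laurent1 : laurent X 1. Proof. exact: (laurent_int 1). Qed.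

Lemma laurent_var i : laurent X (X i).
Proof. by rewrite -mono_unit; apply: laurent_mono. Qed.

Lemma laurentD x y : laurent X x -> laurent X y -> laurent X (x + y).
Proof. by move=> [s ->] [t ->]; exists (s ++ t); rewrite ev_cat. Qed.

Lemma laurentN x : laurent X x -> laurent X (- x).
Proof. by move=> [s ->]; exists (lopp s); rewrite ev_opp. Qed.

Lemma laurentB x y : laurent X x -> laurent X y -> laurent X (x - y).
Proof. by move=> Lx Ly; apply/laurentD/laurentN. Qed.

Lemma laurentM x y : laurent X x -> laurent X y -> laurent X (x * y).
Proof. by move=> [s ->] [t ->]; exists (lmul s t); rewrite ev_mul. Qed.

Lemma laurentXn x n : laurent X x -> laurent X (x ^+ n).
Proof.
move=> Lx; elim: n => [|n IH]; first by rewrite expr0; apply: laurent1.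
by rewrite exprS; apply: laurentM.
Qed.

Lemma laurent_prod (T : finType) (f : T -> F) :
  (forall u, laurent X (f u)) -> laurent X (\prod_u f u).
Proof.
move=> Lf; elim/big_rec: _ => [|u x _ Lx]; first exact: laurent1.
exact: laurentM.
Qed.

End LaurentRing.

Section FreeTuple.
Variable X : {ffun I -> F}.
Hypotheses (c0 : char0 F) (fX : free_tuple X).
Let X0 : nonzero X := fX.1.

(** An Euler operator: the combination of the logarithmic derivations with coefficients [l]. Its
    eigenspaces are the homogeneous parts for the weight [l]. *)
Lemma weight_derivation l : exists D, derivation D /\
  forall m, D (mono X m) = (wt l m)%:~R * mono X m.
Proof.
have [_ [D [dD DX]]] := fX.
exists (fun z => \sum_j (l j)%:~R * D j z); split; first exact: derivation_comb.
move=> m; rewrite /wt rmorph_sum mulr_suml; apply: eq_bigr => j _.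
rewrite rmorphM /= (der_dlog _ (mono_neq0 m X0)) mulrA; congr (_ * _); congr (_ * _).
have dX i : dlog (D j) (X i) = (j == i)%:R by rewrite /dlog DX mulfK.
rewrite /mono dlog_prod // => [|i]; last by rewrite expfz_neq0.
rewrite (bigD1 j) //= dlog_exprz // dX eqxx mulr1 big1 ?addr0 // => i ij.
by rewrite dlog_exprz // dX eq_sym (negPf ij) mulr0.
Qed.

Definition part l (d : int) s := [seq a <- s | wt l a.2 == d].

(** Homogeneous parts are eigenvectors for distinct eigenvalues. Consequently the value of a part
    depends on the value of the list only, although many lists represent the same element. *)
Lemma ev_part0 l d s : ev X s = 0 -> ev X (part l d s) = 0.
Proof.
move=> s0; pose ds := undup [seq wt l a.2 | a <- s].
have [dds|dds] := boolP (d \in ds); last first.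
  suff -> : part l d s = [::] by rewrite ev_nil.
  apply/eqP; rewrite -[_ == _]negbK -has_filter; apply: contra dds => /hasP[a as_ /eqP <-].
  by rewrite mem_undup; apply/mapP; exists a.
have [D [dD Dm]] := weight_derivation l.
apply: (@eigen_indep _ D dD c0 ds (fun e => ev X (part l e s)) (undup_uniq _)) dds => [e _|].
  rewrite /ev der_sum // mulr_sumr big_seq [RHS]big_seq; apply: eq_bigr => a.
  by rewrite mem_filter => /andP[/eqP <- _]; rewrite der_intM // Dm; ring.
rewrite -[RHS]s0 /ev [RHS]big_seq; under [LHS]eq_bigr do rewrite big_filter big_mkcond.
rewrite exchange_big /= big_seq; apply: eq_bigr => a as_.
have ads : wt l a.2 \in ds by rewrite mem_undup; apply/mapP; exists a.
rewrite (bigD1_seq _ ads) ?undup_uniq //= eqxx big1 ?addr0 // => e /negPf.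
by rewrite eq_sym => ->.
Qed.

Lemma ev_part l d s t : ev X s = ev X t -> ev X (part l d s) = ev X (part l d t).
Proof.
move=> st; apply/eqP; rewrite -subr_eq0 -ev_opp -ev_cat; apply/eqP.
have -> : part l d s ++ lopp (part l d t) = part l d (s ++ lopp t).
  by rewrite /part filter_cat /lopp filter_map.
by apply: ev_part0; rewrite ev_cat ev_opp st subrr.
Qed.

Lemma ev_split l d s :
  ev X s = ev X (part l d s) + ev X [seq a <- s | wt l a.2 != d].
Proof. by rewrite /ev !big_filter [LHS](bigID (fun a => wt l a.2 == d)). Qed.

Definition coef s m : int := \sum_(a <- s | a.2 == m) a.1.

Lemma ev_exp s m : ev X [seq a : int * {ffun I -> int} <- s | a.2 == m] = (coef s m)%:~R * mono X m.
Proof.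
rewrite /ev big_filter rmorph_sum mulr_suml; apply: eq_bigr => a /eqP <- //.
Qed.

(** A single exponent is isolated by filtering along every coordinate weight in turn, so coefficient
    extraction reduces to [ev_part0]. *)
Lemma iter_part s m :
  foldr (fun j r => part (unit_exp j) (m j) r) s (enum I) = [seq a : int * {ffun I -> int} <- s | a.2 == m].
Proof.
transitivity [seq a : int * {ffun I -> int} <- s | all (fun j => a.2 j == m j) (enum I)].
  elim: (enum I) => [|j r IH] /=; first by rewrite filter_predT.
  by rewrite IH /part -filter_predI; apply: eq_filter => a /=; rewrite wt_unitl.
apply: eq_filter => a; apply/allP/eqP => [am|-> //].
by apply/ffunP => j; apply/eqP/am; rewrite mem_enum.
Qed.

Lemma ev_coef0 s m : ev X s = 0 -> coef s m = 0.
Proof.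
move=> s0; have: ev X [seq a : int * {ffun I -> int} <- s | a.2 == m] = 0.
  by rewrite -iter_part; elim: (enum I) => //= j r IH; apply: ev_part0.
rewrite ev_exp => /eqP; rewrite mulf_eq0 (negPf (mono_neq0 _ X0)) orbF => /eqP.
exact: c0.
Qed.

(** Positive coefficients cannot cancel: the coefficient of the first exponent is a sum of positive
    integers. *)
Lemma ev_pos_neq0 s : s != [::] -> all (fun a => 0 < a.1) s -> ev X s != 0.
Proof.
case: s => // a s _ /= /andP[a0 s0]; apply/eqP => /(ev_coef0 a.2) /eqP.
rewrite /coef big_cons eqxx; apply/negP; rewrite gt_eqF // ltr_wpDr //.
by rewrite big_seq_cond sumr_ge0 // => b /andP[bs _]; apply/ltW/(allP s0).
Qed.

(** A sum of two weights bounded below by [d] and [e] equals [d + e] only if both bounds are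
    attained. *)
Lemma part_lmul_low l d e s t :
  all (fun a => d <= wt l a.2) s -> all (fun a => e <= wt l a.2) t ->
  ev X (part l (d + e) (lmul s t)) = ev X (part l d s) * ev X (part l e t).
Proof.
move=> /allP sd /allP te; rewrite -ev_mul //; congr (ev X _).
rewrite /part /lmul; elim: s sd => //= a s IH sd.
rewrite filter_cat IH => [|b bs]; last by apply: sd; rewrite inE bs orbT.
have: d <= wt l a.2 by apply: sd; rewrite mem_head.
case: eqP => [ad|/eqP ad] da /=.
  congr cat; rewrite filter_map; congr map; apply: eq_filter => b /=.
  by rewrite wtD ad (inj_eq (addrI d)).
rewrite (eq_in_filter (a2 := pred0)) ?filter_pred0 //= => c /mapP[b bt ->] /=.
by apply/eqP; rewrite wtD; have /= := te b bt; lia.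
Qed.

Lemma part_lmul_hom l d e s t : all (fun a => wt l a.2 == e) s ->
  ev X (part l d (lmul s t)) = ev X s * ev X (part l (d - e) t).
Proof.
move=> /allP se; rewrite -ev_mul //; congr (ev X _).
rewrite /part /lmul; elim: s se => //= a s IH se.
rewrite filter_cat IH => [|b bs]; last by apply: se; rewrite inE bs orbT.
congr cat; rewrite filter_map; congr map; apply: eq_filter => b /=.
have /eqP ae := se a (mem_head _ _).
by rewrite wtD ae; apply/eqP/eqP; lia.
Qed.

(* [low l d z]: the [l]-adic valuation of the Laurent polynomial [z] is [d]. *)
Definition low l d (z : F) := exists s,
  [/\ z = ev X s, all (fun a => d <= wt l a.2) s & ev X (part l d s) != 0].

Lemma low_uniq l d e z : low l d z -> low l e z -> d = e.
Proof.
wlog: d e / d < e.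
  move=> H Hd He; case: (ltgtP d e) => // [lt|lt]; first exact: (H d e).
  by symmetry; apply: (H e d).
move=> lt_de [s [-> _ s0]] [t [/(ev_part l d) st td _]].
move: s0; rewrite st [part l d t](eq_in_filter (a2 := pred0)) ?filter_pred0 ?ev_nil ?eqxx //.
by move=> a /(allP td) /= ea; apply/negbTE/eqP; lia.
Qed.

Lemma lowM l d e x y : low l d x -> low l e y -> low l (d + e) (x * y).
Proof.
move=> [s [-> sd s0]] [t [-> td t0]]; exists (lmul s t); split; rewrite ?ev_mul //.
  by apply/allP => _ /allpairsP[[a b] /= [/(allP sd) /= ? /(allP td) /= ? ->]]; rewrite wtD lerD.
by rewrite part_lmul_low // mulf_neq0.
Qed.

Lemma low_mono l c m : c != 0 -> low l (wt l m) (c%:~R * mono X m).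
Proof.
move=> c_n0; exists [:: (c, m)]; split; rewrite ?ev_seq1 //= ?lexx //.
rewrite eqxx ev_seq1 mulf_neq0 ?mono_neq0 //.
by apply: contra c_n0 => /eqP /c0 /eqP.
Qed.

Lemma low1 l : low l 0 1.
Proof. by rewrite -[1]mulr1 -{2}(mono0 X) -(wt0 l); apply: (@low_mono l 1). Qed.

Lemma lowXn l d x n : low l d x -> low l (d *+ n) (x ^+ n).
Proof.
move=> lx; elim: n => [|n IH]; first by rewrite mulr0n expr0; apply: low1.
by rewrite mulrS exprS; apply: lowM.
Qed.

Lemma min_weight l s : s != [::] ->
  exists2 a, a \in s & all (fun b => wt l a.2 <= wt l b.2) s.
Proof.
elim: s => // b s IH _; case: (eqVneq s [::]) => [->|/IH [a as_ amin]].
  by exists b; rewrite ?mem_head //= lexx.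
have [ba|/ltW ab] := leP (wt l b.2) (wt l a.2).
  exists b; rewrite ?mem_head //= lexx /=; apply/allP => c /(allP amin).
  exact: le_trans.
by exists a; rewrite ?inE ?as_ ?orbT //= ab.
Qed.

(** The terms of least weight in a given list may add up to 0; dropping them shortens the list
    without changing its value. *)
Lemma low_exists l z : z != 0 -> laurent X z -> exists d, low l d z.
Proof.
move=> z0 [s]; have [n] := ubnP (size s); elim: n s => // n IH s sn zs.
have [a as_ amin] : exists2 a, a \in s & all (fun b => wt l a.2 <= wt l b.2) s.
  by apply: min_weight; apply: contra z0 => /eqP s0; rewrite zs s0 ev_nil.
have [p0|p0] := eqVneq (ev X (part l (wt l a.2) s)) 0; last first.
  by exists (wt l a.2), s.
apply: (IH [seq b <- s | wt l b.2 != wt l a.2]); last first.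
  by rewrite zs (ev_split l (wt l a.2)) p0 add0r.
rewrite -ltnS; apply: leq_trans sn; rewrite ltnS size_filter -(count_predC (fun b => wt l b.2 == wt l a.2) s).
by rewrite -{1}[count _ s]add0n ltn_add2r -has_count; apply/hasP; exists a.
Qed.

(** The valuation for [- l] is minus the highest weight, so [z] has no parts outside the interval
    from [d] to [- e]; when the interval is a point, [z] is homogeneous. *)
Lemma low_high l d e z s : z = ev X s -> low l d z -> low (- l) e z ->
  d <= - e /\ (d = - e -> z = ev X (part l d s)).
Proof.
move=> zs [t [zt td t0]] [u [zu ue u0]].
have part_out f : (f < d) || (- e < f) -> ev X (part l f s) = 0.
  case/orP => [fd|ef].
    rewrite (@ev_part l f s t) -?zs // [part l f t](eq_in_filter (a2 := pred0)).
      by rewrite filter_pred0 ev_nil.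
    by move=> a /(allP td) /= ?; apply/negbTE/eqP; lia.
  rewrite (@ev_part l f s u) -?zs // [part l f u](eq_in_filter (a2 := pred0)).
    by rewrite filter_pred0 ev_nil.
  by move=> a /(allP ue) /=; rewrite wtNl => ?; apply/negbTE/eqP; lia.
have td0 : ev X (part l d s) != 0 by rewrite (@ev_part l d s t) -?zs.
split=> [|de]; first by rewrite leNgt; apply/negP => ed; move: td0; rewrite part_out ?eqxx // ed orbT.
rewrite (@ev_part l d s t) -?zs // zt (ev_split l d t) (_ : ev X [seq a <- t | _] = 0) ?addr0 //.
(* A nonzero remainder would have a lowest weight above [d = - e], where all parts of [z] vanish. *)
set r := [seq a <- t | _]; apply/eqP; apply: contraT => r0.
have [f [w [rw wf w0]]] : exists f, low l f (ev X r) by apply: low_exists => //; exists r.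
have := @ev_part l f _ _ rw.
have fd : d < f.
  apply: contraNT w0; rewrite -leNgt => fd.
  rewrite -(@ev_part l f r w) // (_ : part l f r = [::]) ?ev_nil //.
  apply/eqP; rewrite -[_ == _]negbK -has_filter; apply/hasPn => a.
  by rewrite mem_filter => /andP[ad /(allP td) /= da]; apply/eqP; move/eqP: ad; lia.
have : ev X (part l f s) = 0 by apply: part_out; rewrite -de fd orbT.
rewrite (@ev_part l f s t) -?zs // => pt0 pr; move: w0; rewrite -pr.
rewrite (_ : part l f r = part l f t) ?pt0 ?eqxx // /part /r -filter_predI.
by apply: eq_filter => a /=; case: eqP => //= ->; rewrite gt_eqF.
Qed.

Lemma homogeneous_mono z : laurent X z ->
  (forall j, exists d, low (unit_exp j) d z /\ low (- unit_exp j) (- d) z) ->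
  exists c m, z = c%:~R * mono X m.
Proof.
move=> [s zs] /fin_all_exists[m0 mP]; pose m := [ffun j => m0 j].
exists (coef s m), m; rewrite -ev_exp -iter_part.
elim: (enum I) => //= j r IH.
have [lo hi] := mP j; have [_] := low_high IH lo hi.
by rewrite opprK /m ffunE => <-.
Qed.

(** Lowest and highest weights are additive under products. They coincide for a monomial, hence for
    each of its factors: the Newton polytope of a factor is a point. *)
Lemma factor_mono x y c m : c != 0 -> laurent X x -> laurent X y ->
  x * y = c%:~R * mono X m -> exists k n, x = k%:~R * mono X n.
Proof.
move=> c_n0 Lx Ly xy; have xy0 : x * y != 0.
  rewrite xy mulf_neq0 ?mono_neq0 //; by apply: contra c_n0 => /eqP /c0 /eqP.
have [x0 y0] : x != 0 /\ y != 0 by move: xy0; rewrite mulf_eq0 negb_or => /andP.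
apply: homogeneous_mono => // j.
have [d ld] := low_exists (unit_exp j) x0 Lx; have [e le] := low_exists (unit_exp j) y0 Ly.
have [d' ld'] := low_exists (- unit_exp j) x0 Lx.
have [e' le'] := low_exists (- unit_exp j) y0 Ly.
have := lowM ld le; rewrite xy => /low_uniq /(_ (low_mono _ _ c_n0)) de.
have := lowM ld' le'; rewrite xy => /low_uniq /(_ (low_mono _ _ c_n0)); rewrite wtNl => de'.
have [[s sx] [t ty]] := (Lx, Ly).
have [dd' _] := low_high sx ld ld'; have [ee' _] := low_high ty le le'.
by exists d; split=> //; rewrite (_ : - d = d') //; lia.
Qed.

Lemma unit_mono x y : laurent X x -> laurent X y -> x * y = 1 ->
  exists k n, (k = 1 \/ k = -1) /\ x = k%:~R * mono X n.
Proof.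
move=> Lx Ly xy; have xy' : x * y = 1%:~R * mono X 0 by rewrite mono0 mulr1.
have [k [n xk]] := factor_mono (oner_neq0 int) Lx Ly xy'.
have [k' [n' yk]] := factor_mono (oner_neq0 int) Ly Lx (etrans (mulrC y x) xy').
exists k, n; split=> //.
have xyE : ev X [:: (k * k', n + n'); (-1, 0)] = 0.
  rewrite ev_cons ev_seq1 /= rmorphM /= monoD // mono0 rmorphN /= mulr1.
  by transitivity (x * y - 1); [rewrite xk yk; ring | rewrite xy subrr].
have := ev_coef0 0 xyE; rewrite /coef !big_cons big_nil /= eqxx addr0.
case: eqP => // _ /eqP; rewrite subr_eq0 => /eqP /(congr1 absz)/eqP.
by rewrite abszM muln_eq1 => /andP[/eqP k1 _]; lia.
Qed.

(** The Newton segment of the product must be parallel to that of the factor. If [l] separated [m1]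
    from [m2], one homogeneous part of [g] would make the first binomial a divisor of a monomial,
    hence itself a monomial, against [b1 != b2]. *)
Lemma binomial_factor l b1 b2 m1 m2 g : b1 != b2 -> laurent X g ->
  (mono X b1 + mono X b2) * g = mono X m1 + mono X m2 ->
  wt l b1 = wt l b2 -> wt l m1 = wt l m2.
Proof.
move=> b12 [t gt] E lb; apply/eqP; apply: contraT => lm.
have [g' Lg' Eg'] : exists2 g', laurent X g' & (mono X b1 + mono X b2) * g' = mono X m1.
  exists (ev X (part l (wt l m1 - wt l b1) t)); first by exists (part l (wt l m1 - wt l b1) t).
  have -> : mono X b1 + mono X b2 = ev X [:: (1, b1); (1, b2)].
    by rewrite ev_cons ev_seq1 !mul1r.
  rewrite -part_lmul_hom /= ?lb ?eqxx //.
  rewrite (@ev_part l (wt l m1) _ [:: (1, m1); (1, m2)]); last first.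
    by rewrite ev_mul // -gt !ev_cons !ev_nil !mul1r !addr0.
  by rewrite /= eqxx eq_sym (negPf lm) ev_seq1 mul1r.
have Lb : laurent X (mono X b1 + mono X b2) by apply: laurentD; apply: laurent_mono.
have [k [n Ek]] : exists k n, mono X b1 + mono X b2 = k%:~R * mono X n.
  by apply: (factor_mono (oner_neq0 int) (m := m1) Lb Lg'); rewrite Eg' mul1r.
have E0 : ev X [:: (1, b1); (1, b2); (- k, n)] = 0.
  by rewrite !ev_cons ev_nil /= !mul1r rmorphN /= mulNr addr0 addrA Ek subrr.
have := ev_coef0 b1 E0; have := ev_coef0 b2 E0.
rewrite /coef !big_cons big_nil /= !eqxx [b2 == b1]eq_sym (negPf b12).
case: eqP => [nb2 _|_] //; rewrite nb2 eq_sym (negPf b12) big_nil //.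
Qed.

(* Filtering by a weight for which the first binomial is homogeneous and the
   second one is not, the lowest part of any [f] with [a | c f] is divisible by [a]. *)
Lemma binomial_regular l b1 b2 c1 c2 (k : int) f g :
  wt l b1 = wt l b2 -> wt l c1 != wt l c2 ->
  laurent X f -> laurent X g ->
  (mono X c1 + k%:~R * mono X c2) * f = (mono X b1 + mono X b2) * g ->
  exists2 h, laurent X h & f = (mono X b1 + mono X b2) * h.
Proof.
wlog: l / wt l c1 < wt l c2.
  move=> H lb lc; case: (ltgtP (wt l c1) (wt l c2)) => [lt|lt|eq]; first exact: (H l).
    by apply: (H (- l)); rewrite !wtNl ?lb ?ltrN2 // eqr_opp.
  by rewrite eq eqxx in lc.
move=> lt12 lb _ [s fs]; set a := mono X b1 + mono X b2; set c := mono X c1 + _.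
have ac : a = ev X [:: (1, b1); (1, b2)] by rewrite ev_cons ev_seq1 !mul1r.
have cc : c = ev X [:: (1, c1); (k, c2)] by rewrite ev_cons ev_seq1 mul1r.
have La : laurent X a by exists [:: (1, b1); (1, b2)].
have Lc : laurent X c by exists [:: (1, c1); (k, c2)].
have [n] := ubnP (size s); elim: n s f fs g => // n IH s f fs g sn [t gt] E.
have [s0|/(min_weight l) [v vs vmin]] := eqVneq s [::].
  by exists 0; rewrite ?mulr0 ?fs ?s0 ?ev_nil //; apply: laurent0.
set d := wt l v.2 in vmin.
have [h0 Lh0 Eh0] : exists2 h, laurent X h & ev X (part l d s) = a * h.
  exists (mono X (- c1) * ev X (part l (wt l c1 + d - wt l b1) t)).
    by apply: laurentM => //; [apply: laurent_mono|exists (part l (wt l c1 + d - wt l b1) t)].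
  rewrite mulrCA ac -part_lmul_hom /= -?lb ?eqxx //.
  rewrite (@ev_part l (wt l c1 + d) _ (lmul [:: (1, c1); (k, c2)] s)); last first.
    by rewrite !ev_mul // -ac -cc -gt -fs.
  rewrite part_lmul_low //= ?lexx ?ltW // eqxx gt_eqF // ev_seq1 mul1r monoN //.
  by rewrite mulrA mulVf ?mul1r // mono_neq0.
have [h1 Lh1 Eh1] : exists2 h, laurent X h & ev X [seq b <- s | wt l b.2 != d] = a * h.
  apply: (IH _ _ erefl (g - c * h0)).
  - rewrite -ltnS; apply: leq_trans sn; rewrite ltnS size_filter.
    rewrite -(count_predC (fun b => wt l b.2 == d) s) -{1}[count _ s]add0n ltn_add2r -has_count.
    by apply/hasP; exists v; rewrite //= eqxx.
  - by apply: laurentB; [exists t|apply: laurentM].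
  - rewrite mulrBr -E fs (ev_split l d s) Eh0; ring.
exists (h0 + h1); first exact: laurentD.
by rewrite fs (ev_split l d) Eh0 Eh1 mulrDr.
Qed.

End FreeTuple.
End Laurent.

(** * Mutations *)

Lemma pos_part_ge0 z : 0 <= pos_part z.
Proof. by rewrite /pos_part le_max lexx. Qed.

Lemma pos_partN z : pos_part (- z) = pos_part z - z.
Proof. by rewrite /pos_part; case: (leP 0 z) => ?; case: (leP 0 (- z)) => ?; lia. Qed.

Lemma pos_part0 : pos_part 0 = 0.
Proof. by rewrite /pos_part maxxx. Qed.

Lemma pos_part_pos z : 0 <= z -> pos_part z = z.
Proof. by move=> z0; apply/max_idPr. Qed.

Lemma pos_part_neg z : z <= 0 -> pos_part z = 0.
Proof. by move=> z0; apply/max_idPl. Qed.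

Lemma pos_partMl z c : 0 <= c -> pos_part (z * c) = pos_part z * c.
Proof.
by move=> c0; rewrite /pos_part maxr_pMl // mul0r.
Qed.

Section Mutation.
Variables (I : finType) (F : fieldType).
Implicit Types (B : {ffun I * I -> int}) (X : {ffun I -> F}).

Definition bcol B k : {ffun I -> int} := [ffun j => B (j, k)].
Definition pcol B k : {ffun I -> int} := [ffun j => pos_part (B (j, k))].
Definition ncol B k : {ffun I -> int} := [ffun j => pos_part (- B (j, k))].

Lemma bcolE B k j : bcol B k j = B (j, k). Proof. by rewrite ffunE. Qed.
Lemma pcolE B k j : pcol B k j = pos_part (B (j, k)). Proof. by rewrite ffunE. Qed.
Lemma ncolE B k j : ncol B k j = pos_part (- B (j, k)). Proof. by rewrite ffunE. Qed.

Lemma pncol B k : pcol B k - ncol B k = bcol B k.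
Proof. by apply/ffunP => j; rewrite !ffunE pos_partN; ring. Qed.

Lemma exch_posE B X k : exch_pos B X k = mono X (pcol B k).
Proof. by apply: eq_bigr => j _; rewrite ffunE exprnP gez0_abs ?pos_part_ge0. Qed.

Lemma exch_negE B X k : exch_neg B X k = mono X (ncol B k).
Proof. by apply: eq_bigr => j _; rewrite ffunE exprnP gez0_abs ?pos_part_ge0. Qed.

Definition exch B X k := mono X (pcol B k) + mono X (ncol B k).

Lemma mut_cluster_self B X k : mut_cluster k B X k = exch B X k / X k.
Proof. by rewrite ffunE eqxx exch_posE exch_negE. Qed.

Lemma mut_cluster_other B X k j : j != k -> mut_cluster k B X j = X j.
Proof. by move=> /negPf jk; rewrite ffunE jk. Qed.

Definition skew_by (d : I -> int) B :=
  (forall i, 0 < d i) /\ forall i j, B (i, j) * d j = - (B (j, i) * d i).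

Lemma skew_diag d B i : skew_by d B -> B (i, i) = 0.
Proof. by move=> [d0 sk]; have := sk i i; have := d0 i; nia. Qed.

Lemma skew_lt0 d B i j : skew_by d B -> B (i, j) < 0 -> 0 < B (j, i).
Proof. by move=> [d0 sk]; have := sk i j; have := d0 i; have := d0 j; nia. Qed.

Lemma skew_eq0 d B i j : skew_by d B -> B (i, j) = 0 -> B (j, i) = 0.
Proof.
move=> [d0 sk] Bij; have := sk i j; rewrite Bij mul0r => /esym /eqP.
by rewrite oppr_eq0 mulf_eq0 (gt_eqF (d0 i)) orbF => /eqP.
Qed.

Lemma mut_matrix_in k B i j : (i == k) || (j == k) -> mut_matrix k B (i, j) = - B (i, j).
Proof. by rewrite ffunE => ->. Qed.

Lemma mut_matrix_out k B i j : i != k -> j != k -> mut_matrix k B (i, j) =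
  B (i, j) + pos_part (B (i, k)) * pos_part (B (k, j)) -
    pos_part (- B (i, k)) * pos_part (- B (k, j)).
Proof. by move=> /negPf ik /negPf jk; rewrite ffunE ik jk. Qed.

Lemma mut_matrix_lin k B i j : i != k -> j != k -> mut_matrix k B (i, j) =
  B (i, j) + pos_part (B (i, k)) * B (k, j) + B (i, k) * pos_part (- B (k, j)).
Proof. by move=> ik jk; rewrite mut_matrix_out // !pos_partN; ring. Qed.

Lemma skew_mut d B k : skew_by d B -> skew_by d (mut_matrix k B).
Proof.
move=> [d0 sk]; split=> // i j.
have [h|] := boolP ((i == k) || (j == k)).
  by rewrite !mut_matrix_in ?[(j == k) || _]orbC // !mulNr sk.
rewrite negb_or => /andP[ik jk]; rewrite !mut_matrix_out //.
have pd a b : pos_part (B (a, b)) * d b = pos_part (- B (b, a)) * d a.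
  by rewrite -!pos_partMl ?ltW // sk mulNr.
have nd a b : pos_part (- B (a, b)) * d b = pos_part (B (b, a)) * d a.
  by rewrite -!pos_partMl ?ltW // mulNr sk opprK.
rewrite !mulrBl !mulrDl sk -!mulrA (pd k j) (nd k j) (pd k i) (nd k i).
ring.
Qed.

Lemma skew_opp d B : skew_by d B -> skew_by d (- B).
Proof. by move=> [d0 sk]; split=> // i j; rewrite !ffunE !mulNr sk. Qed.

Lemma mut_matrix_opp k B : mut_matrix k (- B) = - mut_matrix k B.
Proof.
apply/ffunP => -[i j]; rewrite [RHS]ffunE.
have [h|] := boolP ((i == k) || (j == k)); first by rewrite !mut_matrix_in // ffunE.
by rewrite negb_or => /andP[ik jk]; rewrite !mut_matrix_out // !ffunE !opprK; ring.
Qed.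

Lemma mut_cluster_opp k B X : mut_cluster k (- B) X = mut_cluster k B X.
Proof.
apply/ffunP => i; rewrite !ffunE; case: eqP => // _; rewrite addrC; congr ((_ + _) / _).
  by apply: eq_bigr => j _; rewrite ffunE opprK.
by apply: eq_bigr => j _; rewrite ffunE.
Qed.

Lemma mut_matrixK k B : B (k, k) = 0 -> mut_matrix k (mut_matrix k B) = B.
Proof.
move=> Bkk; apply/ffunP => -[i j].
have [h|] := boolP ((i == k) || (j == k)); first by rewrite !mut_matrix_in // opprK.
rewrite negb_or => /andP[ik jk]; rewrite mut_matrix_out // mut_matrix_out // !mut_matrix_in ?eqxx ?orbT //.
by rewrite !opprK; ring.
Qed.

Lemma pcol_mut B k : pcol (mut_matrix k B) k = ncol B k.
Proof. by apply/ffunP => j; rewrite ffunE mut_matrix_in ?eqxx ?orbT // ffunE. Qed.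

Lemma ncol_mut B k : ncol (mut_matrix k B) k = pcol B k.
Proof. by apply/ffunP => j; rewrite ffunE mut_matrix_in ?eqxx ?orbT // opprK ffunE. Qed.

Lemma mono_ext X (Y : {ffun I -> F}) (m : {ffun I -> int}) : (forall j, m j != 0 -> X j = Y j) -> mono X m = mono Y m.
Proof.
move=> XY; apply: eq_bigr => j _; have [->|/XY -> //] := eqVneq (m j) 0.
by rewrite !expr0z.
Qed.

Lemma pcol_diag B k : B (k, k) = 0 -> pcol B k k = 0.
Proof. by rewrite ffunE => ->; rewrite pos_part0. Qed.

Lemma ncol_diag B k : B (k, k) = 0 -> ncol B k k = 0.
Proof. by rewrite ffunE => ->; rewrite oppr0 pos_part0. Qed.

Lemma mono_mut_cluster B X k (m : {ffun I -> int}) : m k = 0 -> mono (mut_cluster k B X) m = mono X m.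
Proof.
move=> mk; apply: mono_ext => j; apply: contraNeq => jX.
have /eqP -> : j == k by apply: contraNT jX => jk; rewrite mut_cluster_other.
by rewrite mk.
Qed.

Lemma exch_mut B X k : B (k, k) = 0 ->
  exch (mut_matrix k B) (mut_cluster k B X) k = exch B X k.
Proof.
move=> Bkk; rewrite /exch pcol_mut ncol_mut addrC.
by rewrite !mono_mut_cluster ?pcol_diag ?ncol_diag.
Qed.

Lemma mut_clusterK B X k : B (k, k) = 0 -> X k != 0 -> exch B X k != 0 ->
  mut_cluster k (mut_matrix k B) (mut_cluster k B X) = X.
Proof.
move=> Bkk Xk Pk; apply/ffunP => j; have [->|jk] := eqVneq j k.
  rewrite mut_cluster_self exch_mut // mut_cluster_self.
  by rewrite invfM invrK mulrA divff // mul1r.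
by rewrite !mut_cluster_other.
Qed.

Lemma der_mono (D : F -> F) X (v : I -> F) (m : {ffun I -> int}) : derivation D -> nonzero X ->
  (forall j, D (X j) = v j * X j) ->
  D (mono X m) = (\sum_j (m j)%:~R * v j) * mono X m.
Proof.
move=> dD X0 DX; rewrite (der_dlog _ (mono_neq0 m X0)); congr (_ * _).
rewrite /mono dlog_prod // => [|j]; last by rewrite expfz_neq0.
by apply: eq_bigr => j _; rewrite dlog_exprz // /dlog DX mulfK.
Qed.

Section FreeMutation.
Hypothesis c0 : char0 F.

Lemma exch_neq0 B X k : free_tuple X -> exch B X k != 0.
Proof.
move=> fX; rewrite /exch.
have -> : mono X (pcol B k) + mono X (ncol B k) = ev X [:: (1, pcol B k); (1, ncol B k)].
  by rewrite ev_cons ev_seq1 !mul1r.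
exact: ev_pos_neq0.
Qed.

Lemma mut_cluster_nonzero B X k : free_tuple X -> nonzero (mut_cluster k B X).
Proof.
move=> fX j; have X0 := fX.1; have [->|jk] := eqVneq j k.
  by rewrite mut_cluster_self mulf_neq0 ?invr_eq0 ?exch_neq0.
by rewrite mut_cluster_other.
Qed.

Lemma free_mut B X k : B (k, k) = 0 -> free_tuple X -> free_tuple (mut_cluster k B X).
Proof.
move=> Bkk fX; have X0 := fX.1; have [_ [D [dD DX]]] := fX.
split; first exact: mut_cluster_nonzero.
pose P := exch B X k; have P0 : P != 0 by exact: exch_neq0.
(* [D k] kills the exchange polynomial [P] and acts by -1 on [P / X k]. So [D k] must change sign,
   and every other [D l] needs the multiple of [D k] that cancels the logarithmic derivative of
   [P]. *)
pose c l := if l == k then - 2%:R else dlog (D l) P.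
exists (fun l z => D l z + c l * D k z).
have dD' l : derivation (fun z => D l z + c l * D k z).
  split=> x y; first by rewrite !(dD _).1 mulrDr; ring.
  by rewrite !(dD _).2; ring.
split=> // l i.
have DP : D k P = 0.
  rewrite /P /exch (dD k).1 !(der_mono _ (dD k) X0 (DX k)).
  rewrite ![\sum_j _](bigD1 k) //= pcol_diag // ncol_diag // !mul0r !add0r.
  rewrite !big1 ?mul0r ?addr0 // => j /negPf jk; rewrite eq_sym jk mulr0 //.
have [->|ik] := eqVneq i k; last first.
  rewrite mut_cluster_other // !DX /c [k == i]eq_sym (negPf ik) mul0r mulr0 addr0 //.
have dX a : dlog (D a) (X k) = (a == k)%:R by rewrite /dlog DX mulfK.
rewrite mut_cluster_self -/P.
have Dz a : D a (P / X k) = (dlog (D a) P - (a == k)%:R) * (P / X k).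
  by rewrite (der_dlog (D a)) ?mulf_neq0 ?invr_eq0 // dlogM ?invr_eq0 // dlogV // dX.
rewrite !Dz eqxx {2}/dlog DP mul0r sub0r mulN1r /c.
have [->|lk] := eqVneq l k; last by rewrite subr0 mulrN mul0r subrr.
by rewrite {1}/dlog DP mul0r (_ : (nat_of_bool true)%:R = 1 :> F) //; ring.
Qed.

End FreeMutation.

(* How a vector of logarithmic derivatives, and its image under the transpose
   of the matrix, change under mutation; w is the weight of the first of the
   two exchange monomials. *)
Lemma mut_linear (R : comPzRingType) B k (xi xi' : I -> R) (w : R) :
  B (k, k) = 0 -> (forall j, j != k -> xi' j = xi j) ->
  xi' k = - xi k + \sum_j (pos_part (- B (j, k)))%:~R * xi j
            + w * \sum_j (B (j, k))%:~R * xi j ->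
  forall l, \sum_j (mut_matrix k B (j, l))%:~R * xi' j =
    if l == k then - \sum_j (B (j, k))%:~R * xi j
    else \sum_j (B (j, l))%:~R * xi j +
     ((pos_part (- B (k, l)))%:~R + (1 - w) * (B (k, l))%:~R) * \sum_j (B (j, k))%:~R * xi j.
Proof.
move=> Bkk xiE xik l.
have [->|lk] := eqVneq l k.
  rewrite -sumrN; apply: eq_bigr => j _; rewrite mut_matrix_in ?eqxx ?orbT //.
  have [->|jk] := eqVneq j k; first by rewrite Bkk oppr0 !mul0r oppr0.
  by rewrite xiE // rmorphN mulNr.
pose S := \sum_(j | j != k) (B (j, k))%:~R * xi j.
pose T := \sum_(j | j != k) (B (j, l))%:~R * xi j.
pose N := \sum_(j | j != k) (pos_part (- B (j, k)))%:~R * xi j.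
have SE : \sum_j (B (j, k))%:~R * xi j = S by rewrite (bigD1 k) //= Bkk mul0r add0r.
have TE : \sum_j (B (j, l))%:~R * xi j = (B (k, l))%:~R * xi k + T by rewrite (bigD1 k).
have NE : \sum_j (pos_part (- B (j, k)))%:~R * xi j = N.
  by rewrite (bigD1 k) //= Bkk oppr0 pos_part0 mul0r add0r.
rewrite (bigD1 k) //= mut_matrix_in ?eqxx // xik SE TE NE.
have -> : \sum_(j | j != k) (mut_matrix k B (j, l))%:~R * xi' j =
   T + (B (k, l))%:~R * (N + S) + (pos_part (- B (k, l)))%:~R * S.
  rewrite /T /N /S -big_split /= !mulr_sumr -!big_split /=.
  apply: eq_bigr => j jk; rewrite xiE // mut_matrix_lin //.
  have -> : pos_part (B (j, k)) = pos_part (- B (j, k)) + B (j, k) by rewrite pos_partN; ring.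
  by rewrite !rmorphD !rmorphM /= !rmorphD /=; ring.
rewrite rmorphN /=; ring.
Qed.

(** The columns indexed by [P], the mutable indices, are part of a basis of the lattice of
    exponents. This supplies weights vanishing on one column and not on another, in place of
    coprimality of the exchange binomials. *)
Definition unimodular (P : pred I) B := forall mu : I -> int,
  exists l : {ffun I -> int}, forall k, P k -> wt l (bcol B k) = mu k.

Lemma wt_col l B k : wt l (bcol B k) = \sum_j (B (j, k))%:~R * l j.
Proof. by apply: eq_bigr => j _; rewrite ffunE intz mulrC. Qed.

(** A weight transforms by [mut_linear] with [w = 1]; [mu0] is the prescription on the old columns
    that this transformation turns into [mu]. *)
Lemma unimodular_mut (P : pred I) B k : B (k, k) = 0 -> P k ->
  unimodular P B -> unimodular P (mut_matrix k B).
Proof.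
move=> Bkk Pk uB mu.
pose mu0 l := if l == k then - mu k else mu l + pos_part (- B (k, l)) * mu k.
have [la laP] := uB mu0.
pose la' := [ffun j => if j == k then - la k + \sum_j (pos_part (- B (j, k)))%:~R * la j
            + 1 * \sum_j (B (j, k))%:~R * la j else la j] : {ffun I -> int}.
exists la' => l Pl; rewrite wt_col.
rewrite (@mut_linear int B k la la' 1) // => [|j /negPf jk|]; rewrite ?ffunE ?jk ?eqxx //.
rewrite -!wt_col !laP // /mu0 eqxx; case: eqP => [->|_]; first by rewrite opprK.
by rewrite intz; ring.
Qed.

Lemma unimodular_opp (P : pred I) B : unimodular P B -> unimodular P (- B).
Proof.
move=> uB mu; have [l lP] := uB (fun k => - mu k); exists l => k /lP.
have -> : bcol (- B) k = - bcol B k by apply/ffunP => j; rewrite !ffunE.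
by rewrite wtN => ->; rewrite opprK.
Qed.

End Mutation.

(** * The Laurent phenomenon *)

Section LaurentPhenomenon.
Variables (I : finType) (F : fieldType).
Hypothesis c0 : char0 F.
Implicit Types (B : {ffun I * I -> int}) (X Y : {ffun I -> F}).

(** Expansion to first order suffices: in [three_step_neg] the argument is a multiple of the new
    variable [a], so the remainder vanishes modulo [a] even after one division by [a]. *)
Lemma expr1D X (t : F) n : nonzero X -> laurent X t ->
  exists2 r, laurent X r & (1 + t) ^+ n = 1 + n%:R * t + t ^+ 2 * r.
Proof.
move=> X0 Lt; elim: n => [|n [r Lr E]].
  by exists 0; [apply: laurent0|rewrite expr0; ring].
exists (r + n%:R + t * r).
  apply: laurentD; last exact: laurentM.
  by apply: laurentD => //; rewrite pmulrn; apply: laurent_int.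
by rewrite exprS E -[n.+1]add1n natrD; ring.
Qed.

Section Regular.
Variables (X : {ffun I -> F}) (a : F).
Hypotheses (X0 : nonzero X) (La : laurent X a).

(** [c] is not a zero divisor modulo [a] in the Laurent ring of [X]; this plays the part of
    coprimality. *)
Definition regular (c : F) := forall f g, laurent X f -> laurent X g ->
  c * f = a * g -> exists2 h, laurent X h & f = a * h.

Lemma regular_mono m : regular (mono X m).
Proof.
move=> f g Lf Lg E; exists (mono X (- m) * g); first by apply: laurentM => //; apply: laurent_mono.
by rewrite mulrCA -E monoN // mulrA mulVf ?mul1r ?mono_neq0.
Qed.

Lemma regular_congr c w : laurent X w -> regular c -> regular (c + a * w).
Proof.
move=> Lw rc f g Lf Lg E; apply: (rc f (g - w * f)) => //.
  by apply: laurentB => //; apply: laurentM.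
by rewrite mulrBr -E; ring.
Qed.

Lemma regularM c c' : laurent X c' -> regular c -> regular c' -> regular (c * c').
Proof.
move=> Lc' rc rc' f g Lf Lg E; have [||h Lh] := rc (c' * f) g _ Lg.
- exact: laurentM.
- by rewrite mulrA.
- exact: rc'.
Qed.

Lemma regularX c n : laurent X c -> regular c -> regular (c ^+ n).
Proof.
move=> Lc rc; elim: n => [|n IH]; first by rewrite expr0 -(mono0 X); apply: regular_mono.
by rewrite exprS; apply: regularM => //; apply: laurentXn.
Qed.

(** Inverting [a] and inverting [c] have only the original ring in common: each factor [a] in the
    denominator is cancelled by regularity of [c ^+ p]. *)
Lemma regular_inter c z n p : a != 0 -> laurent X c -> regular c ->
  laurent X (a ^+ n * z) -> laurent X (c ^+ p * z) -> laurent X z.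
Proof.
move=> a0 Lc rc; elim: n z => [|n IH] z; first by rewrite expr0 mul1r.
move=> La1 Lc1; apply: IH => //.
have Lg : laurent X (a ^+ n * (c ^+ p * z)) by apply: laurentM => //; apply: laurentXn.
have [|h Lh Eh] := @regularX c p Lc rc _ _ La1 Lg; first by rewrite exprS; ring.
suff -> : a ^+ n * z = h by [].
by apply: (mulfI a0); rewrite -Eh exprS mulrA.
Qed.

End Regular.

Lemma clear_denominators X Y (c z : F) : nonzero X -> nonzero Y ->
  laurent X c -> (forall l, laurent X (Y l)) -> (forall l, laurent X (c / Y l)) ->
  laurent Y z -> exists n, laurent X (c ^+ n * z).
Proof.
move=> X0 Y0 Lc LY LcY [s ->]; elim: s => [|v s [n IH]].
  by exists 0%N; rewrite ev_nil mulr0; apply: laurent0.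
have [p Hp] : exists p, laurent X (c ^+ p * mono Y v.2).
  exists (\sum_l absz (v.2 l))%N; rewrite /mono -prodrXr -big_split.
  apply: laurent_prod => // l /=; case: (v.2 l) => q.
    by rewrite absz_nat -exprnP -exprMn; apply: laurentXn => //; apply: laurentM.
  by rewrite NegzE abszN -exprnN absz_nat -exprVn -exprMn; apply: laurentXn.
exists (p + n)%N; rewrite ev_cons exprD mulrDr; apply: laurentD.
  rewrite (_ : c ^+ p * c ^+ n * _ = v.1%:~R * (c ^+ n * (c ^+ p * mono Y v.2))).
  2: by rewrite mulrCA mulrA [c ^+ n * _]mulrCA mulrA; ring.
  by apply: laurentM; [|apply: laurent_int|apply: laurentM => //; apply: laurentXn].
by rewrite -mulrA; apply: laurentM => //; apply: laurentXn.
Qed.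

Section ThreeSteps.
Variables (d : I -> int) (P : pred I) (i j : I).
Hypotheses (Pi : P i) (Pj : P j) (ij : i != j).

Let B1 B := mut_matrix i B.
Let B2 B := mut_matrix j (B1 B).
Let X1 B X := mut_cluster i B X.
Let X2 B X := mut_cluster j (B1 B) (X1 B X).
Let X3 B X := mut_cluster i (B2 B) (X2 B X).

Lemma exch_binomial B X k : nonzero X ->
  exch B X k / X k = mono X (pcol B k - unit_exp k) + mono X (ncol B k - unit_exp k).
Proof. by move=> X0; rewrite !monoB // mono_unit /exch mulrDl. Qed.

Lemma wt_binomial B k l : (wt l (pcol B k - unit_exp k) == wt l (ncol B k - unit_exp k)) =
  (wt l (bcol B k) == 0).
Proof. by rewrite -pncol !wtB; apply/eqP/eqP; lia. Qed.

(** After mutating at [i], [j], [i], the new variables are [a], [X2 B X j] and [X3 B X i]. The first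
    is the denominator of Laurent polynomials in [X1], the product of the other two that of Laurent
    polynomials in [X3]. *)
Definition three_step_ok B X := let a := X1 B X i in
  [/\ laurent X (X2 B X j), regular X a (X2 B X j),
      laurent X (X3 B X i) & regular X a (X3 B X i)].

(** The mutations at [i] and [j] commute, so the third step undoes the first, and the second new
    variable is the exchange binomial of [X] at [j] over [X j]. *)
Lemma three_step_zero B X : skew_by d B -> unimodular P B -> free_tuple X ->
  B (i, j) = 0 -> three_step_ok B X.
Proof.
move=> sk uB fX Bij; have X0 := fX.1.
have Bji := skew_eq0 sk Bij.
have Bii := skew_diag i sk; have Bjj := skew_diag j sk; have ji : j != i by rewrite eq_sym.
have B1j k : B1 B (k, j) = B (k, j).
  have [->|ki] := eqVneq k i; first by rewrite mut_matrix_in ?eqxx // Bij oppr0.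
  by rewrite mut_matrix_lin // Bij oppr0 pos_part0 !mulr0 !addr0.
have B2i k : B2 B (k, i) = - B (k, i).
  have B1ji : B1 B (j, i) = 0 by rewrite mut_matrix_in ?eqxx ?orbT // Bji oppr0.
  have [->|kj] := eqVneq k j; first by rewrite mut_matrix_in ?eqxx // B1ji Bji oppr0.
  rewrite mut_matrix_lin // B1ji oppr0 pos_part0 !mulr0 !addr0.
  by rewrite mut_matrix_in ?eqxx ?orbT.
have x2E : X2 B X j = mono X (pcol B j - unit_exp j) + 1%:~R * mono X (ncol B j - unit_exp j).
  rewrite mul1r -exch_binomial // mut_cluster_self mut_cluster_other //; congr (_ / _).
  have -> : exch (B1 B) (X1 B X) j = mono (X1 B X) (pcol B j) + mono (X1 B X) (ncol B j).
    by rewrite /exch; congr (_ + _); congr mono; apply/ffunP => k; rewrite ?pcolE ?ncolE B1j.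
  by rewrite !mono_mut_cluster // ?pcolE ?ncolE Bij ?oppr0 pos_part0.
have x3E : X3 B X i = X i.
  rewrite mut_cluster_self mut_cluster_other // mut_cluster_self.
  have -> : exch (B2 B) (X2 B X) i = mono (X2 B X) (ncol B i) + mono (X2 B X) (pcol B i).
    by rewrite /exch; congr (_ + _); congr mono; apply/ffunP => k; rewrite ?pcolE ?ncolE B2i ?opprK.
  have e0 (m : {ffun I -> int}) : m i = 0 -> m j = 0 -> mono (X2 B X) m = mono X m.
    by move=> mi mj; rewrite !mono_mut_cluster.
  rewrite !e0 ?pcol_diag ?ncol_diag //; try by rewrite ?pcolE ?ncolE Bji ?oppr0 pos_part0.
  rewrite [mono X _ + _]addrC -/(exch B X i) invfM invrK mulrA divff ?mul1r //.
  exact: exch_neq0.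
split.
- rewrite x2E mul1r; apply: laurentD; apply: laurent_mono.
- move=> f g Lf Lg; rewrite x2E mut_cluster_self exch_binomial // => E.
  (* This weight vanishes on column [i] and is 1 on column [j]: the binomial at [i] is homogeneous,
     the one at [j] is not. *)
  have [l lP] := uB (fun k => (k == j)%:Z).
  apply: (binomial_regular c0 fX (l := l)) E => //.
    by apply/eqP; rewrite wt_binomial lP // (negPf ij).
  by rewrite wt_binomial lP // eqxx.
- by rewrite x3E; apply: laurent_var.
- by rewrite x3E -(mono_unit X i); apply: regular_mono.
Qed.

(** With this sign [a] occurs in just one of the two monomials exchanged at [j], so the new variable
    there is a monomial modulo [a]. *)
Lemma three_step_neg B X : skew_by d B -> unimodular P B -> free_tuple X ->
  B (i, j) < 0 -> three_step_ok B X.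
Proof.
move=> sk uB fX Bij; have X0 := fX.1.
have Bji := skew_lt0 sk Bij.
have Bii := skew_diag i sk; have Bjj := skew_diag j sk; have ji : j != i by rewrite eq_sym.
have fX1 : free_tuple (X1 B X) by apply: free_mut.
have X10 := fX1.1; have a0 := X10 i.
set a := X1 B X i in a0.
have aE : a = mono X (pcol B i - unit_exp i) + mono X (ncol B i - unit_exp i).
  by rewrite -exch_binomial // -mut_cluster_self.
have La : laurent X a by rewrite aE; apply: laurentD; apply: laurent_mono.
(* Writing the entry as a successor exposes one factor [a] in the exchange relation at [j]. *)
have [c cE] : exists c, - B (i, j) = c.+1%:Z by exists (absz (B (i, j))).-1; lia.
have [e eE] : exists e, B (j, i) = e%:Z by exists (absz (B (j, i))); lia.
have B1ij : B1 B (i, j) = c.+1%:Z by rewrite mut_matrix_in ?eqxx.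
have B1ji : B1 B (j, i) = - e%:Z by rewrite mut_matrix_in ?eqxx ?orbT // eE.
have B1jj : B1 B (j, j) = 0 by rewrite (skew_diag j (skew_mut i sk)).
pose u := ncol (B1 B) j; pose v := pcol (B1 B) j - unit_exp i *+ c.+1.
have uj : u j = 0 by rewrite ncol_diag.
have ui : u i = 0 by rewrite ncolE B1ij pos_part_neg //; lia.
have vi : v i = 0 by rewrite /v !expE eqxx pcolE B1ij pos_part_pos //; lia.
have pv : pcol (B1 B) j = v + unit_exp i *+ c.+1 by rewrite subrK.
clearbody v.
have x2E : X2 B X j = mono X (u - unit_exp j) + a * (a ^+ c * mono X (v - unit_exp j)).
  rewrite mut_cluster_self mut_cluster_other // /exch -/u.
  rewrite pv monoD // -mono_exprn mono_unit !(mono_mut_cluster _ _ (k := i)) // -/a.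
  by rewrite !monoB // mono_unit exprS; field; apply: X0.
have Lx2 : laurent X (X2 B X j).
  rewrite x2E; apply: laurentD; first exact: laurent_mono.
  by apply: laurentM => //; apply: laurentM; [|apply: laurentXn|apply: laurent_mono].
pose w := ncol (B2 B) i.
have B2ii : B2 B (i, i) = 0 by rewrite (skew_diag i (skew_mut j (skew_mut i sk))).
have B2ji : B2 B (j, i) = e by rewrite mut_matrix_in ?eqxx // B1ji opprK.
have wi : w i = 0 by rewrite ncol_diag.
have wj : w j = 0 by rewrite ncolE B2ji pos_part_neg //; lia.
pose t := mono X (v - u).
(* The bracket vanishes at both [i] and [j], so it can be evaluated in the initial cluster; the
   first summand is the power of the new variable at [j]. *)
have colE : bcol (B2 B) i = unit_exp j *+ e + (unit_exp j *+ e - bcol B i - u *+ e).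
  apply/ffunP => k; rewrite !expE !bcolE.
  have [->|kj] := eqVneq k j.
    by rewrite B2ji uj eE -[Posz (nat_of_bool true)]/(1 : int); ring.
  rewrite ncolE mut_matrix_lin // B1ji opprK (pos_part_pos (z := e%:Z)) // pos_partN.
  by rewrite mut_matrix_in ?eqxx ?orbT // mul0r; ring.
have x2jE : X2 B X j * X j = mono X u * (1 + a ^+ c.+1 * t).
  rewrite x2E /t !monoB // mono_unit exprS; field.
  by rewrite (X0 j) mono_neq0.
have colmono : mono (X2 B X) (bcol (B2 B) i) =
    (1 + a ^+ c.+1 * t) ^+ e * mono X (- bcol B i).
  have X20 : nonzero (X2 B X) by apply: mut_cluster_nonzero.
  rewrite colE monoD // -mono_exprn mono_unit.
  rewrite (mono_mut_cluster _ _ (k := j)); last first.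
    by rewrite !expE eqxx bcolE uj eE -[Posz (nat_of_bool true)]/(1 : int); ring.
  rewrite (mono_mut_cluster _ _ (k := i)); last first.
    by rewrite !expE bcolE ui Bii (negPf ij) -[Posz (nat_of_bool false)]/(0 : int); ring.
  rewrite !monoB // -!mono_exprn mono_unit monoN // !mulrA -exprMn x2jE exprMn.
  by field; rewrite !expf_neq0 ?mono_neq0.
have Lt : laurent X (a ^+ c.+1 * t).
  by apply: laurentM => //; [apply: laurentXn|apply: laurent_mono].
have [r Lr rE] := expr1D e X0 Lt.
(* [c1] comes from the constant term of the expansion, once the exchange relation at [i] has
   absorbed the division by [a]; [c2] comes from the linear term. *)
pose c1 := w - bcol B i + unit_exp i - ncol B i.
pose c2 := w - bcol B i + (v - u).
have x3E : X3 B X i = mono X c1 + e%:R * a ^+ c * mono X c2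
                      + a * (a ^+ (c + c) * mono X (w - bcol B i) * t ^+ 2 * r).
  rewrite mut_cluster_self mut_cluster_other // -/a /exch -/w.
  have -> : pcol (B2 B) i = w + bcol (B2 B) i by rewrite -pncol addrC subrK.
  rewrite monoD ?colmono; last exact: mut_cluster_nonzero.
  rewrite !(mono_mut_cluster _ _ (k := j)) // !(mono_mut_cluster _ _ (k := i)) //.
  rewrite rE -/t; apply: (mulIf a0); rewrite divfK //.
  have YE : mono X (- bcol B i) + 1 = mono X (- bcol B i) * (a * X i) / mono X (ncol B i).
    rewrite aE !monoB // mono_unit monoN // -pncol monoB //; field.
    by rewrite (X0 i) !mono_neq0.
  have -> : mono X c1 = mono X w * mono X (- bcol B i) * X i / mono X (ncol B i).
    by rewrite /c1 monoB // monoD // monoD // mono_unit.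
  have -> : mono X c2 = mono X w * mono X (- bcol B i) * t by rewrite /c2 monoD // monoD.
  rewrite monoD //; transitivity (mono X w * (mono X (- bcol B i) + 1) +
    mono X w * mono X (- bcol B i) *
      (e%:R * (a ^+ c.+1 * t) + (a ^+ c.+1 * t) ^+ 2 * r)); first by ring.
  by rewrite YE exprD !exprS; ring.
have Lrest : laurent X (a ^+ (c + c) * mono X (w - bcol B i) * t ^+ 2 * r).
  apply: laurentM => //; apply: laurentM => //.
    by apply: laurentM => //; [apply: laurentXn|apply: laurent_mono].
  by apply: laurentXn => //; apply: laurent_mono.
have Le : laurent X (e%:R) by rewrite pmulrn; apply: laurent_int.
split=> //.
- rewrite x2E; apply: regular_congr => //; last exact: regular_mono.
  by apply: laurentM => //; [apply: laurentXn|apply: laurent_mono].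
- rewrite x3E; apply: laurentD; last by apply: laurentM.
  apply: laurentD; first exact: laurent_mono.
  apply: laurentM => //; last exact: laurent_mono.
  by apply: laurentM => //; apply: laurentXn.
- rewrite x3E; apply: regular_congr => //.
  (* If [c > 0], the second term is a multiple of [a] and only a monomial remains modulo [a]. If
     [c = 0], the two exponents differ in coordinate [i], along which [a] is homogeneous. *)
  have [c_0|[c' cS]] : c = 0%N \/ exists c', c = c'.+1 by case: (c) => [|c']; [left|right; exists c'].
    move=> f g Lf Lg; rewrite c_0 expr0 mulr1 -/a aE => E.
    apply: (binomial_regular c0 fX (l := unit_exp i) (k := e)) E => //.
      by apply/eqP; rewrite wt_binomial wt_unitl bcolE Bii.
    by rewrite !wt_unitl !expE bcolE Bii wi vi ui ncol_diag // eqxx.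
  rewrite cS; have -> : e%:R * a ^+ c'.+1 * mono X c2 = a * (e%:R * a ^+ c' * mono X c2).
    by rewrite exprS; ring.
  apply: regular_congr => //; last exact: regular_mono.
  apply: laurentM => //; last exact: laurent_mono.
  by apply: laurentM => //; apply: laurentXn.
Qed.

Lemma three_step B X : skew_by d B -> unimodular P B -> free_tuple X -> three_step_ok B X.
Proof.
move=> sk uB fX; case: (ltgtP (B (i, j)) 0) => Bij.
- exact: three_step_neg.
- have := @three_step_neg (- B) X (skew_opp sk) (unimodular_opp uB) fX.
  rewrite /three_step_ok /X3 /X2 /X1 /B2 /B1 !mut_matrix_opp !mut_cluster_opp.
  by apply; rewrite ffunE oppr_lt0.
- exact: three_step_zero.
Qed.

(** [z] becomes Laurent in [X] after multiplication by a power of [a], and also by a power of an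
    element regular modulo [a]. *)
Lemma three_step_laurent B X z : skew_by d B -> unimodular P B -> free_tuple X ->
  laurent (X1 B X) z -> laurent (X3 B X) z -> laurent X z.
Proof.
move=> sk uB fX L1 L3; have X0 := fX.1.
have [Lx2 r2 Lx3 r3] := three_step sk uB fX.
have ji : j != i by rewrite eq_sym.
have Bii := skew_diag i sk; have Bjj := skew_diag j (skew_mut i sk).
have B2ii := skew_diag i (skew_mut j (skew_mut i sk)).
have fX1 : free_tuple (X1 B X) by apply: free_mut.
have fX2 : free_tuple (X2 B X) by apply: free_mut.
have fX3 : free_tuple (X3 B X) by apply: free_mut.
have La : laurent X (X1 B X i).
  by rewrite mut_cluster_self exch_binomial //; apply: laurentD; apply: laurent_mono.
have LV k : laurent X (X k)^-1 by rewrite -mono_unit -monoN //; apply: laurent_mono.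
have x3j : X3 B X j = X2 B X j by rewrite mut_cluster_other.
have x3o k : k != i -> k != j -> X3 B X k = X k by move=> ki kj; rewrite !mut_cluster_other.
have [n Ln] : exists n, laurent X (X1 B X i ^+ n * z).
  apply: (clear_denominators X0 fX1.1 La) L1 => k; have [->|ki] := eqVneq k i => //.
  - by rewrite mut_cluster_other //; apply: laurent_var.
  - by rewrite divff ?(fX1.1 i) //; apply: laurent1.
  - by rewrite [X1 B X k]mut_cluster_other //; apply: laurentM.
have Lc : laurent X (X2 B X j * X3 B X i) by apply: laurentM.
have [p Lp] : exists p, laurent X ((X2 B X j * X3 B X i) ^+ p * z).
  apply: (clear_denominators X0 fX3.1 Lc) L3 => k; have [->|ki] := eqVneq k i => //.
  - have [->|kj] := eqVneq k j; first by rewrite x3j.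
    by rewrite x3o //; apply: laurent_var.
  - by rewrite mulfK ?(fX3.1 i).
  - have [->|kj] := eqVneq k j; first by rewrite x3j mulrC mulKf ?(fX2.1 j).
    by rewrite (x3o k) //; apply: laurentM.
apply: (regular_inter X0 La (fX1.1 i) Lc _ Ln Lp).
exact: regularM.
Qed.

End ThreeSteps.
Definition mutate (S : {ffun I * I -> int} * {ffun I -> F}) k :=
  (mut_matrix k S.1, mut_cluster k S.1 S.2).

Definition mutations := foldl mutate.

Lemma mutateK d B X k : skew_by d B -> free_tuple X -> mutate (mutate (B, X) k) k = (B, X).
Proof.
move=> sk fX; have Bkk := skew_diag k sk.
by rewrite /mutate /= mut_matrixK // mut_clusterK ?(fX.1 k) ?exch_neq0.
Qed.

(** Induction on the length. A variable reached by [i, j, ks] is reached from the cluster after [i]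
    by [j, ks], and from the cluster after [i, j, i] by [i, ks]. Both sequences are shorter, and
    [three_step_laurent] combines the two expansions. *)
Theorem laurent_phenomenon d (P : pred I) ks B X l : all P ks ->
  skew_by d B -> unimodular P B -> free_tuple X ->
  laurent X ((mutations (B, X) ks).2 l).
Proof.
have [n] := ubnP (size ks); elim: n ks B X => // n IH ks B X ksn Pks sk uB fX.
have X0 := fX.1.
case: ks => [|i [|j ks]] in ksn Pks *.
- exact: laurent_var.
- rewrite /= ffunE; case: eqP => _; last exact: laurent_var.
  rewrite exch_posE exch_negE -/(exch B X i) exch_binomial //.
  by apply: laurentD; apply: laurent_mono.
move: Pks => /= /and3P[Pi Pj Pks].
have Bii := skew_diag i sk.
have [ij|ij] := eqVneq i j.
  rewrite -ij; have := mutateK i sk fX; rewrite /mutations /= => ->.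
  by apply: IH => //; move: ksn => /=; lia.
pose S1 := mutate (B, X) i; pose S2 := mutate S1 j; pose S3 := mutate S2 i.
have sk1 : skew_by d S1.1 by apply: skew_mut.
have fX1 : free_tuple S1.2 by apply: free_mut.
have u1 : unimodular P S1.1 by apply: unimodular_mut.
have sk2 : skew_by d S2.1 by apply: skew_mut.
have fX2 : free_tuple S2.2 by apply: free_mut => //; apply: skew_diag sk1.
have u2 : unimodular P S2.1 by apply: unimodular_mut => //; apply: skew_diag sk1.
have sk3 : skew_by d S3.1 by apply: skew_mut.
have fX3 : free_tuple S3.2 by apply: free_mut => //; apply: skew_diag sk2.
have u3 : unimodular P S3.1 by apply: unimodular_mut => //; apply: skew_diag sk2.
apply: (three_step_laurent Pi Pj ij sk uB fX).
  by apply: (IH (j :: ks) S1.1 S1.2) => //=; rewrite Pj.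
have E : mutate S3 i = S2 := mutateK i sk2 fX2.
have H : laurent S3.2 ((mutations (mutate S3 i) ks).2 l).
  by apply: (IH (i :: ks) S3.1 S3.2) => //=; rewrite Pi.
by rewrite E in H.
Qed.

End LaurentPhenomenon.

Section MutationSequences.
Variables (I : finType) (F : fieldType).
Hypothesis c0 : char0 F.
Implicit Types (B : {ffun I * I -> int}) (X Y : {ffun I -> F}) (S : {ffun I * I -> int} * {ffun I -> F}).

Lemma mutations_rcons S ks k : mutations S (rcons ks k) = mutate (mutations S ks) k.
Proof. exact: foldl_rcons. Qed.

Lemma seed_mutations B X B' X' : seed B X B' X' -> exists ks, mutations (B, X) ks = (B', X').
Proof.
elim=> [|B1 X1 k _ [ks E]]; first by exists [::].
by exists (rcons ks k); rewrite mutations_rcons E.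
Qed.

Definition good (d : I -> int) S := skew_by d S.1 /\ free_tuple S.2.

Lemma good_mutate d S k : good d S -> good d (mutate S k).
Proof.
by move=> [sk fS]; split; [apply: skew_mut|apply: free_mut => //; apply: skew_diag sk].
Qed.

Lemma good_mutations d S ks : good d S -> good d (mutations S ks).
Proof. by elim: ks S => //= k ks IH S gS; apply/IH/good_mutate. Qed.

Lemma unimodular_mutations d (P : pred I) S ks : good d S -> all P ks ->
  unimodular P S.1 -> unimodular P (mutations S ks).1.
Proof.
elim: ks S => //= k ks IH S gS /andP[Pk Pks] uS; apply: IH => //; first exact: good_mutate.
by apply: unimodular_mut => //; apply: skew_diag gS.1.
Qed.

Lemma mutate_involutive d S k : good d S -> mutate (mutate S k) k = S.
Proof. by case: S => B X [sk fX]; apply: mutateK sk fX. Qed.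

Lemma mutations_rev d S ks : good d S -> mutations (mutations S ks) (rev ks) = S.
Proof.
elim: ks S => //= k ks IH S gS; rewrite rev_cons mutations_rcons.
by rewrite (IH (mutate S k)) ?(mutate_involutive k gS) //; apply: good_mutate.
Qed.

End MutationSequences.

(** * Log-canonical forms *)

Section Poisson.
Variables (I T : finType) (F : fieldType) (L : T -> T -> F).
Hypothesis c0 : char0 F.
Hypothesis Lanti : forall s t, L s t = - L t s.
Implicit Types (B : {ffun I * I -> int}) (X : {ffun I -> F}) (u v : T -> F).

Definition pform u v : F := \sum_s \sum_t L s t * u s * v t.

Lemma pform_anti u v : pform u v = - pform v u.
Proof.
rewrite /pform exchange_big -sumrN; apply: eq_bigr => s _; rewrite -sumrN.
by apply: eq_bigr => t _; rewrite Lanti; ring.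
Qed.

Lemma pform_self u : pform u u = 0.
Proof.
have /eqP := pform_anti u u; rewrite -subr_eq0 opprK -mulr2n -mulr_natl mulf_eq0.
by case/orP => /eqP // E; have := c0 (z := 2) E.
Qed.

Lemma pform_sumr (J : finType) u (c : J -> F) (v : J -> T -> F) w :
  (forall t, w t = \sum_j c j * v j t) -> pform u w = \sum_j c j * pform u (v j).
Proof.
move=> wE; rewrite /pform; under [RHS]eq_bigr do rewrite mulr_sumr.
rewrite [RHS]exchange_big; apply: eq_bigr => s _.
under [RHS]eq_bigr do rewrite mulr_sumr.
rewrite [RHS]exchange_big; apply: eq_bigr => t _; rewrite wE mulr_sumr.
by apply: eq_bigr => j _; ring.
Qed.

Lemma pform_suml (J : finType) u (c : J -> F) (v : J -> T -> F) w :
  (forall t, w t = \sum_j c j * v j t) -> pform w u = \sum_j c j * pform (v j) u.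
Proof.
move=> /(pform_sumr u) E; rewrite pform_anti E -sumrN; apply: eq_bigr => j _.
by rewrite [in RHS]pform_anti mulrN.
Qed.

Lemma pform_combr u v1 v2 c w : (forall t, w t = v1 t + c * v2 t) ->
  pform u w = pform u v1 + c * pform u v2.
Proof.
move=> wE; rewrite /pform mulr_sumr -big_split; apply: eq_bigr => s _.
by rewrite mulr_sumr -big_split; apply: eq_bigr => t _ /=; rewrite wE; ring.
Qed.

(** The vectors stand for logarithmic gradients: for gradients of [f] and [g], [pform] is the
    Poisson bracket of [f] and [g] divided by [f * g]. *)
Lemma pform_combl u v1 v2 c w : (forall t, w t = v1 t + c * v2 t) ->
  pform w u = pform v1 u + c * pform v2 u.
Proof. by move=> /(pform_combr u) E; rewrite pform_anti E 2![pform u _]pform_anti; ring. Qed.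

Definition yvec B (xi : I -> T -> F) l t := \sum_j (B (j, l))%:~R * xi j t.

Definition coskew (e : I -> int) B := forall k l, B (l, k) * e l = - (B (k, l) * e k).

(** The compatibility of a Poisson bracket with a seed: each variable pairs trivially with the
    Laurent monomial of every mutable column except its own. *)
Definition log_canonical (P : pred I) (e : I -> int) B (xi : I -> T -> F) :=
  forall j l, P l -> pform (xi j) (yvec B xi l) = (j == l)%:R * (e l)%:~R.

(** The scalar [w], which in the application varies with the cluster, drops out: its contributions
    cancel by [coskew] and the antisymmetry of the form. *)
Lemma log_canonical_mut d (P : pred I) e B xi xi' k (w : F) :
  skew_by d B -> (forall i, 0 < e i) -> coskew e B -> P k -> log_canonical P e B xi ->
  (forall j t, j != k -> xi' j t = xi j t) ->
  (forall t, xi' k t = - xi k t + \sum_j (pos_part (- B (j, k)))%:~R * xi j t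
            + w * yvec B xi k t) ->
  log_canonical P e (mut_matrix k B) xi'.
Proof.
move=> sk e0 ce Pk lc xiE xik j l Pl; have Bkk := skew_diag k sk.
have yE t : yvec (mut_matrix k B) xi' l t = if l == k then - yvec B xi k t else
   yvec B xi l t + ((pos_part (- B (k, l)))%:~R + (1 - w) * (B (k, l))%:~R) * yvec B xi k t.
  by rewrite /yvec (@mut_linear _ _ B k (xi^~ t) (xi'^~ t) w) // => i /xiE.
set c := _ + (1 - w) * _ in yE.
have pos_sum m : P m -> \sum_i (pos_part (- B (i, k)))%:~R * pform (xi i) (yvec B xi m) =
    (pos_part (- B (m, k)) * e m)%:~R.
  move=> Pm; rewrite (bigD1 m) //= lc // eqxx mul1r rmorphM big1 ?addr0 // => i im.
  by rewrite lc // (negPf im) mul0r mulr0.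
have xikE v : pform (xi' k) v = - pform (xi k) v +
    (\sum_i (pos_part (- B (i, k)))%:~R * pform (xi i) v) + w * pform (yvec B xi k) v.
  pose z t := \sum_i (pos_part (- B (i, k)))%:~R * xi i t.
  rewrite (@pform_combl v (fun t => z t + (-1) * xi k t) (yvec B xi k) w); last first.
    by move=> t; rewrite xik /z; ring.
  rewrite (@pform_combl v z (xi k) (-1)) //.
  rewrite (@pform_suml _ v (fun i => (pos_part (- B (i, k)))%:~R) xi z) //.
  by ring.
have yk : forall v, (forall t, v t = - yvec B xi k t) -> forall u, pform u v = - pform u (yvec B xi k).
  move=> v vE u; rewrite (@pform_combr u (yvec B xi k) (yvec B xi k) (- 2%:R)); first by ring.
  by move=> t; rewrite vE; ring.
have [lk|lk] := eqVneq l k.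
  rewrite lk eqxx in yE *.
  rewrite (yk _ yE); have [->|jk] := eqVneq j k.
    rewrite xikE pform_self pos_sum // Bkk oppr0 pos_part0 mul0r lc // eqxx; ring.
  have -> : pform (xi' j) (yvec B xi k) = pform (xi j) (yvec B xi k).
    by rewrite /pform; apply: eq_bigr => s _; apply: eq_bigr => t _; rewrite xiE.
  by rewrite lc // (negPf jk) mul0r oppr0.
rewrite (negPf lk) in yE; rewrite (pform_combr _ yE).
have [->|jk] := eqVneq j k; last first.
  have xiJ v : pform (xi' j) v = pform (xi j) v.
    by rewrite /pform; apply: eq_bigr => s _; apply: eq_bigr => t _; rewrite xiE.
  by rewrite !xiJ !lc // (negPf jk) mul0r mulr0 addr0.
rewrite !xikE pform_self !pos_sum // Bkk oppr0 pos_part0 mul0r !lc // eqxx [k == l]eq_sym (negPf lk).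
rewrite (@pform_suml _ (yvec B xi l) (fun i => (B (i, k))%:~R) xi (yvec B xi k)) //.
have -> : \sum_i (B (i, k))%:~R * pform (xi i) (yvec B xi l) = (B (l, k) * e l)%:~R.
  rewrite (bigD1 l) //= lc // eqxx mul1r rmorphM big1 ?addr0 // => i il.
  by rewrite lc // (negPf il) mul0r mulr0.
have -> : pos_part (- B (l, k)) * e l = (pos_part (- B (k, l)) + B (k, l)) * e k.
  rewrite -pos_partMl ?ltW // mulNr ce opprK pos_partMl ?ltW // pos_partN; ring.
rewrite ce /c !rmorphM /= !rmorphN /= !rmorphM !rmorphD /=; ring.
Qed.

End Poisson.

Section DlogMutation.
Variables (I : finType) (F : fieldType).
Hypothesis c0 : char0 F.

Lemma dlog_mono (D : F -> F) (X : {ffun I -> F}) m : derivation D -> nonzero X ->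
  dlog D (mono X m) = \sum_j (m j)%:~R * dlog D (X j).
Proof.
move=> dD X0; rewrite /mono dlog_prod // => [|j]; last by rewrite expfz_neq0.
by apply: eq_bigr => j _; rewrite dlog_exprz.
Qed.

(** The exchange relation in the shape required by [mut_linear], with [w] the share of the first
    monomial in the exchange polynomial. *)
Lemma dlog_mut_cluster (D : F -> F) (B : {ffun I * I -> int}) (X : {ffun I -> F}) k :
  derivation D -> free_tuple X ->
  dlog D (mut_cluster k B X k) = - dlog D (X k)
    + \sum_j (pos_part (- B (j, k)))%:~R * dlog D (X j)
    + mono X (pcol B k) / exch B X k * \sum_j (B (j, k))%:~R * dlog D (X j).
Proof.
move=> dD fX; have X0 := fX.1; have P0 := exch_neq0 c0 B k fX.
rewrite mut_cluster_self dlogM ?invr_eq0 // dlogV // addrC -addrA; congr (_ + _).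
have nE : \sum_j (pos_part (- B (j, k)))%:~R * dlog D (X j) = dlog D (mono X (ncol B k)).
  by rewrite dlog_mono //; apply: eq_bigr => j _; rewrite ncolE.
have pE : \sum_j (B (j, k))%:~R * dlog D (X j) =
    dlog D (mono X (pcol B k)) - dlog D (mono X (ncol B k)).
  rewrite !dlog_mono // -sumrB; apply: eq_bigr => j _.
  by rewrite -mulrBl -rmorphB /= -bcolE -pncol !expE.
rewrite nE pE; apply: (mulfI P0); rewrite /dlog /exch dD.1.
by field; rewrite !mono_neq0 // -/(exch B X k) P0.
Qed.

End DlogMutation.

(** * Principal coefficients *)

Section PrincipalExtension.
Variables (I : finType) (F G : fieldType).
Hypotheses (cF : char0 F) (cG : char0 G).
Local Notation J := (I + I)%type.
Variables (X : {ffun I -> F}) (Xt : {ffun J -> G}).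
Hypotheses (fX : free_tuple X) (fXt : free_tuple Xt).
Let X0 : nonzero X := fX.1.
Let Xt0 : nonzero Xt := fXt.1.
Implicit Types (s t : seq (int * {ffun J -> int})) (m : {ffun J -> int}).

(** An identity block of frozen rows is put under [B]; the block of frozen columns keeps the matrix
    skew-symmetrizable. *)
Definition principal (B : {ffun I * I -> int}) : {ffun J * J -> int} :=
  [ffun p => match p with
    | (inl i, inl j) => B (i, j)
    | (inr i, inl j) => (i == j)%:Z
    | (inl i, inr j) => - (i == j)%:Z
    | (inr _, inr _) => 0 end].

Definition isl (j : J) := if j is inl _ then true else false.
Definition fold_sum (T : Type) (d : I -> T) (j : J) : T := match j with inl i => d i | inr i => d i end.

Lemma principal_skew d B : skew_by d B -> skew_by (fold_sum d) (principal B).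
Proof.
move=> [d0 sk]; split=> [[i|i]|[i|i] [j|j]] //=; rewrite !ffunE //=.
- by rewrite [j == i]eq_sym; case: eqP => [->|_]; rewrite ?mulN1r ?mul1r ?oppr0 ?mul0r.
- by rewrite [j == i]eq_sym; case: eqP => [->|_]; rewrite ?mulN1r ?mul1r ?oppr0 ?mul0r ?opprK ?oppr0.
- by rewrite !mul0r oppr0.
Qed.

Lemma principal_unimodular B : unimodular isl (principal B).
Proof.
move=> mu; exists [ffun j => match j with inl _ => 0 | inr i => mu (inl i) end].
case=> // k _; rewrite /wt big_sumType /= big1 ?add0r => [|i _]; last by rewrite !ffunE mul0r.
rewrite (bigD1 k) //= !ffunE eqxx mulr1 big1 ?addr0 // => i /negPf ik.
by rewrite !ffunE ik mulr0.
Qed.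

Definition res m : {ffun I -> int} := [ffun i => m (inl i)].
Definition ext (m : {ffun I -> int}) : {ffun J -> int} :=
  [ffun j => match j with inl i => m i | inr _ => 0 end].

Lemma resD m n : res (m + n) = res m + res n.
Proof. by apply/ffunP => i; rewrite !ffunE. Qed.

Lemma resE m i : res m i = m (inl i). Proof. by rewrite ffunE. Qed.

Definition resl s := [seq (a.1, res a.2) | a <- s].
Definition pos s := (s != [::]) && all (fun a => 0 < a.1) s.

Lemma pos_lmul s t : pos s -> pos t -> pos (lmul s t).
Proof.
case/andP=> s0 ps /andP[t0 pt]; apply/andP; split.
  by case: s t s0 t0 {ps pt} => // a s [].
apply/allP => _ /allpairsP[[a b] /= [/(allP ps) a0 /(allP pt) b0 ->]] /=.
exact: mulr_gt0.
Qed.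

Lemma pos_cat s t : pos s -> pos t -> pos (s ++ t).
Proof. by case/andP=> s0 ps /andP[t0 pt]; rewrite /pos all_cat ps pt; case: (s) s0. Qed.

Lemma resl_cat s t : resl (s ++ t) = resl s ++ resl t.
Proof. exact: map_cat. Qed.

Lemma resl_lmul s t : resl (lmul s t) = lmul (resl s) (resl t).
Proof.
rewrite /resl /lmul map_allpairs; elim: s => //= a s ->; congr cat.
by rewrite -map_comp; apply: eq_map => b /=; rewrite resD.
Qed.

Lemma pos_ev s : pos s -> ev Xt s != 0.
Proof. by case/andP=> s0 ps; apply: ev_pos_neq0. Qed.

Lemma pos_resl s : pos s -> ev X (resl s) != 0.
Proof.
case/andP=> s0 ps; apply: ev_pos_neq0 => //; first by case: (s) s0.
by rewrite all_map.
Qed.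

(* z is the specialisation at q = 1 of the subtraction-free expression zt. *)
Definition spec (zt : G) (z : F) := exists s t,
  [/\ pos s, pos t, zt * ev Xt t = ev Xt s & z * ev X (resl t) = ev X (resl s)].

Lemma specM zt z yt y : spec zt z -> spec yt y -> spec (zt * yt) (z * y).
Proof.
move=> [s [t [ps pt E e]]] [s' [t' [ps' pt' E' e']]].
exists (lmul s s'), (lmul t t'); split; rewrite ?pos_lmul ?resl_lmul ?ev_mul //.
  by rewrite mulrACA E E'.
by rewrite mulrACA e e'.
Qed.

Lemma specD zt z yt y : spec zt z -> spec yt y -> spec (zt + yt) (z + y).
Proof.
move=> [s [t [ps pt E e]]] [s' [t' [ps' pt' E' e']]].
exists (lmul s t' ++ lmul s' t), (lmul t t').
split; rewrite ?pos_cat ?pos_lmul ?resl_cat ?resl_lmul ?ev_cat ?ev_mul //.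
  by rewrite -E -E'; ring.
by rewrite -e -e'; ring.
Qed.

Lemma specV zt z : spec zt z -> spec zt^-1 z^-1.
Proof.
move=> [s [t [ps pt E e]]]; exists t, s; split=> //.
  have z0 : zt != 0 by apply: contraTneq (pos_ev ps) => z0; rewrite -E z0 mul0r eqxx.
  by rewrite -E mulKf.
have z0 : z != 0 by apply: contraTneq (pos_resl ps) => z0; rewrite -e z0 mul0r eqxx.
by rewrite -e mulKf.
Qed.

Lemma spec_mono m : spec (mono Xt m) (mono X (res m)).
Proof.
have res0 : res 0 = 0 by apply/ffunP => i; rewrite !ffunE.
exists [:: (1, m)], [:: (1, 0)].
by split=> //; rewrite /= ?res0 !ev_seq1 !mul1r mono0 mulr1.
Qed.

Lemma spec1 : spec 1 1.
Proof.
rewrite -(mono0 Xt) -(mono0 X) (_ : 0 = res 0); first exact: spec_mono.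
by apply/ffunP => i; rewrite !ffunE.
Qed.

Lemma specXn zt z n : spec zt z -> spec (zt ^+ n) (z ^+ n).
Proof.
move=> zz; elim: n => [|n IH]; first by rewrite !expr0; apply: spec1.
by rewrite !exprS; apply: specM.
Qed.

Lemma spec_prod (T : finType) (ft : T -> G) (f : T -> F) :
  (forall u, spec (ft u) (f u)) -> spec (\prod_u ft u) (\prod_u f u).
Proof.
move=> ff; elim/big_rec2: _ => [|u y x _ xy]; first exact: spec1.
exact: specM.
Qed.

Definition lift_of (St : {ffun J * J -> int} * {ffun J -> G})
    (S : {ffun I * I -> int} * {ffun I -> F}) :=
  [/\ forall i j, St.1 (inl i, inl j) = S.1 (i, j),
      forall i, spec (St.2 (inl i)) (S.2 i) &
      forall i, St.2 (inr i) = Xt (inr i)].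

Lemma spec_frozen i : spec (Xt (inr i)) 1.
Proof.
rewrite -mono_unit -(mono0 X) (_ : 0 = res (unit_exp (inr i))); first exact: spec_mono.
by apply/ffunP => j; rewrite !ffunE.
Qed.

Lemma lift_exch_pos St S k : lift_of St S ->
  spec (exch_pos St.1 St.2 (inl k)) (exch_pos S.1 S.2 k).
Proof.
move=> [SB SX Sq]; rewrite /exch_pos big_sumType /=.
rewrite -[X in spec _ X]mulr1; apply: specM.
  by apply: spec_prod => i; rewrite SB; apply: specXn.
have E1 : (1 : F) = \prod_(i : I) 1 by rewrite big1.
rewrite [X in spec _ X]E1.
apply: spec_prod => i; rewrite Sq -[1](expr1n _ (absz (pos_part (St.1 (inr i, inl k))))).
exact/specXn/spec_frozen.
Qed.

Lemma lift_exch_neg St S k : lift_of St S ->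
  spec (exch_neg St.1 St.2 (inl k)) (exch_neg S.1 S.2 k).
Proof.
move=> [SB SX Sq]; rewrite /exch_neg big_sumType /=.
rewrite -[X in spec _ X]mulr1; apply: specM.
  by apply: spec_prod => i; rewrite SB; apply: specXn.
have E1 : (1 : F) = \prod_(i : I) 1 by rewrite big1.
rewrite [X in spec _ X]E1.
apply: spec_prod => i; rewrite Sq -[1](expr1n _ (absz (pos_part (- St.1 (inr i, inl k))))).
exact/specXn/spec_frozen.
Qed.

Lemma lift_mutate St S k : lift_of St S -> lift_of (mutate St (inl k)) (mutate S k).
Proof.
move=> L; have [SB SX Sq] := L; split=> [i j|i|i] /=.
- by rewrite !ffunE !SB /=.
- rewrite ffunE [in X in spec _ X]ffunE -[_ == inl k]/(i == k); case: eqP => _ //.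
  apply: specM; last exact: specV.
  by apply: specD; [apply: lift_exch_pos|apply: lift_exch_neg].
- by rewrite mut_cluster_other.
Qed.

Lemma lift_mutations St S ks : lift_of St S ->
  lift_of (mutations St [seq inl k | k <- ks]) (mutations S ks).
Proof. by elim: ks St S => //= k ks IH St S /(lift_mutate k) /IH. Qed.

Lemma lift_init B : lift_of (principal B, Xt) (B, X).
Proof.
split=> //= [i j|i]; first by rewrite ffunE.
rewrite -!mono_unit (_ : unit_exp i = res (unit_exp (inl i))); first exact: spec_mono.
by apply/ffunP => j; rewrite !ffunE.
Qed.

Lemma low_pos l s : pos s -> exists2 a, a \in s &
  all (fun b => wt l a.2 <= wt l b.2) s /\ low Xt l (wt l a.2) (ev Xt s).
Proof.
case/andP=> s0 ps; have [a as_ amin] := min_weight l s0; exists a => //; split=> //.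
exists s; split=> //; apply: pos_ev; apply/andP; split.
  by rewrite -has_filter; apply/hasP; exists a.
by apply/allP => b; rewrite mem_filter => /andP[_ /(allP ps)].
Qed.

Lemma low_resl l s a : pos s -> a \in s ->
  all (fun b => wt l (res a.2) <= wt l (res b.2)) s ->
  low X l (wt l (res a.2)) (ev X (resl s)).
Proof.
move=> /andP[s0 ps] as_ amin; exists (resl s); split; rewrite ?all_map //.
apply: ev_pos_neq0 => //.
  rewrite -has_filter; apply/hasP; exists (a.1, res a.2); rewrite //=.
  by apply/mapP; exists a.
apply/allP => b; rewrite mem_filter => /andP[_ /mapP[b' /(allP ps) b0 ->]] //.
Qed.

Lemma spec_low zt e (c : int) i : spec zt (mono X e) -> laurent Xt zt -> (c = 1 \/ c = -1) ->
  low Xt (if c == 1 then unit_exp (inl i) else - unit_exp (inl i)) (c * e i) zt.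
Proof.
move=> [s [t [ps pt E E']]] Lz c1; set l := if _ then _ else _.
pose l0 : {ffun I -> int} := if c == 1 then unit_exp i else - unit_exp i.
have wtr m : wt l m = wt l0 (res m).
  by rewrite /l /l0; case: ifP => _; rewrite ?wtNl !wt_unitl resE.
have wte (m : {ffun I -> int}) : wt l0 m = c * m i.
  by rewrite /l0; case: c1 => -> /=; rewrite ?wtNl wt_unitl; ring.
have z0 : zt != 0 by apply: contraTneq (pos_ev ps) => z0; rewrite -E z0 mul0r eqxx.
have [f lf] := low_exists l z0 Lz.
have [a as_ [amin la]] := low_pos l ps; have [b bt [bmin lb]] := low_pos l pt.
have lar : low X l0 (wt l0 (res a.2)) (ev X (resl s)).
  by apply: low_resl => //; apply/allP => v /(allP amin); rewrite !wtr.
have lbr : low X l0 (wt l0 (res b.2)) (ev X (resl t)).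
  by apply: low_resl => //; apply/allP => v /(allP bmin); rewrite !wtr.
have := lowM fXt lf lb; rewrite E => /(low_uniq cG fXt) /(_ la) E1.
have le := @low_mono I F X cF fX l0 1 e isT; rewrite mul1r in le.
have := lowM fX le lbr; rewrite E' => /(low_uniq cF fX) /(_ lar) E2.
suff -> : c * e i = f by [].
by rewrite -wte; move: E1 E2; rewrite !wtr; lia.
Qed.

Lemma lift_monomial zt e : spec zt (mono X e) -> laurent Xt zt ->
  exists2 q, zt = mono Xt (ext e) * ev Xt q & forall a i, a \in q -> a.2 (inl i) = 0.
Proof.
move=> sz Lz.
have [q zq qe] : exists2 q, zt = ev Xt q & forall a i, a \in q -> i \in enum I -> a.2 (inl i) = e i.
  elim: (enum I) => [|i r [q zq qe]]; first by have [q ->] := Lz; exists q.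
  exists (part (unit_exp (inl i)) (e i) q).
    have lo := spec_low i sz Lz (or_introl erefl); have hi := spec_low i sz Lz (or_intror erefl).
    rewrite /= mul1r mulN1r in lo hi; have [_ ] := low_high cG fXt zq lo hi.
    by rewrite opprK; apply.
  move=> a j; rewrite mem_filter wt_unitl inE => /andP[/eqP ae aq] /orP[/eqP -> //|].
  exact: qe.
exists [seq (a.1, a.2 - ext e) | a <- q].
  rewrite zq /ev mulr_sumr big_map big_seq [RHS]big_seq; apply: eq_bigr => a aq /=.
  rewrite monoB //; field; exact: mono_neq0.
move=> _ i /mapP[a aq ->] /=.
by rewrite !expE (qe a i aq) ?mem_enum // ffunE subrr.
Qed.

(* A Laurent monomial in the cluster Y that specialises to a Laurent monomial in
   X is itself a Laurent monomial in Xt. *)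
Lemma lift_monomial_unit (Y : {ffun J -> G}) zt e n : free_tuple Y ->
  (forall i, Y (inr i) = Xt (inr i)) -> spec zt (mono X e) -> laurent Xt zt ->
  zt = mono Y n -> laurent Y (mono Xt (ext e)) ->
  exists2 m, zt = mono Xt m & res m = e.
Proof.
move=> fY Yq sz Lz zn Le; have Y0 := fY.1.
have [q zq q0] := lift_monomial sz Lz.
have YX m : (forall i, m (inl i) = 0) -> mono Y m = mono Xt m.
  by move=> m0; apply: mono_ext => -[i|i]; rewrite ?m0 ?eqxx.
have qY : ev Xt q = ev Y q.
  rewrite /ev big_seq [RHS]big_seq; apply: eq_bigr => a aq.
  by rewrite YX // => i; apply: q0.
have [|||k [n' [k1 qk]]] := @unit_mono _ _ Y cG fY (ev Y q) (mono Xt (ext e) * mono Y (- n)).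
- by exists q.
- by apply: laurentM => //; apply: laurent_mono.
- by rewrite -qY mulrA [ev Xt q * _]mulrC -zq zn monoN // divff ?mono_neq0.
have n'0 i : n' (inl i) = 0.
  have E0 : ev Y (q ++ [:: (- k, n')]) = 0.
    by rewrite ev_cat ev_seq1 qk rmorphN /= mulNr subrr.
  have := ev_coef0 cG fY n' E0; rewrite /coef big_cat big_cons big_nil /= eqxx addr0.
  have [/hasP[a aq /eqP <-] _|/hasPn qn] := boolP (has (fun a => a.2 == n') q); first exact: q0.
  by rewrite big_seq_cond big1 => [|a /andP[/qn /negPf ->]] //; lia.
exists (ext e + n'); last first.
  by apply/ffunP => i; rewrite resE !expE n'0 ffunE addr0.
suff k_1 : k = 1 by rewrite zq qY qk k_1 mul1r YX // monoD.
(* The sign -1 would make a sum of terms with positive coefficients vanish. *)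
case: k1 => // kN1; have [s [t [ps pt E _]]] := sz.
have /negP[] : ev Xt (s ++ lmul [:: (1, ext e + n')] t) != 0.
  by apply/pos_ev/pos_cat => //; apply: pos_lmul.
rewrite ev_cat ev_mul // ev_seq1 mul1r -E zq qY qk kN1 YX // monoD //.
by apply/eqP; rewrite rmorphN /=; ring.
Qed.

End PrincipalExtension.

Lemma scaled_valuation_eq1 (e1 e2 w1 w2 : int) (q : nat) :
  e1 * q + w1 = e2 * q + w2 -> w2 - w1 = 1 -> q = 1 :> int.
Proof.
move=> E w1E; have : (e1 - e2) * q = 1 by rewrite mulrBl; lia.
by move=> /(congr1 absz) /eqP; rewrite abszM muln_eq1 absz_nat => /andP[_ /eqP ->].
Qed.

(** * Recovering a column of the matrix from an exchange relation *)

Section ExchangeColumn.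
Variables (I : finType) (F G : fieldType).
Hypotheses (cF : char0 F) (cG : char0 G).
Local Notation J := (I + I)%type.
Variables (X : {ffun I -> F}) (Xt : {ffun J -> G}).
Hypotheses (fX : free_tuple X) (fXt : free_tuple Xt).
Variables (d : I -> int) (B : {ffun I * I -> int}).
Hypothesis sk : skew_by d B.

(** An integral multiple of the inverse of [d i], the same multiple for all [i]; it turns a
    symmetrizer on one side of [B] into one on the other. *)
Definition codeg (i : I) : int := \prod_(j | j != i) d j.

Lemma codeg_gt0 i : 0 < codeg i.
Proof. by apply: prodr_gt0 => j _; apply: sk.1. Qed.

Lemma coskew_codeg : coskew codeg B.
Proof.
move=> k l; have [<-|kl] := eqVneq k l; first by rewrite (skew_diag k sk) !mul0r oppr0.
have E i : codeg i * d i = \prod_j d j by rewrite [RHS](bigD1 i) //= mulrC.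
have dk := sk.1 k; have dl := sk.1 l.
apply: (mulIf (_ : d k * d l != 0)); first by rewrite mulf_neq0 ?gt_eqF.
transitivity ((B (l, k) * d k) * (codeg l * d l)); first by ring.
by rewrite sk.2 E -(E k); ring.
Qed.

Definition form_matrix (s t : J) : G :=
  match s, t with
  | inl _, inl _ => 0
  | inl i, inr j => ((i == j)%:Z * codeg i)%:~R
  | inr i, inl j => - ((i == j)%:Z * codeg i)%:~R
  | inr i, inr j => (codeg i * B (i, j))%:~R
  end.

Lemma form_matrix_anti s t : form_matrix s t = - form_matrix t s.
Proof.
case: s t => [i|i] [j|j] /=; rewrite ?oppr0 ?opprK //.
- by rewrite [j == i]eq_sym; case: eqP => [->|]; rewrite ?mul0r.
- by rewrite [j == i]eq_sym; case: eqP => [->|]; rewrite ?mul0r.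
- by rewrite -rmorphN /= mulrC coskew_codeg; congr (_%:~R); ring.
Qed.

Lemma log_canonical_init : log_canonical form_matrix (@isl I) (fold_sum codeg) (principal B)
  (fun j t => (t == j)%:R).
Proof.
move=> j [l|] // _; rewrite /pform (bigD1 j) //= [X in _ + X]big1 => [|s sj]; last first.
  by rewrite big1 // => t _; rewrite (negPf sj) mulr0 mul0r.
have yE t : yvec (principal B) (fun j t => (t == j)%:R) (inl l) t = (principal B (t, inl l))%:~R.
  rewrite /yvec (bigD1 t) //= eqxx mulr1 big1 ?addr0 // => s; rewrite eq_sym => /negPf ->.
  by rewrite mulr0.
under eq_bigr do rewrite yE eqxx mulr1.
rewrite addr0 big_sumType /=; case: j => j /=.
  rewrite big1 ?add0r => [|i _]; last by rewrite mul0r.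
  rewrite (bigD1 j) //= ffunE big1 ?addr0 => [|i ij].
    rewrite eqxx mul1r -[inl j == inl l]/(j == l) -pmulrn !mulrb.
    by case: eqP => [->|_]; rewrite ?mulr1 ?mul1r ?mulr0 ?mul0r.
  by rewrite eq_sym (negPf ij) mul0r mul0r.
rewrite (bigD1 j) //= big1 ?addr0 => [|i ij]; last by rewrite eq_sym (negPf ij) mul0r oppr0 mul0r.
rewrite [X in _ + X](bigD1 l) //= [X in _ + (_ + X)]big1 ?addr0 => [|i il]; last first.
  by rewrite ffunE (negPf il) mulr0.
by rewrite !ffunE !eqxx mul1r mulr1 rmorphM /=; ring.
Qed.

Lemma log_canonical_mutations (D : J -> G -> G) ks (S : {ffun J * J -> int} * {ffun J -> G}) :
  (forall t, derivation (D t)) -> good (fold_sum d) S -> coskew (fold_sum codeg) S.1 ->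
  log_canonical form_matrix (@isl I) (fold_sum codeg) S.1 (fun j t => dlog (D t) (S.2 j)) ->
  all (@isl I) ks -> log_canonical form_matrix (@isl I) (fold_sum codeg) (mutations S ks).1
    (fun j t => dlog (D t) ((mutations S ks).2 j)).
Proof.
move=> dD; elim: ks S => //= k ks IH S gS cS lc /andP[Pk Pks].
apply: IH => //; first exact: good_mutate.
  have ge0 i : 0 < fold_sum codeg i by case: i => i; apply: codeg_gt0.
  (* [coskew] is skew-symmetrizability of the transpose, and transposition commutes with
     mutation. *)
  have coS : skew_by (fold_sum codeg) [ffun p => S.1 (p.2, p.1)].
    by split=> // i j; rewrite !ffunE /= cS.
  move=> i j; have [_ H] := skew_mut k coS; have := H i j.
  have mutT a b : mut_matrix k [ffun p => S.1 (p.2, p.1)] (a, b) = mut_matrix k S.1 (b, a).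
    by rewrite !ffunE /= orbC; case: ifP => // _; ring.
  by rewrite !mutT.
apply: (log_canonical_mut cG form_matrix_anti (d := fold_sum d) (k := k)
  (w := mono S.2 (pcol S.1 k) / exch S.1 S.2 k)) (lc) _ _ => //=; first exact: gS.1.
- by case=> i; apply: codeg_gt0.
- by move=> j t jk; rewrite mut_cluster_other.
- by move=> t; rewrite dlog_mut_cluster //; apply: gS.2.
Qed.

Lemma laurent_nonneg (Y : {ffun J -> G}) (Z : {ffun J -> G}) (m : {ffun J -> int}) :
  nonzero Y -> (forall j, laurent Y (Z j)) -> (forall j, 0 <= m j) -> laurent Y (mono Z m).
Proof.
move=> Y0 LZ m0; apply: laurent_prod => // j; have := m0 j.
by case: (m j) => // n _; apply: laurentXn.
Qed.

(* Lifting the exchange relation to principal coefficients makes the exchange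
   matrix unimodular; there the Laurent phenomenon forces the exchange binomial
   of B at i to divide the given one, so that their exponents differ by a factor
   s.  The Poisson form gives s > 0, and unimodularity at the other seed gives
   s = 1. *)
Theorem exchange_column B' X' k i (np nm : {ffun I -> int}) :
  seed B X B' X' -> X' k = X i ->
  exch_pos B' X' k = mono X np -> exch_neg B' X' k = mono X nm ->
  (forall j, 0 <= np j) -> (forall j, 0 <= nm j) -> np i = 0 -> nm i = 0 ->
  forall j, B (j, i) = np j - nm j.
Proof.
move=> /seed_mutations [ks Sks] xk Ep Em np0 nm0 npi nmi.
have Xt0 := fXt.1.
pose St0 := (principal B, Xt); pose kst := [seq inl k | k <- ks] : seq J.
pose St := mutations St0 kst; pose Y := St.2.
have g0 : good (fold_sum d) St0 by split=> //; apply: principal_skew.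
have gS : good (fold_sum d) St by apply: good_mutations.
have fY : free_tuple Y := gS.2; have Y0 := fY.1.
have lks : all (@isl I) kst by apply/allP => _ /mapP[j _ ->].
have uS : unimodular (@isl I) St.1.
  by apply: (unimodular_mutations cG g0) => //; apply: principal_unimodular.
have lift : lift_of X Xt St (B', X').
  by rewrite -Sks; apply: (lift_mutations cF cG fX fXt); apply: lift_init.
have LY j : laurent Xt (Y j).
  exact: (laurent_phenomenon cG j lks g0.1 (principal_unimodular B) fXt).
(* The Laurent phenomenon applies in the other direction along the reversed sequence, since
   unimodularity is inherited by the final seed. *)
have LXt j : laurent Y (Xt j).
  have lks' : all (@isl I) (rev kst) by rewrite all_rev.
  have := laurent_phenomenon cG j lks' gS.1 uS fY.
  by rewrite -surjective_pairing (mutations_rev cG kst g0).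
have [LB LX Lq] := lift.
pose u := Y (inl k).
have su : spec X Xt u (mono X (unit_exp i)) by rewrite mono_unit -xk; apply: (LX k).
have [mu uE mui] : exists2 m, u = mono Xt m & res m = unit_exp i.
  apply: (lift_monomial_unit cF cG fX fXt (n := unit_exp (inl k)) fY Lq su (LY _)).
    by rewrite mono_unit.
  by apply: laurent_nonneg => // -[j|j]; rewrite ffunE // ffunE.
have sp : spec X Xt (exch_pos St.1 Y (inl k)) (mono X np).
  by rewrite -Ep; apply: (@lift_exch_pos _ _ _ X Xt fX fXt _ (B', X')).
have sm : spec X Xt (exch_neg St.1 Y (inl k)) (mono X nm).
  by rewrite -Em; apply: (@lift_exch_neg _ _ _ X Xt fX fXt _ (B', X')).
rewrite exch_posE in sp; rewrite exch_negE in sm.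
have pcol0 j : 0 <= pcol St.1 (inl k) j by rewrite pcolE pos_part_ge0.
have ncol0 j : 0 <= ncol St.1 (inl k) j by rewrite ncolE pos_part_ge0.
have [mp pE mpi] : exists2 m, mono Y (pcol St.1 (inl k)) = mono Xt m & res m = np.
  apply: (lift_monomial_unit cF cG fX fXt fY Lq sp _ erefl).
    exact: laurent_nonneg.
  by apply: laurent_nonneg => // -[j|j]; rewrite ffunE.
have [mm mE mmi] : exists2 m, mono Y (ncol St.1 (inl k)) = mono Xt m & res m = nm.
  apply: (lift_monomial_unit cF cG fX fXt fY Lq sm _ erefl).
    exact: laurent_nonneg.
  by apply: laurent_nonneg => // -[j|j]; rewrite ffunE.
pose zt := mut_cluster (inl k) St.1 Y (inl k).
(* In the neighbouring cluster [Z], the variable [Xt (inl i)] is the exchange binomial of column [i]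
   over a variable. As [zt] is Laurent in [Z] too, that binomial divides the exchange polynomial
   [zt * u]. *)
pose S1 := mutate St0 (inl i); pose Z := S1.2.
have g1 : good (fold_sum d) S1 by apply: good_mutate.
have fZ : free_tuple Z := g1.2; have Z0 := fZ.1.
have Lz : laurent Z zt.
  have l1 : all (@isl I) (inl i :: rcons kst (inl k)) by rewrite /= all_rcons.
  have u1 : unimodular (@isl I) S1.1.
    by apply: unimodular_mut => //; [apply: skew_diag g0.1|apply: principal_unimodular].
  have := laurent_phenomenon cG (inl k) l1 g1.1 u1 fZ.
  rewrite -surjective_pairing /= (mutate_involutive cG (inl i) g0).
  by rewrite -/mutations mutations_rcons.
have Bii : principal B (inl i, inl i) = 0 by apply: skew_diag g0.1.
pose p := pcol (principal B) (inl i); pose n := ncol (principal B) (inl i).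
have XZ (m : {ffun J -> int}) : m (inl i) = 0 -> mono Xt m = mono Z m.
  by move=> mi; rewrite /Z /S1 /= mono_mut_cluster.
have mui1 : mu (inl i) = 1 by rewrite -resE mui ffunE eqxx.
have mpi0 : mp (inl i) = 0 by rewrite -resE mpi.
have mmi0 : mm (inl i) = 0 by rewrite -resE mmi.
have Xi : Xt (inl i) = (mono Z p + mono Z n) / Z (inl i).
  rewrite -!XZ ?pcol_diag ?ncol_diag // /Z /S1 /= mut_cluster_self -/(exch _ _ _).
  by rewrite invfM invrK mulrA divff ?mul1r ?exch_neq0.
have ztE : (mono Z p + mono Z n) * (zt * mono Z (mu - unit_exp (inl i)) / Z (inl i)) =
    mono Z mp + mono Z mm.
  rewrite -(XZ mp) // -(XZ mm) // -pE -mE -/(exch St.1 Y (inl k)).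
  have u0 : u != 0 := Y0 _.
  have <- : zt * u = exch St.1 Y (inl k) by rewrite /zt mut_cluster_self divfK.
  have -> : u = Xt (inl i) * mono Z (mu - unit_exp (inl i)).
    rewrite -XZ; last by rewrite !expE mui1 eqxx subrr.
    by rewrite -{1}(mono_unit Xt (inl i)) -monoD // addrC subrK.
  by rewrite Xi; ring.
have pn : p != n.
  apply/eqP => /ffunP /(_ (inr i)); rewrite pcolE ncolE ffunE eqxx.
  by rewrite pos_part_pos // pos_part_neg.
have Lg : laurent Z (zt * mono Z (mu - unit_exp (inl i)) / Z (inl i)).
  apply: laurentM => //; first by apply: laurentM => //; apply: laurent_mono.
  by rewrite -mono_unit -monoN //; apply: laurent_mono.
pose b := bcol (principal B) (inl i); pose s := (mp - mm) (inr i).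
have bq : b (inr i) = 1 by rewrite bcolE ffunE eqxx.
have mb l : (mp - mm) l = s * b l.
  (* This weight vanishes on [b], so the dividing binomial is homogeneous for it. *)
  pose la := unit_exp l - (unit_exp (inr i) *~ b l).
  have wla m : wt la m = m l - b l * m (inr i).
    have wtDl (l1 l2 m' : {ffun J -> int}) : wt (l1 + l2) m' = wt l1 m' + wt l2 m'.
      by rewrite /wt -big_split; apply: eq_bigr => j _; rewrite expDE mulrDl.
    have wtMl (c : int) (l1 m' : {ffun J -> int}) : wt (l1 *~ c) m' = c * wt l1 m'.
      rewrite /wt mulr_sumr; apply: eq_bigr => j _.
      have -> : (l1 *~ c) j = l1 j * c.
        by case: c => q; rewrite ?NegzE ?mulrNz ?expNE -pmulrn expMnE //; ring.
      by ring.
    by rewrite /la wtDl wtNl wtMl !wt_unitl.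
  have := binomial_factor cG fZ (l := la) pn Lg ztE; rewrite !wla => H.
  have {}H : mp l - b l * mp (inr i) = mm l - b l * mm (inr i).
    apply: H; have := pncol (principal B) (inl i) => /ffunP pnb.
    have := pnb l; have := pnb (inr i); rewrite -/b -/p -/n bq !expE => Hq Hl.
    by rewrite -Hl (_ : p (inr i) = n (inr i) + 1); [ring|lia].
  by rewrite /s !expE; lia.
have mbE : mp - mm = b *~ s.
  apply/ffunP => l; rewrite mb.
  by case: (s) => q; rewrite ?NegzE ?mulrNz ?expNE -pmulrn expMnE; ring.
have [_ [D [dD DX]]] := fXt.
have dX j t : dlog (D t) (Xt j) = (t == j)%:R by rewrite /dlog DX mulfK.
have lc0 : log_canonical form_matrix (@isl I) (fold_sum codeg) St0.1
    (fun j t => dlog (D t) (St0.2 j)).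
  move=> j l Pl; have := log_canonical_init j Pl.
  rewrite /pform /yvec /= => <-; apply: eq_bigr => a _; apply: eq_bigr => c _.
  by rewrite dX; congr (_ * _); apply: eq_bigr => v _; rewrite dX.
have ck0 : coskew (fold_sum codeg) St0.1.
  move=> [a|a] [c|c]; rewrite /= !ffunE //; first exact: coskew_codeg.
  - by rewrite [c == a]eq_sym; case: eqP => [->|_]; rewrite ?mul1r ?mulN1r ?mul0r ?oppr0 ?mul0r ?opprK.
  - by rewrite [c == a]eq_sym; case: eqP => [->|_]; rewrite ?mul1r ?mulN1r ?mul0r ?oppr0 ?mul0r ?opprK.
  - by rewrite !mul0r oppr0.
have lcS := log_canonical_mutations dD g0 ck0 lc0 lks.
have E1 := lcS (inl k) (inl k) isT; rewrite eqxx mul1r /= -/St in E1.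
have xiE t : dlog (D t) u = \sum_j (mu j)%:~R * dlog (D t) (Xt j) by rewrite uE dlog_mono.
have yE t : yvec St.1 (fun j t => dlog (D t) (St.2 j)) (inl k) t =
    s%:~R * yvec (principal B) (fun j t => dlog (D t) (Xt j)) (inl i) t.
  transitivity (dlog (D t) (mono Y (pcol St.1 (inl k))) - dlog (D t) (mono Y (ncol St.1 (inl k)))).
    rewrite !dlog_mono // -sumrB; apply: eq_bigr => j _.
    by rewrite -mulrBl -rmorphB /= -bcolE -pncol !expE.
  rewrite pE mE !dlog_mono // -sumrB mulr_sumr; apply: eq_bigr => j _.
  by rewrite -mulrBl -rmorphB /= mulrA -rmorphM /= -bcolE -/b -mb !expE.
(* The pairing of [u] with its column is [codeg k] in the final seed; with both expanded in the
   initial seed, it is [s * codeg i]. *)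
have s_codeg : codeg k = s * codeg i.
  apply/eqP; rewrite -subr_eq0; apply/eqP/cG; rewrite rmorphB /= rmorphM /= -E1.
  rewrite (pform_suml form_matrix_anti _ (c := fun j => (mu j)%:~R) xiE).
  rewrite (bigD1 (inl i)) //= mui1 mul1r.
  have pf j : pform form_matrix (fun t => dlog (D t) (Xt j))
      (yvec St.1 (fun j t => dlog (D t) (St.2 j)) (inl k)) =
      s%:~R * ((j == inl i)%:R * (codeg i)%:~R).
    rewrite -(lc0 j (inl i)) // /pform mulr_sumr; apply: eq_bigr => a _.
    by rewrite mulr_sumr; apply: eq_bigr => c _; rewrite yE /=; ring.
  rewrite pf eqxx mul1r big1 ?addr0 ?subrr // => j /negPf ji.
  by rewrite pf ji mul0r !mulr0.
have s0 : 0 < s by rewrite -(pmulr_lgt0 _ (codeg_gt0 i)) -s_codeg codeg_gt0.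
have [q sq] : exists q, s = q%:Z by exists (absz s); rewrite gez0_abs // ltW.
have s1 : s = 1.
  (* The initial monomials of [p] and [n] are only Laurent polynomials in [Y], so their valuations
     replace weights. Comparing valuations in [EE] exhibits 1 as a multiple of [q]. *)
  have [la laP] := uS (fun=> 1); have := laP (inl k) isT; rewrite -pncol wtB => la1.
  have p0 j : 0 <= p j by rewrite pcolE pos_part_ge0.
  have n0 j : 0 <= n j by rewrite ncolE pos_part_ge0.
  have Lp : laurent Y (mono Xt p) by apply: laurent_nonneg.
  have Ln : laurent Y (mono Xt n) by apply: laurent_nonneg.
  have [e1 le1] := low_exists la (mono_neq0 p Xt0) Lp.
  have [e2 le2] := low_exists la (mono_neq0 n Xt0) Ln.
  have EE : mono Xt p ^+ q * mono Y (ncol St.1 (inl k)) =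
      mono Xt n ^+ q * mono Y (pcol St.1 (inl k)).
    rewrite pE mE !mono_exprn -!monoD //; congr (mono Xt _); apply/ffunP => l.
    have := mb l; rewrite /b -pncol -/p -/n !expE sq => /eqP; rewrite subr_eq => /eqP ->.
    by ring.
  have lo m : low Y la (wt la m) (mono Y m).
    by have := @low_mono J G Y cG fY la 1 m isT; rewrite mul1r.
  have := lowM fY (lowXn cG fY q le1) (lo (ncol St.1 (inl k))).
  rewrite EE => /(low_uniq cG fY) /(_ (lowM fY (lowXn cG fY q le2) (lo (pcol St.1 (inl k))))).
  rewrite -[e1 *+ q]mulr_natr -[e2 *+ q]mulr_natr natz => EW; rewrite sq.
  exact: (scaled_valuation_eq1 EW la1).
move=> j; have := mb (inl j); rewrite s1 mul1r bcolE !expE -!resE mpi mmi => ->.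
by rewrite ffunE.
Qed.

End ExchangeColumn.

(** * Fields of rational functions *)

Section FractionDerivation.
Variables (R : idomainType) (D : R -> R).
Hypotheses (DD : forall x y, D (x + y) = D x + D y)
  (DM : forall x y, D (x * y) = D x * y + x * D y).
Local Notation F := {fraction R}.

Lemma fraction_ex (x : F) : exists n d, d != 0 /\ x = tofrac n / tofrac d.
Proof.
elim/quotW: x => x; exists \n_x, \d_x; split; first exact: denom_ratioP.
have d0 := denom_ratioP x.
apply: (canRL (mulfK _)); first by rewrite tofrac_eq0.
unlock FracField.tofrac; rewrite -[LHS]FracField.pi_mul; apply/eqmodP.
rewrite /= FracField.equivfE /FracField.mulf !numden_Ratio ?oner_eq0 ?mulr1 //.
by rewrite mulrC.
Qed.

Definition fraction_num (x : F) := projT1 (cid (fraction_ex x)).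
Definition fraction_den (x : F) := projT1 (cid (projT2 (cid (fraction_ex x)))).

Lemma fraction_denP x : fraction_den x != 0.
Proof. exact: (projT2 (cid (projT2 (cid (fraction_ex x))))).1. Qed.

Lemma fractionE x : x = tofrac (fraction_num x) / tofrac (fraction_den x).
Proof. exact: (projT2 (cid (projT2 (cid (fraction_ex x))))).2. Qed.

Definition fraction_der (x : F) : F :=
  let n := fraction_num x in let d := fraction_den x in
  tofrac (D n * d - n * D d) / tofrac (d ^+ 2).

(** Independence of the chosen representative: two of them satisfy [n * d' = n' * d], and
    differentiating this identity makes the two quotient rules agree. *)
Lemma fraction_derE n d : d != 0 ->
  fraction_der (tofrac n / tofrac d) = tofrac (D n * d - n * D d) / tofrac (d ^+ 2).
Proof.
move=> d0; rewrite /fraction_der; set x := tofrac n / tofrac d.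
have := fractionE x; set n' := fraction_num x; set d' := fraction_den x => E.
have d'0 : d' != 0 by apply: fraction_denP.
have E' : n * d' = n' * d.
  apply/eqP; rewrite -tofrac_eq !tofracM; apply/eqP.
  by move: E; rewrite /x => /eqP; rewrite eqr_div ?tofrac_eq0 // => /eqP.
apply/eqP; rewrite eqr_div ?tofrac_eq0 ?expf_neq0 // -!tofracM tofrac_eq; apply/eqP.
have := congr1 D E'; rewrite !DM => E2.
have E3 : (D n' * d - n * D d') = D n * d' - n' * D d.
  by apply/eqP; rewrite subr_eq addrAC -subr_eq opprK E2 eqxx.
transitivity (d * d' * (D n' * d) - d * D d' * (n' * d)); first by ring.
rewrite -E'; transitivity (d * d' * (D n' * d - n * D d')); first by ring.
rewrite E3; transitivity (D n * d * d' ^+ 2 - d' * D d * (n' * d)); first by ring.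
by rewrite -E'; ring.
Qed.

Lemma fraction_derivation : derivation fraction_der.
Proof.
split=> x y; have := fractionE x; have := fractionE y; have := fraction_denP x; have := fraction_denP y;
  set n := fraction_num x; set d := fraction_den x; set n' := fraction_num y;
  set d' := fraction_den y => d'0 d0 -> ->.
  have -> : tofrac n / tofrac d + tofrac n' / tofrac d' = tofrac (n * d' + n' * d) / tofrac (d * d').
    by rewrite tofracD !tofracM addf_div ?tofrac_eq0.
  rewrite !fraction_derE ?mulf_neq0 // addf_div ?tofrac_eq0 ?expf_neq0 //.
  rewrite -!tofracM -tofracD -exprMn; congr (tofrac _ / _).
  by rewrite DD !DM; ring.
have -> : tofrac n / tofrac d * (tofrac n' / tofrac d') = tofrac (n * n') / tofrac (d * d').
  by rewrite !tofracM mulf_div.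
rewrite !fraction_derE ?mulf_neq0 // !mulf_div addf_div -?tofracM ?tofrac_eq0 ?mulf_neq0 ?expf_neq0 //.
apply/eqP; rewrite -tofracD eqr_div ?tofrac_eq0 ?mulf_neq0 ?expf_neq0 //.
rewrite -!tofracM tofrac_eq; apply/eqP; rewrite !DM; ring.
Qed.

Lemma fraction_der_tofrac n : fraction_der (tofrac n) = tofrac (D n).
Proof.
have D1 : D 1 = 0 by have := DM 1 1; rewrite !mulr1 mul1r => /eqP; rewrite -subr_eq subrr eq_sym => /eqP.
rewrite -[tofrac n]divr1 -tofrac1 fraction_derE ?oner_eq0 //.
by rewrite D1 mulr1 mulr0 subr0 expr1n tofrac1 divr1.
Qed.

End FractionDerivation.

Section RationalFunctions.
Variable I : finType.

Lemma char0_rat_fun : char0 (rat_fun I).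
Proof.
move=> z /eqP; rewrite -(rmorph_int (@tofrac _)) tofrac_eq0.
by rewrite -[_%:~R]/(intmul 1 z) -(@rmorph_int _ _ (@mpolyC #|I| rat)) mpolyC_eq0 intr_eq0 => /eqP.
Qed.

Lemma free_indets : free_tuple (indets I).
Proof.
split=> [i|]; first rewrite ffunE tofrac_eq0.
  apply/eqP => /(congr1 (mcoeff (mnm1 (enum_rank i)))) /eqP.
  by rewrite mcoeffX eqxx mcoeff0 oner_eq0.
(* The Euler operator of one variable, under which every indeterminate is an eigenvector. *)
pose D (i : I) : mpoly #|I| rat -> mpoly #|I| rat :=
  fun f => mpolyX rat (mnm1 (enum_rank i)) * mderiv (enum_rank i) f.
have DD i f g : D i (f + g) = D i f + D i g by rewrite /D mderivD mulrDr.
have DM i f g : D i (f * g) = D i f * g + f * D i g.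
  rewrite /D mderivM mulrDr !mulrA; congr (_ + _); congr (_ * _); exact: mulrC.
exists (fun i => fraction_der (D i)).
split=> [i|i j]; first exact: (fraction_derivation (DD i) (DM i)).
rewrite ffunE (fraction_der_tofrac (DM i)) // /D mderivX mnm1E.
have [->|ij] := eqVneq i j; last first.
  by rewrite (inj_eq enum_rank_inj) eq_sym (negPf ij) scale0r mulr0 tofrac0 mul0r.
rewrite eqxx scale1r mul1r (_ : mnm_sub _ _ = mnm0) ?mpolyX0 ?mulr1 //.
by apply/mnmP => k; rewrite mnmBE mnm0E subnn.
Qed.

End RationalFunctions.

(** * Commuting mutations and relabellings *)

Section CommutingMutations.
Variables (I : finType) (F : fieldType).
Implicit Types (B : {ffun I * I -> int}) (X : {ffun I -> F}) (s : seq I).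

Definition multi_mut s B i j : int :=
  if (i \in s) || (j \in s) then - B (i, j)
  else B (i, j) + \sum_(k <- s) (pos_part (B (i, k)) * pos_part (B (k, j))
         - pos_part (- B (i, k)) * pos_part (- B (k, j))).

(** With no arrows inside [s], a mutation at one member changes neither the row and column of
    another nor the variables in its exchange binomial. *)
Lemma mutations_commuting s B X : uniq s -> {in s &, forall k l, B (k, l) = 0} ->
  (forall i j, (mutations (B, X) s).1 (i, j) = multi_mut s B i j) /\
  (forall i, (mutations (B, X) s).2 i = if i \in s then exch B X i / X i else X i).
Proof.
elim/last_ind: s => [|s k IH] us s0.
  by split=> [i j|i] //=; rewrite /multi_mut big_nil addr0.
move: us; rewrite rcons_uniq => /andP[ks us].
have [||IHB IHX] := IH => //.
  by move=> a b as_ bs; apply: s0; rewrite mem_rcons inE ?as_ ?bs orbT.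
have sk0 a : a \in s -> B (a, k) = 0 /\ B (k, a) = 0.
  by move=> as_; split; apply: s0; rewrite mem_rcons inE ?as_ ?orbT ?eqxx.
have colk i : multi_mut s B i k = B (i, k).
  rewrite /multi_mut (negPf ks) orbF; case: ifP => [/sk0 [-> _]|_]; first by rewrite oppr0.
  rewrite big_seq big1 ?addr0 // => a /sk0 [-> _].
  by rewrite oppr0 pos_part0 !mulr0 subr0.
have rowk i : multi_mut s B k i = B (k, i).
  rewrite /multi_mut (negPf ks) /=; case: ifP => [/sk0 [_ ->]|_]; first by rewrite oppr0.
  rewrite big_seq big1 ?addr0 // => a /sk0 [_ ->].
  by rewrite oppr0 pos_part0 !mul0r subr0.
rewrite mutations_rcons; split=> [i j|i] /=.
  have [h|] := boolP ((i == k) || (j == k)).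
    rewrite mut_matrix_in // IHB /multi_mut !mem_rcons !inE.
    have -> : [|| (i == k) || (i \in s), j == k | j \in s].
      by case/orP: h => ->; rewrite ?orbT.
    by congr (- _); case/orP: h => /eqP ->; rewrite -/(multi_mut _ _ _ _) ?rowk ?colk.
  rewrite negb_or => /andP[ik jk]; rewrite mut_matrix_out // !IHB !colk !rowk.
  rewrite /multi_mut !mem_rcons !inE (negPf ik) (negPf jk) /= -cats1 big_cat big_seq1 /=.
  case: ifP => [/orP[/sk0 [-> _]|/sk0 [_ ->]]|_].
  - by rewrite oppr0 pos_part0 !mul0r subr0 addr0.
  - by rewrite oppr0 pos_part0 !mulr0 subr0 addr0.
  - by ring.
rewrite mem_rcons inE; have [->|ik] /= := eqVneq i k; last first.
  by rewrite mut_cluster_other // IHX.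
rewrite mut_cluster_self IHX (negPf ks); congr (_ / _).
have cX (m : {ffun I -> int}) : (forall a, a \in s -> m a = 0) ->
    mono (mutations (B, X) s).2 m = mono X m.
  move=> m0; apply: mono_ext => j; rewrite IHX; case: ifP => // /m0 ->.
  by rewrite eqxx.
rewrite /exch (_ : pcol (mutations (B, X) s).1 k = pcol B k); last first.
  by apply/ffunP => j; rewrite !pcolE IHB colk.
rewrite (_ : ncol (mutations (B, X) s).1 k = ncol B k); last first.
  by apply/ffunP => j; rewrite !ncolE IHB colk.
by rewrite !cX // => a /sk0 [E _]; rewrite ?pcolE ?ncolE E ?oppr0 pos_part0.
Qed.

End CommutingMutations.

Section Relabelling.
Variables (I : finType) (F : fieldType).
Implicit Types (B : {ffun I * I -> int}) (X : {ffun I -> F}) (s : {perm I})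
  (S : {ffun I * I -> int} * {ffun I -> F}).

Definition rel_mx s B : {ffun I * I -> int} := [ffun p => B (s p.1, s p.2)].
Definition rel_tuple s X : {ffun I -> F} := [ffun i => X (s i)].
Definition relabel s S := (rel_mx s S.1, rel_tuple s S.2).

Lemma rel_exch_pos s B X k : exch_pos (rel_mx s B) (rel_tuple s X) k = exch_pos B X (s k).
Proof.
rewrite /exch_pos [RHS](reindex_inj (@perm_inj _ s)) /=.
by apply: eq_bigr => j _; rewrite !ffunE.
Qed.

Lemma rel_exch_neg s B X k : exch_neg (rel_mx s B) (rel_tuple s X) k = exch_neg B X (s k).
Proof.
rewrite /exch_neg [RHS](reindex_inj (@perm_inj _ s)) /=.
by apply: eq_bigr => j _; rewrite !ffunE.
Qed.

Lemma mutate_relabel s S k : mutate (relabel s S) k = relabel s (mutate S (s k)).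
Proof.
congr pair.
  by apply/ffunP => -[i j]; rewrite !ffunE /= !(inj_eq perm_inj).
apply/ffunP => i; rewrite /= !ffunE (inj_eq perm_inj); case: eqP => // _.
by rewrite rel_exch_pos rel_exch_neg.
Qed.

Lemma mutations_relabel s S ks :
  mutations (relabel s S) ks = relabel s (mutations S [seq s k | k <- ks]).
Proof. by elim: ks S => //= k ks IH S; rewrite mutate_relabel IH. Qed.

Lemma relabelM s t S : relabel s (relabel t S) = relabel (s * t)%g S.
Proof.
by congr pair; apply/ffunP => x; rewrite !ffunE /= !permM.
Qed.

Lemma relabel1 S : relabel 1%g S = S.
Proof.
by case: S => B X; congr pair; apply/ffunP; [case=> i j|move=> i]; rewrite !ffunE /= !perm1.
Qed.

Lemma relabelVK s S : relabel s^-1%g (relabel s S) = S.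
Proof. by rewrite relabelM mulVg relabel1. Qed.

Lemma free_rel s X : free_tuple X -> free_tuple (rel_tuple s X).
Proof.
move=> [X0 [D [dD DX]]]; split=> [i|]; first by rewrite ffunE.
exists (fun i => D (s i)); split=> // i j.
by rewrite ffunE DX (inj_eq perm_inj).
Qed.

Lemma mutations_seed B X ks : seed B X (mutations (B, X) ks).1 (mutations (B, X) ks).2.
Proof.
elim/last_ind: ks => [|ks k IH]; first exact: SeedInit.
by rewrite mutations_rcons /=; constructor.
Qed.

Lemma mutations_cat S ks ls : mutations S (ks ++ ls) = mutations (mutations S ks) ls.
Proof. exact: foldl_cat. Qed.

Definition seed_rel S S' := exists ks, S' = mutations S ks.

Lemma seedP S S' : seed S.1 S.2 S'.1 S'.2 <-> seed_rel S S'.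
Proof.
split=> [/seed_mutations[ks E]|[ks ->]].
  by exists ks; move: E; rewrite -!surjective_pairing => ->.
by have := mutations_seed S.1 S.2 ks; rewrite -surjective_pairing.
Qed.

Lemma seed_rel_trans S S' S'' : seed_rel S S' -> seed_rel S' S'' -> seed_rel S S''.
Proof. by move=> [ks ->] [ls ->]; exists (ks ++ ls); rewrite mutations_cat. Qed.

Lemma seed_rel_relabel s S S' : seed_rel S S' -> seed_rel (relabel s S) (relabel s S').
Proof.
move=> [ks ->]; exists [seq s^-1%g k | k <- ks]; rewrite mutations_relabel.
by rewrite -map_comp (eq_map (permKV s)) map_id.
Qed.

Lemma seed_rel_sym (c0 : char0 F) d S S' : good d S -> seed_rel S S' -> seed_rel S' S.
Proof. by move=> gS [ks ->]; exists (rev ks); rewrite (mutations_rev c0 ks gS). Qed.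

End Relabelling.

(** * The exchange matrix of a T-datum *)

Section TExchangeMatrix.
Variables (r : nat) (sigma : 'S_r) (p : 'I_r -> nat).
Variables (P M : 'I_r -> 'I_r -> nat -> int) (d : 'I_r -> int).
Hypotheses (p0 : forall a, (0 < p a)%N) (d0 : forall a, 0 < d a).
Hypotheses (P0 : forall b a k, 0 <= P b a k) (M0 : forall b a k, 0 <= M b a k).
Hypotheses (Pz : forall b a k, ~~ (0 < k < p b)%N -> P b a k = 0)
  (Mz : forall b a k, ~~ (0 < k < p b)%N -> M b a k = 0).
Hypothesis PM0 : forall b a k, P b a k * M b a k = 0.
Hypothesis dsigma : forall a, d (sigma a) = d a.
Hypotheses (dvP : forall b c k, (d b %| P b c k * d c)%Z)
  (dvM : forall b c k, (d b %| M b c k * d c)%Z).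

Definition cdiff b a k := P b a k - M b a k.

(* The pairs (s, t) with s - t = x - y, s <= x, t <= y; the truncated
   subtractions only produce indices 0, where the coefficients vanish. *)
Definition conv a x b y : int := \sum_c d c * \sum_(v < (x + y).+1)
  (M a c (x - v)%N * P b c (y - v)%N - P a c (x - v)%N * M b c (y - v)%N).

Hypothesis sympl : forall a b q, (q <= p b)%N ->
  cdiff b (sigma^-1%g a) q * d (sigma^-1%g a) =
  cdiff a b (p a - q)%N * d b - cdiff b a (q - p a)%N * d a + conv a (p a) b q.

(** The skew-symmetric form [B * D]. Its column at [y = 0] is dictated by the T-system; each step
    along a diagonal adds one simultaneous-mutation correction, and these add up to [conv]. *)
Definition wform a x b y : int :=
  cdiff a b (x - y)%N * d b - cdiff b a (y - x)%N * d a + conv a x b y.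

Lemma P_0 b a : P b a 0%N = 0. Proof. exact: Pz. Qed.
Lemma M_0 b a : M b a 0%N = 0. Proof. exact: Mz. Qed.
Lemma P_p b a : P b a (p b) = 0. Proof. by apply: Pz; rewrite ltnn andbF. Qed.
Lemma M_p b a : M b a (p b) = 0. Proof. by apply: Mz; rewrite ltnn andbF. Qed.
Lemma cdiff_0 b a : cdiff b a 0%N = 0. Proof. by rewrite /cdiff P_0 M_0. Qed.
Lemma cdiff_p b a : cdiff b a (p b) = 0. Proof. by rewrite /cdiff P_p M_p. Qed.

Lemma d_neq0 a : d a != 0. Proof. by rewrite gt_eqF. Qed.

Lemma conv_anti a x b y : conv a x b y = - conv b y a x.
Proof.
rewrite -sumrN; apply: eq_bigr => c _; rewrite -mulrN -sumrN addnC; congr (_ * _).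
by apply: eq_bigr => v _; ring.
Qed.

Lemma wform_anti a x b y : wform a x b y = - wform b y a x.
Proof. by rewrite /wform conv_anti; ring. Qed.

Lemma wform0r a x b : wform a x b 0 = cdiff a b x * d b.
Proof.
rewrite /wform subn0 sub0n cdiff_0 mul0r subr0 [conv _ _ _ _]big1 ?addr0 // => c _.
by rewrite big1 ?mulr0 // => v _; rewrite sub0n P_0 M_0 !mulr0 subr0.
Qed.

Lemma convS a x b y : conv a x.+1 b y.+1 =
  \sum_c d c * (M a c x.+1 * P b c y.+1 - P a c x.+1 * M b c y.+1) + conv a x b y.
Proof.
rewrite -big_split; apply: eq_bigr => c _ /=; rewrite -mulrDr; congr (_ * _).
rewrite big_ord_recl !subn0; congr (_ + _).
rewrite addSn addnS big_ord_recr /= [X in _ + X](_ : _ = 0) ?addr0.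
  by apply: eq_bigr => v _; rewrite /= /bump /= add1n !subSS.
rewrite /bump /= add1n !subSS (_ : (x - (x + y).+1)%N = 0%N) ?P_0 ?M_0 ?mul0r ?subr0 //.
by apply/eqP; rewrite subn_eq0 leqW // leq_addr.
Qed.

Lemma wformS a x b y : wform a x.+1 b y.+1 = wform a x b y +
  \sum_c d c * (M a c x.+1 * P b c y.+1 - P a c x.+1 * M b c y.+1).
Proof. by rewrite /wform !subSS convS; ring. Qed.

(** The symplectic condition, taken at [y.+1]. The diagonal step from [(p a).-1] to [p a] adds
    nothing, because the coefficients at [p a] vanish. *)
Lemma wform_last a b y : (y < p b)%N ->
  wform a (p a).-1 b y = cdiff b (sigma^-1%g a) y.+1 * d (sigma^-1%g a).
Proof.
move=> yp; rewrite sympl // -/(wform _ _ _ _) -[in RHS](prednK (p0 a)) wformS.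
rewrite big1 ?addr0 // => c _.
by rewrite (prednK (p0 a)) P_p M_p !mul0r subr0 mulr0.
Qed.

(** Integrality of the conjugates of [N_+] and [N_-] by [D] is what makes the quotient in [Bmx]
    exact. *)
Lemma dvd_wform a x b y : (d b %| wform a x b y)%Z.
Proof.
have dvc e f k : (d e %| cdiff e f k * d f)%Z by rewrite /cdiff mulrBl rpredB.
rewrite /wform; apply: rpredD.
  by apply: rpredB => //; apply: dvdz_mull.
apply: rpred_sum => c _; rewrite mulr_sumr; apply: rpred_sum => v _.
by rewrite mulrBr; apply: rpredB; rewrite mulrCA; apply: dvdz_mull; rewrite mulrC.
Qed.

Local Notation Rin := (R_in p).

(** An out-of-range [x] is sent to position 0. *)
Definition mkI a (x : nat) : Rin :=
  Tagged (fun b => 'I_(p b)) (insubd (Ordinal (p0 a)) x).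

Definition pos_of (i : Rin) : nat := tagged i.

Lemma tag_mkI a x : tag (mkI a x) = a. Proof. by []. Qed.

Lemma pos_mkI a x : (x < p a)%N -> pos_of (mkI a x) = x.
Proof. by move=> xp; rewrite /pos_of /= val_insubd xp. Qed.

Lemma pos_lt (i : Rin) : (pos_of i < p (tag i))%N.
Proof. exact: ltn_ord. Qed.

Lemma Rin_eq (i j : Rin) : tag i = tag j -> pos_of i = pos_of j -> i = j.
Proof.
case: i j => [a x] [b y] /= ab; case: b / ab y => y xy.
by congr Tagged; apply: val_inj.
Qed.

Lemma mkI_of (i : Rin) : mkI (tag i) (pos_of i) = i.
Proof. by apply: Rin_eq; rewrite ?pos_mkI // pos_lt. Qed.

Definition Bmx : {ffun Rin * Rin -> int} := [ffun ij =>
  (wform (tag ij.1) (pos_of ij.1) (tag ij.2) (pos_of ij.2) %/ d (tag ij.2))%Z].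

Lemma BmxE i j : Bmx (i, j) * d (tag j) = wform (tag i) (pos_of i) (tag j) (pos_of j).
Proof. by rewrite ffunE divzK // dvd_wform. Qed.

Lemma Bmx_skew : skew_by (fun i => d (tag i)) Bmx.
Proof. by split=> // i j; rewrite !BmxE wform_anti. Qed.

Lemma Bmx_col i a : Bmx (i, mkI a 0) = cdiff (tag i) a (pos_of i).
Proof.
apply: (mulIf (d_neq0 a)).
by rewrite -{1}[a in d a](tag_mkI a 0) BmxE pos_mkI // wform0r.
Qed.

Lemma pos_cdiff b a k : pos_part (cdiff b a k) = P b a k.
Proof.
have /eqP := PM0 b a k; rewrite mulf_eq0 /cdiff => /orP[/eqP E|/eqP E]; rewrite E ?sub0r ?subr0.
  by rewrite pos_part_neg // oppr_le0.
exact: pos_part_pos.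
Qed.

Lemma neg_cdiff b a k : pos_part (- cdiff b a k) = M b a k.
Proof. by rewrite pos_partN pos_cdiff /cdiff; ring. Qed.

(** The relabelling after one time step: positions drop by 1, and the variable just produced at
    [(a, 0)] is the last one of the window of [sigma a]. *)
Definition nu_fun (i : Rin) : Rin :=
  if pos_of i == 0%N then mkI (sigma (tag i)) (p (sigma (tag i))).-1
  else mkI (tag i) (pos_of i).-1.

Lemma pred_lt a : ((p a).-1 < p a)%N. Proof. by rewrite prednK. Qed.

Lemma pos_nu0 i : pos_of i = 0%N ->
  tag (nu_fun i) = sigma (tag i) /\ pos_of (nu_fun i) = (p (sigma (tag i))).-1.
Proof. by rewrite /nu_fun => ->; rewrite eqxx pos_mkI // pred_lt. Qed.

Lemma pos_nuS i x : pos_of i = x.+1 -> tag (nu_fun i) = tag i /\ pos_of (nu_fun i) = x.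
Proof.
move=> ix; rewrite /nu_fun ix /= pos_mkI //.
by have := pos_lt i; rewrite ix; apply: ltnW.
Qed.

Lemma nu_inj : injective nu_fun.
Proof.
move=> i j ij; have pi := pos_lt i; have pj := pos_lt j.
case Ei: (pos_of i) => [|x]; case Ej: (pos_of j) => [|y].
- have [ti _] := pos_nu0 Ei; have [tj _] := pos_nu0 Ej.
  by apply: Rin_eq; [apply: (@perm_inj _ sigma); rewrite -ti -tj ij|rewrite Ei Ej].
- have [ti xi] := pos_nu0 Ei; have [tj xj] := pos_nuS Ej.
  by move: pj; rewrite Ej -xj -tj -ij xi ti prednK // ltnn.
- have [ti xi] := pos_nuS Ei; have [tj xj] := pos_nu0 Ej.
  by move: pi; rewrite Ei -xi -ti ij xj tj prednK // ltnn.
- have [ti xi] := pos_nuS Ei; have [tj xj] := pos_nuS Ej.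
  by apply: Rin_eq; [rewrite -ti -tj ij|rewrite Ei Ej -xi -xj ij].
Qed.

Definition nu : {perm Rin} := perm nu_inj.

Definition zeros : seq Rin := [seq mkI a 0 | a <- enum 'I_r].

Lemma zeros_uniq : uniq zeros.
Proof. by rewrite map_inj_uniq ?enum_uniq // => a b /(congr1 tag). Qed.

Lemma mem_zeros i : (i \in zeros) = (pos_of i == 0%N).
Proof.
apply/mapP/eqP => [[a _ ->]|i0]; first by rewrite pos_mkI.
by exists (tag i); rewrite ?mem_enum // -i0 mkI_of.
Qed.

Lemma Bmx_zeros : {in zeros &, forall k l, Bmx (k, l) = 0}.
Proof.
move=> k l; rewrite !mem_zeros => /eqP k0 /eqP l0.
by rewrite -[l]mkI_of l0 Bmx_col k0 cdiff_0.
Qed.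

(** When [i] or [j] has position 0, this is [wform_last], hence the symplectic condition. For two
    positive positions it is [wformS], whose increment is the mutation correction. *)
Lemma Bmx_nu i j : Bmx (nu i, nu j) = multi_mut zeros Bmx i j.
Proof.
rewrite !permE; apply: (mulIf (d_neq0 (tag (nu_fun j)))).
rewrite BmxE /multi_mut !mem_zeros.
have pi := pos_lt i; have pj := pos_lt j.
case Ei: (pos_of i) => [|x]; case Ej: (pos_of j) => [|y] /=.
- have [-> ->] := pos_nu0 Ei; have [-> ->] := pos_nu0 Ej.
  rewrite wform_last ?pred_lt // prednK // cdiff_p mul0r.
  by rewrite Bmx_zeros ?mem_zeros ?Ei ?Ej // oppr0 mul0r.
- have [-> ->] := pos_nu0 Ei; have [-> ->] := pos_nuS Ej.
  rewrite wform_last; last by rewrite Ej in pj; apply: ltnW.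
  rewrite permK mulNr BmxE wform_anti Ei Ej wform0r opprK //.
- have [-> ->] := pos_nuS Ei; have [-> ->] := pos_nu0 Ej.
  rewrite wform_anti wform_last; last by rewrite Ei in pi; apply: ltnW.
  by rewrite permK dsigma mulNr BmxE Ei Ej wform0r.
have [-> ->] := pos_nuS Ei; have [-> ->] := pos_nuS Ej.
rewrite mulrDl BmxE Ei Ej wformS -addrA -[LHS]addr0; congr (_ + _).
rewrite mulr_suml big_map big_enum -big_split big1 //= => c _.
rewrite Bmx_col Ei pos_cdiff neg_cdiff mulrBl -!mulrA.
have E : Bmx (mkI c 0, j) * d (tag j) = - (cdiff (tag j) c y.+1 * d c).
  by rewrite BmxE pos_mkI // wform_anti wform0r Ej.
rewrite -!pos_partMl ?ltW // mulNr E opprK -[- (cdiff (tag j) c y.+1 * d c)]mulNr !pos_partMl ?ltW //.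
by rewrite pos_cdiff neg_cdiff; ring.
Qed.

End TExchangeMatrix.

(** * The symplectic relation in coefficients *)

Section ReversedPolynomials.

Definition rev_poly (N : nat) (g : {poly int}) : {poly int} := \poly_(k < N.+1) g`_(N - k).

Lemma horner_inv_X (g : {poly int}) N : (size g <= N.+1)%N ->
  (map_poly (fun c : int => c%:~R) g).[(tofrac 'X)^-1] =
  tofrac (rev_poly N g) / tofrac 'X^N :> {fraction {poly int}}.
Proof.
move=> gN; have X0 : tofrac ('X : {poly int}) != 0 by rewrite tofrac_eq0 polyX_eq0.
rewrite (horner_coef_wide _ (n := N.+1)); last first.
  by apply: leq_trans gN; apply: size_poly.
apply: (canRL (mulfK _)); first by rewrite tofrac_eq0 -size_poly_eq0 size_polyXn.
rewrite mulr_suml /rev_poly poly_def rmorph_sum /=.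
rewrite [RHS](reindex_inj rev_ord_inj) /=; apply: eq_bigr => j _.
have jN : (j <= N)%N by rewrite -ltnS.
rewrite coef_map_id0 ?mulr0z // !subSS subKn //.
have cE (c : int) : c%:~R = tofrac c%:P :> {fraction {poly int}}.
  by rewrite -[in RHS](intz c) !rmorph_int.
rewrite -mul_polyC rmorphM /= cE -mulrA; congr (_ * _).
rewrite !tofracXn exprVn.
have -> : tofrac 'X ^+ N = tofrac 'X ^+ j * tofrac 'X ^+ (N - j) :> {fraction {poly int}}.
  by rewrite -exprD subnKC.
by rewrite mulKf ?expf_neq0.
Qed.

(** The coefficient of [z^(x - y)] in [f(z) g(1/z)], provided that [f] vanishes beyond [x]. *)
Definition shifted_conv (x y : nat) (f g : nat -> int) : int :=
  \sum_(v < x.+1) if (v <= y)%N then f (x - v)%N * g (y - v)%N else 0.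

Lemma coef_rev_mul (f g : {poly int}) N x y : (y <= N)%N ->
  (forall j, (x < j)%N -> f`_j = 0) ->
  (f * rev_poly N g)`_(N + x - y) = shifted_conv x y (nth 0 f) (nth 0 g).
Proof.
move=> yN fx; rewrite coefM.
transitivity (\sum_(j < x.+1) f`_j * (rev_poly N g)`_(N + x - y - j)).
  rewrite [RHS](big_ord_widen_cond (N + x - y).+1 xpredT (fun j => f`_j * (rev_poly N g)`_(N + x - y - j))); last by lia.
  rewrite [RHS]big_mkcond /=; apply: eq_bigr => j _; case: ltnP => // xj.
  by rewrite fx ?mul0r.
rewrite (reindex_inj rev_ord_inj) /=; apply: eq_bigr => v _.
have vx := ltn_ord v; rewrite subSS coef_poly; case: leqP => vy.
  by rewrite ifF ?mulr0 //; apply/negbTE; lia.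
rewrite ifT; last by lia.
by rewrite (_ : (N - (N + x - y - (x - v)))%N = (y - v)%N) //; lia.
Qed.

End ReversedPolynomials.

Section ShiftedConv.
Variables x y : nat.

Lemma shifted_convBl f1 f2 g : shifted_conv x y (fun k => f1 k - f2 k) g =
  shifted_conv x y f1 g - shifted_conv x y f2 g.
Proof.
rewrite -sumrB; apply: eq_bigr => v _; case: ifP => _; rewrite ?subr0 //.
by rewrite mulrBl.
Qed.

Lemma shifted_convBr f g1 g2 : shifted_conv x y f (fun k => g1 k - g2 k) =
  shifted_conv x y f g1 - shifted_conv x y f g2.
Proof.
rewrite -sumrB; apply: eq_bigr => v _; case: ifP => _; rewrite ?subr0 //.
by rewrite mulrBr.
Qed.

Lemma shifted_conv_shift f g : f 0%N = 0 -> g 0%N = 0 ->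
  shifted_conv x y f g = \sum_(v < (x + y).+1) f (x - v)%N * g (y - v)%N.
Proof.
move=> f0 g0; rewrite /shifted_conv (big_ord_widen_cond (x + y).+1 xpredT
  (fun v => if (v <= y)%N then f (x - v)%N * g (y - v)%N else 0)); last by lia.
rewrite big_mkcond /=; apply: eq_bigr => v _; case: ltnP => vx.
  by case: leqP => // /ltnW; rewrite -subn_eq0 => /eqP ->; rewrite g0 mulr0.
by have /ltnW := vx; rewrite -subn_eq0 => /eqP ->; rewrite f0 mul0r.
Qed.

Lemma shifted_conv_leadingl (e1 e2 : bool) g : (0 < x)%N -> g 0%N = 0 ->
  shifted_conv x y (fun k => (e1 && (k == 0%N))%:R + (e2 && (k == x))%:R) g =
  e1%:R * g (y - x)%N + e2%:R * g y.
Proof.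
move=> x0 g0; rewrite /shifted_conv.
transitivity (\sum_(v < x.+1) ((if v == ord_max then e1%:R * g (y - x)%N else 0) +
   (if v == ord0 then e2%:R * g y else 0))); last first.
  by rewrite big_split /= -!big_mkcond !big_pred1_eq.
apply: eq_bigr => v _; have vx := ltn_ord v; rewrite -!val_eqE /=.
have [v_x|v_x] := eqVneq (v : nat) x.
  rewrite v_x subnn eqxx andbT (eq_sym 0%N) (gtn_eqF x0) andbF !addr0.
  by case: leqP => // /ltnW; rewrite -subn_eq0 => /eqP ->; rewrite g0 mulr0.
have -> : (x - v == 0)%N = false by apply/negbTE; lia.
have -> : (x - v == x)%N = (v == 0%N :> nat) by apply/eqP/eqP; lia.
rewrite andbF !add0r; have [->|v_0] := eqVneq (v : nat) 0%N.
  by rewrite leq0n andbT subn0.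
by rewrite andbF mul0r if_same.
Qed.

(** The coefficient at [q] is reached only for [y = q] and [v = 0], where it meets [f x = 0]. *)
Lemma shifted_conv_leadingr (e1 e2 : bool) q f : (y <= q)%N -> (0 < q)%N ->
  f 0%N = 0 -> f x = 0 ->
  shifted_conv x y f (fun k => (e1 && (k == 0%N))%:R + (e2 && (k == q))%:R) =
  e1%:R * f (x - y)%N.
Proof.
move=> yq q0 f0 fx; rewrite /shifted_conv.
have [yx|xy] := leqP y x.
  have yx1 : (y < x.+1)%N by [].
  rewrite (bigD1 (Ordinal yx1)) //= leqnn subnn eqxx andbT (eq_sym 0%N) (gtn_eqF q0) andbF addr0.
  rewrite mulrC big1 ?addr0 // => v; rewrite -val_eqE /= => vy; case: leqP => // vy'.
  have -> : (y - v == 0)%N = false by apply/negbTE; lia.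
  rewrite andbF add0r; have [yvq|yvq] := eqVneq (y - v)%N q; last by rewrite andbF mulr0.
  by rewrite (_ : nat_of_ord v = 0%N) ?subn0 ?fx ?mul0r //; lia.
rewrite (_ : (x - y)%N = 0%N) ?f0 ?mulr0; last by lia.
apply: big1 => v _; have vx := ltn_ord v; case: ifP => // vy.
have -> : (y - v == 0)%N = false by apply/negbTE; lia.
rewrite andbF add0r; have [yvq|yvq] := eqVneq (y - v)%N q; last by rewrite andbF mulr0.
by rewrite (_ : nat_of_ord v = 0%N) ?subn0 ?fx ?mul0r //; lia.
Qed.

End ShiftedConv.

Section DatumCoefficients.
Variables (r : nat) (Ap Am : 'M[{poly int}]_r) (Dm : 'M[int]_r)
  (N0 Np Nm : 'M[{poly int}]_r) (sigma : 'S_r) (p : 'I_r -> nat).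
Hypothesis alphaP : T_datum Ap Am Dm N0 Np Nm sigma p.
Let tri := T_datum_triple alphaP.

Definition dcoef a := Dm a a.
Definition ncoef (N : 'M[{poly int}]_r) b a k := (N b a)`_k.

Lemma diag_entry a b : Dm a b = if a == b then dcoef a else 0.
Proof.
case: eqP => [-> //|/eqP ab].
by have /is_diag_mxP /(_ a b ab) := T_datum_diag alphaP.
Qed.

Lemma mulmx_const_diag (A : 'M[{poly int}]_r) a b :
  (A *m const_poly_mx Dm) a b = A a b * (dcoef b)%:P.
Proof.
rewrite mxE (bigD1 b) //= !mxE diag_entry eqxx big1 ?addr0 // => c cb.
by rewrite mxE diag_entry (negPf cb) mulr0.
Qed.

Lemma mulmx_diag_const (A : 'M[{poly int}]_r) a b :
  (const_poly_mx Dm *m A) a b = (dcoef a)%:P * A a b.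
Proof.
rewrite mxE (bigD1 a) //= !mxE diag_entry eqxx big1 ?addr0 // => c ca.
by rewrite mxE diag_entry eq_sym (negPf ca) mul0r.
Qed.

Lemma dcoef_sigma a : dcoef (sigma a) = dcoef a.
Proof.
have /matrixP /(_ (sigma a) a) := T_datum_comm alphaP.
rewrite mulmx_const_diag mulmx_diag_const mulrC => /(congr1 (fun f : {poly int} => f`_(p (sigma a)))).
rewrite !coefCM (T_N1 tri) !eqxx /= andbC (gtn_eqF (T_period_gt0 tri _)) /= add0r !mulr1.
by move=> ->.
Qed.

(** [invmx] returns a singular matrix unchanged, so invertibility must be known before
    [conj_integral] can be read as a conjugation. *)
Lemma laurent_const_unit : laurent_mx (const_poly_mx Dm) \in unitmx.
Proof.
pose F := {fraction {poly int}}.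
pose E : 'M[F]_r := \matrix_(a, b) (if a == b then (tofrac (dcoef a)%:P)^-1 else 0).
apply: (proj1 (mulmx1_unit (_ : laurent_mx (const_poly_mx Dm) *m E = 1%:M))).
apply/matrixP => a b; rewrite !mxE (bigD1 a) //= !mxE diag_entry eqxx big1 => [|c ca]; last first.
  by rewrite !mxE diag_entry eq_sym (negPf ca) tofrac0 mul0r.
rewrite addr0; case: eqP => [_|_]; rewrite ?mulr0 // mulfV //.
by rewrite tofrac_eq0 polyC_eq0 gt_eqF // (T_datum_pos alphaP).
Qed.

Lemma conj_integral_dvd N : conj_integral Dm N ->
  forall b c k, (dcoef b %| ncoef N b c k * dcoef c)%Z.
Proof.
move=> [M0 E] b c k.
have {}E : N *m const_poly_mx Dm = const_poly_mx Dm *m M0.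
  have : laurent_mx (N *m const_poly_mx Dm) = laurent_mx (const_poly_mx Dm *m M0).
    rewrite /laurent_mx !map_mxM -/(laurent_mx M0) -E !mulmxA mulmxV ?mul1mx //.
    exact: laurent_const_unit.
  move=> /matrixP H; apply/matrixP => i j; have := H i j; rewrite [LHS]mxE [RHS]mxE.
  by move/eqP; rewrite tofrac_eq => /eqP.
have /matrixP /(_ b c) := E; rewrite mulmx_const_diag mulmx_diag_const mulrC.
move=> /(congr1 (fun f : {poly int} => f`_k)); rewrite !coefCM mulrC /ncoef => ->.
exact: dvdz_mulr.
Qed.

Lemma dagger_entry (A B : 'M[{poly int}]_r) N a b : (forall c, size (B b c) <= N.+1)%N ->
  (laurent_mx A *m laurent_mx (const_poly_mx Dm) *m dagger B) a b =
  tofrac (\sum_c (dcoef c)%:P * (A a c * rev_poly N (B b c))) / tofrac 'X^N.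
Proof.
move=> BN; rewrite mxE rmorph_sum mulr_suml; apply: eq_bigr => c _.
have -> : (laurent_mx A *m laurent_mx (const_poly_mx Dm)) a c = tofrac (A a c * (dcoef c)%:P).
  by rewrite /laurent_mx -map_mxM [LHS]mxE mulmx_const_diag.
rewrite [dagger _ _ _]mxE (horner_inv_X (BN c)) mulrA -tofracM; congr (tofrac _ / _).
ring.
Qed.

Lemma sympl_conv x y a b : (forall c j, (x < j)%N -> (Ap a c)`_j = 0 /\ (Am a c)`_j = 0) ->
  \sum_c dcoef c * shifted_conv x y (ncoef Ap a c) (ncoef Am b c) =
  \sum_c dcoef c * shifted_conv x y (ncoef Am a c) (ncoef Ap b c).
Proof.
(* [N] bounds the degrees in row [b], so [z^N] clears the negative powers; it is at least [y], so
   [N + x - y] is not truncated. *)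
move=> hx; pose N := (y + \sum_c (size (Ap b c) + size (Am b c)))%N.
have sN c : (size (Ap b c) <= N.+1)%N /\ (size (Am b c) <= N.+1)%N.
  by rewrite /N (bigD1 c) //=; split; lia.
have /matrixP /(_ a b) := T_datum_sympl alphaP.
rewrite (dagger_entry _ (N := N)) => [|c]; last exact: (sN c).2.
rewrite (dagger_entry _ (N := N)) => [|c]; last exact: (sN c).1.
have XN : tofrac ('X^N : {poly int}) != 0 by rewrite tofrac_eq0 -size_poly_eq0 size_polyXn.
move=> /(mulIf (invr_neq0 XN)) /eqP; rewrite tofrac_eq => /eqP.
move=> /(congr1 (fun f : {poly int} => f`_(N + x - y))); rewrite !coef_sum => E.
have yN : (y <= N)%N by rewrite leq_addr.
transitivity (\sum_c ((dcoef c)%:P * (Ap a c * rev_poly N (Am b c)))`_(N + x - y)).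
  apply: eq_bigr => c _; rewrite coefCM coef_rev_mul // => j /(hx c) [] //.
rewrite E; apply: eq_bigr => c _; rewrite coefCM coef_rev_mul // => j /(hx c) [] //.
Qed.

Lemma ncoef0 b a k : ncoef N0 b a k =
  ((b == a) && (k == 0%N))%:R + ((b == sigma a) && (k == p b))%:R.
Proof. by rewrite /ncoef (T_N1 tri). Qed.

(** In the expansion of [A = N_0 - N], the terms quadratic in [N_0] agree on both sides, those
    linear in [N_0] collapse to single coefficients, and the rest is [conv]. *)
Lemma sympl_coef a b q : (q <= p b)%N ->
  cdiff (ncoef Np) (ncoef Nm) b (sigma^-1%g a) q * dcoef (sigma^-1%g a) =
  cdiff (ncoef Np) (ncoef Nm) a b (p a - q)%N * dcoef b -
  cdiff (ncoef Np) (ncoef Nm) b a (q - p a)%N * dcoef a +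
  conv (ncoef Np) (ncoef Nm) dcoef a (p a) b q.
Proof.
move=> qp; have p0 := T_period_gt0 tri.
have PM0 c e k : ~~ (0 < k < p c)%N -> ncoef Np c e k = 0 /\ ncoef Nm c e k = 0.
  exact: (T_N3 tri).
have z0 c e : ncoef Np c e 0%N = 0 /\ ncoef Nm c e 0%N = 0 by apply: PM0.
have zp c e : ncoef Np c e (p c) = 0 /\ ncoef Nm c e (p c) = 0.
  by apply: PM0; rewrite ltnn andbF.
have apE c e k : ncoef Ap c e k = ncoef N0 c e k - ncoef Np c e k.
  by rewrite /ncoef (T_datum_Ap alphaP) !mxE coefB.
have amE c e k : ncoef Am c e k = ncoef N0 c e k - ncoef Nm c e k.
  by rewrite /ncoef (T_datum_Am alphaP) !mxE coefB.
have big c j : (p a < j)%N -> (Ap a c)`_j = 0 /\ (Am a c)`_j = 0.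
  move=> pj; rewrite -/(ncoef Ap a c j) -/(ncoef Am a c j) apE amE ncoef0.
  have [|-> ->] := PM0 a c j; first by apply/negP => /andP[_]; rewrite ltnNge (ltnW pj).
  by rewrite (gtn_eqF pj) (gtn_eqF (leq_ltn_trans (leq0n _) pj)) !andbF addr0 subr0.
have := sympl_conv q b big; set x := p a.
have ext f f' g g' : f =1 f' -> g =1 g' -> shifted_conv x q f g = shifted_conv x q f' g'.
  by move=> ff gg; apply: eq_bigr => v _; rewrite ff gg.
pose n0 c := ncoef N0 a c; pose m0 c := ncoef N0 b c.
have LE c : shifted_conv x q (ncoef Ap a c) (ncoef Am b c) =
    shifted_conv x q (n0 c) (m0 c) - shifted_conv x q (n0 c) (ncoef Nm b c)
    - shifted_conv x q (ncoef Np a c) (m0 c) + shifted_conv x q (ncoef Np a c) (ncoef Nm b c).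
  rewrite (ext _ _ _ _ (apE a c) (amE b c)) shifted_convBl !shifted_convBr; ring.
have RE c : shifted_conv x q (ncoef Am a c) (ncoef Ap b c) =
    shifted_conv x q (n0 c) (m0 c) - shifted_conv x q (n0 c) (ncoef Np b c)
    - shifted_conv x q (ncoef Nm a c) (m0 c) + shifted_conv x q (ncoef Nm a c) (ncoef Np b c).
  rewrite (ext _ _ _ _ (amE a c) (apE b c)) shifted_convBl !shifted_convBr; ring.
have n0E c g : g 0%N = 0 -> shifted_conv x q (n0 c) g =
    (a == c)%:R * g (q - x)%N + (a == sigma c)%:R * g q.
  by move=> g0; rewrite (ext _ _ _ _ (ncoef0 a c) (frefl g)) shifted_conv_leadingl ?p0.
have m0E c f : f 0%N = 0 -> f x = 0 -> shifted_conv x q f (m0 c) = (b == c)%:R * f (x - q)%N.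
  by move=> f0 fx; rewrite (ext _ _ _ _ (frefl f) (ncoef0 b c)) shifted_conv_leadingr ?p0.
have pick (e : 'I_r) (f : 'I_r -> int) : \sum_c (e == c)%:R * f c = f e.
  rewrite (bigD1 e) //= eqxx mul1r big1 ?addr0 // => c; rewrite eq_sym => /negPf ->.
  by rewrite mul0r.
have pick' (f : 'I_r -> int) : \sum_c (a == sigma c)%:R * f c = f (sigma^-1%g a).
  by rewrite -(pick _ f); apply: eq_bigr => c _; rewrite (can2_eq (permKV sigma) (permK sigma)).
move=> E.
have {}E : \sum_c (a == sigma c)%:R * (dcoef c * cdiff (ncoef Np) (ncoef Nm) b c q)
   + \sum_c (a == c)%:R * (dcoef c * cdiff (ncoef Np) (ncoef Nm) b c (q - x)%N)
   - \sum_c (b == c)%:R * (dcoef c * cdiff (ncoef Np) (ncoef Nm) a c (x - q)%N)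
   = \sum_c dcoef c * (shifted_conv x q (ncoef Nm a c) (ncoef Np b c)
                     - shifted_conv x q (ncoef Np a c) (ncoef Nm b c)).
  apply/eqP; rewrite -subr_eq0; apply/eqP.
  transitivity (\sum_c dcoef c * shifted_conv x q (ncoef Ap a c) (ncoef Am b c) -
     \sum_c dcoef c * shifted_conv x q (ncoef Am a c) (ncoef Ap b c)); last by rewrite E subrr.
  rewrite -big_split -!sumrB /=; apply: eq_bigr => c _; rewrite LE RE.
  have [? ?] := z0 a c; have [? ?] := z0 b c; have [? ?] := zp a c.
  set common := shifted_conv x q (n0 c) (m0 c).
  rewrite !n0E // !m0E // /cdiff; ring.
move: E; rewrite pick' !pick => E.
have -> : conv (ncoef Np) (ncoef Nm) dcoef a x b q =
    \sum_c dcoef c * (shifted_conv x q (ncoef Nm a c) (ncoef Np b c)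
                     - shifted_conv x q (ncoef Np a c) (ncoef Nm b c)).
  apply: eq_bigr => c _; have [? ?] := z0 a c; have [? ?] := z0 b c.
  by rewrite !shifted_conv_shift // -sumrB.
by rewrite -E; ring.
Qed.

End DatumCoefficients.

(** * Mutation loops *)

Section MutationLoop.
Variables (I : finType) (F : fieldType).
Hypothesis c0 : char0 F.
Variables (B : {ffun I * I -> int}) (d : I -> int) (Z : seq I) (nu : {perm I}).
Hypotheses (sk : skew_by d B) (uZ : uniq Z) (Z0 : {in Z &, forall k l, B (k, l) = 0}).
Hypothesis loop : forall i j, B (nu i, nu j) = multi_mut Z B i j.
Implicit Types (X : {ffun I -> F}).

Definition forward X := rel_tuple nu^-1 (mutations (B, X) Z).2.
(** Undoing a turn relabels before mutating; moving the relabelling to the end replaces [Z] by its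
    image under [nu]. *)
Definition backward X := rel_tuple nu (mutations (B, X) [seq nu k | k <- rev Z]).2.

Lemma loop_matrix X : (mutations (B, X) Z).1 = rel_mx nu B.
Proof.
apply/ffunP => -[i j]; have [-> _] := mutations_commuting X uZ Z0.
by rewrite ffunE loop.
Qed.

Lemma forward_step X : mutations (B, X) Z = relabel nu (B, forward X).
Proof.
rewrite [LHS]surjective_pairing loop_matrix; congr pair.
by apply/ffunP => i; rewrite !ffunE permK.
Qed.

Lemma mutations_fst (S S' : {ffun I * I -> int} * {ffun I -> F}) ks :
  S.1 = S'.1 -> (mutations S ks).1 = (mutations S' ks).1.
Proof. by elim: ks S S' => //= k ks IH S S' E; apply: IH; rewrite /= E. Qed.

Lemma good_loop X : free_tuple X -> good d (B, X).
Proof. by []. Qed.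

Lemma good_relabel (s : {perm I}) (S : {ffun I * I -> int} * {ffun I -> F}) (e : I -> int) :
  good e S -> good (fun i => e (s i)) (relabel s S).
Proof.
move=> [[e0 skS] fS]; split; last exact: free_rel.
by split=> // i j; rewrite !ffunE /= skS.
Qed.

Lemma backward_step X : free_tuple X ->
  mutations (B, backward X) Z = relabel nu (B, X).
Proof.
move=> fX; have gX : good (fun i => d (nu i)) (relabel nu (B, X)).
  by apply: good_relabel; apply: good_loop.
have E : mutations (relabel nu (B, X)) (rev Z) = (B, backward X).
  rewrite [LHS]surjective_pairing; congr pair; last by rewrite mutations_relabel.
  rewrite (mutations_fst (S' := mutations (B, X) Z)); last by rewrite loop_matrix.
  by rewrite (mutations_rev c0 Z (good_loop fX)).
by rewrite -E -{2}[Z]revK (mutations_rev c0 (rev Z) gX).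
Qed.

Lemma free_forward X : free_tuple X -> free_tuple (forward X).
Proof.
move=> fX; apply: free_rel.
exact: (good_mutations c0 Z (good_loop fX)).2.
Qed.

Lemma free_backward X : free_tuple X -> free_tuple (backward X).
Proof.
move=> fX; apply: free_rel.
exact: (good_mutations c0 _ (good_loop fX)).2.
Qed.

Variable X0 : {ffun I -> F}.
Hypothesis fX0 : free_tuple X0.

(** [Negz n] is [-(n + 1)], hence the additional backward step. *)
Definition cluster_at (u : int) : {ffun I -> F} :=
  match u with Posz n => iter n forward X0 | Negz n => iter n.+1 backward X0 end.

Lemma free_cluster_at u : free_tuple (cluster_at u).
Proof.
case: u => n /=; first by elim: n => //= n IH; apply: free_forward.
by apply: free_backward; elim: n => //= n IH; apply: free_backward.
Qed.

Lemma cluster_at_step u : mutations (B, cluster_at u) Z = relabel nu (B, cluster_at (u + 1)).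
Proof.
case: u => n; first by rewrite forward_step -PoszD addn1.
have -> : cluster_at (Negz n + 1) = iter n backward X0.
  by case: n => [|n] //; rewrite (_ : Negz n.+1 + 1 = Negz n) // !NegzE; lia.
rewrite [cluster_at (Negz n)]iterS backward_step //.
by elim: n => //= n IH; apply: free_backward.
Qed.

Lemma cluster_at_succ u i : cluster_at (u + 1) (nu i) =
  if i \in Z then exch B (cluster_at u) i / cluster_at u i else cluster_at u i.
Proof.
have [_ <-] := mutations_commuting (cluster_at u) uZ Z0.
by rewrite cluster_at_step ffunE.
Qed.

Lemma mutations_relabelV (s : {perm I}) (S : {ffun I * I -> int} * {ffun I -> F}) ks :
  mutations (relabel s S) [seq s^-1%g k | k <- ks] = relabel s (mutations S ks).
Proof. by rewrite mutations_relabel -map_comp (eq_map (permKV s)) map_id. Qed.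

(** A path of seeds consists of mutations alone, so the relabellings accumulate in a permutation. *)
Lemma seed_at u : exists s, seed_rel (B, X0) (relabel s (B, cluster_at u)).
Proof.
have fwd v (s : {perm I}) : seed_rel (B, X0) (relabel s (B, cluster_at v)) ->
    seed_rel (B, X0) (relabel (s * nu)%g (B, cluster_at (v + 1))).
  move=> H; apply: (seed_rel_trans H); exists [seq s^-1%g k | k <- Z].
  by rewrite mutations_relabelV cluster_at_step relabelM.
have bwd v (s : {perm I}) : seed_rel (B, X0) (relabel s (B, cluster_at (v + 1))) ->
    seed_rel (B, X0) (relabel (s * nu^-1)%g (B, cluster_at v)).
  move=> H; apply: (seed_rel_trans H).
  have gv := good_loop (free_cluster_at v).
  apply: (seed_rel_sym c0 (good_relabel (s * nu^-1)%g gv)).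
  exists [seq (s * nu^-1)^-1%g k | k <- Z].
  by rewrite mutations_relabelV cluster_at_step relabelM -mulgA mulVg mulg1.
case: u => n; elim: n => [|n [s IH]].
- by exists 1%g; rewrite relabel1; exists [::].
- by exists (s * nu)%g; rewrite -addn1 PoszD; apply: fwd.
- by exists (1 * nu^-1)%g; apply: bwd; rewrite relabel1; exists [::].
- by exists (s * nu^-1)%g; apply: bwd; rewrite (_ : Negz n.+1 + 1 = Negz n) // !NegzE; lia.
Qed.

(* One turn of the loop moves the column of the matrix at height y to height y - 1,
   so the columns at Z, known at all times, determine the matrix. *)
Lemma loop_unique (y : I -> nat) (B' : {ffun I * I -> int}) d' :
  (forall i, (i \in Z) = (y i == 0%N)) -> (forall i, y i != 0%N -> y (nu i) = (y i).-1) ->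
  skew_by d' B' ->
  (forall B1 d1 u s, skew_by d1 B1 -> seed_rel (B', X0) (relabel s (B1, cluster_at u)) ->
     forall k j, k \in Z -> B1 (j, k) = B (j, k)) ->
  B' = B.
Proof.
move=> yZ ynu sk' Hcol.
(* The matrix and the time are generalised because a turn of the loop replaces both. *)
suff H n : forall B1 d1 u s, skew_by d1 B1 ->
    seed_rel (B', X0) (relabel s (B1, cluster_at u)) ->
    forall i j, (y j <= n)%N -> B1 (i, j) = B (i, j).
  apply/ffunP => -[i j]; apply: (H (y j) B' d' 0 1%g) => //.
  by rewrite relabel1; exists [::].
elim: n => [|n IH] B1 d1 u s sk1 H1 i j yj.
  by apply: (Hcol B1 d1 u s) => //; rewrite yZ -leqn0.
have [j0|j0] := eqVneq (y j) 0%N; first by apply: (IH B1 d1 u s); rewrite ?j0.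
have col1 k l : k \in Z -> B1 (l, k) = B (l, k) by apply: (Hcol B1 d1 u s).
have Z1 : {in Z &, forall k l, B1 (k, l) = 0} by move=> k l kZ lZ; rewrite col1 ?Z0.
have [E1 E2] := mutations_commuting (cluster_at u) uZ Z1.
pose S1 := mutations (B1, cluster_at u) Z.
have g1 : good d1 (B1, cluster_at u) by split=> //; apply: free_cluster_at.
have gS : good d1 S1 by apply: good_mutations.
have S1X : S1.2 = rel_tuple nu (cluster_at (u + 1)).
  apply/ffunP => k; rewrite E2 ffunE cluster_at_succ; case: ifP => // kZ.
  congr (_ / _); rewrite /exch; congr (_ + _); congr mono; apply/ffunP => l.
    by rewrite !pcolE col1.
  by rewrite !ncolE col1.
have S1E : S1 = relabel nu (rel_mx nu^-1%g S1.1, cluster_at (u + 1)).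
  rewrite [LHS]surjective_pairing S1X; congr pair.
  by apply/ffunP => -[a b]; rewrite !ffunE /= !permK.
have next a b : (y b <= n)%N -> rel_mx nu^-1%g S1.1 (a, b) = B (a, b).
  apply: (IH _ (fun i => d1 (nu^-1%g i)) (u + 1) (s * nu)%g).
    exact: (good_relabel nu^-1%g gS).1.
  apply: (seed_rel_trans H1); exists [seq s^-1%g k | k <- Z].
  by rewrite mutations_relabelV -/S1 {2}S1E relabelM.
(* The column at [nu j] after the turn is known by induction, and it is the mutated column of [j].
   The mutation is then inverted, starting with the entries in the rows of [Z]. *)
have key a : multi_mut Z B1 a j = multi_mut Z B a j.
  rewrite -loop -E1 -next ?ynu //; first by rewrite ffunE /= !permK.
  by case: (y j) yj j0.
have jZ : j \in Z = false by rewrite yZ; apply/negbTE.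
have row k : k \in Z -> B1 (k, j) = B (k, j).
  by move=> kZ; have := key k; rewrite /multi_mut kZ /= => /oppr_inj.
have := key i; rewrite /multi_mut jZ orbF; case: ifP => [_ /oppr_inj //|_].
have -> : \sum_(k <- Z) (pos_part (B1 (i, k)) * pos_part (B1 (k, j)) -
      pos_part (- B1 (i, k)) * pos_part (- B1 (k, j))) =
   \sum_(k <- Z) (pos_part (B (i, k)) * pos_part (B (k, j)) -
      pos_part (- B (i, k)) * pos_part (- B (k, j))).
  by rewrite big_seq [RHS]big_seq; apply: eq_bigr => k kZ; rewrite col1 // row.
by move/addIr.
Qed.

End MutationLoop.

(** * The T-algebra *)

Section MonomialEvaluation.
Local Open Scope fset_scope.
Variables (I : choiceType) (S : comNzRingType) (v : I -> S).

Definition cm_eval (m : monalg.cmonom I) : S := \prod_(i <- finsupp m) v i ^+ m i.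

Lemma cm_evalEw (m : monalg.cmonom I) (d : {fset I}) : (finsupp m `<=` d)%fset ->
  cm_eval m = \prod_(i <- d) v i ^+ m i.
Proof.
move=> le; rewrite /cm_eval (big_fset_incl _ le) //.
by move=> i _; rewrite -monalg.cmE_neq0 negbK => /eqP ->.
Qed.

Lemma cm_eval_mmorphism : monalg.mmorphism cm_eval.
Proof.
split=> [m1 m2|]; last by rewrite /cm_eval monalg.mdom1 big_seq_fset0.
rewrite {1}/cm_eval monalg.mdomD (cm_evalEw (fsubsetUl _ (finsupp m2))).
rewrite (cm_evalEw (fsubsetUr (finsupp m1) _)) -big_split /=.
by apply: eq_bigr => i _; rewrite monalg.cmM exprD.
Qed.

HB.instance Definition _ := monalg.isMultiplicative.Build (monalg.cmonom I) S cm_eval cm_eval_mmorphism.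

Lemma cm_evalU i : cm_eval (monalg.ucm i) = v i.
Proof. by rewrite /cm_eval monalg.mdomU big_seq_fset1 monalg.cmUU. Qed.

Definition int_eval : {rmorphism monalg.malg (monalg.cmonom I) int -> S} :=
  monalg.mmap intr cm_eval.

Lemma int_evalU i : int_eval (monalg.mkmalgU (monalg.ucm i) 1) = v i.
Proof. by rewrite /int_eval /= monalg.mmapU /= mul1r cm_evalU. Qed.

End MonomialEvaluation.

Section QuotientMorphism.
Local Open Scope quotient_scope.
Variables (P S : comPzRingType) (E : P -> P -> Prop) (phi : {rmorphism P -> S}).
Hypothesis phiE : forall f g, E f g -> phi f = phi g.

Lemma in_ideal_kernel f : in_ideal E f -> phi f = 0.
Proof.
elim=> {f} [f g /phiE fg||f g _ f0 _ g0|h f _ f0]; first by rewrite rmorphB fg subrr.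
- exact: rmorph0.
- by rewrite rmorphD f0 g0 addr0.
- by rewrite rmorphM f0 mulr0.
Qed.

(** The compatibility proof is an argument so that the morphism structure can be attached to the
    resulting function. *)
Definition quot_lift of (forall f g, E f g -> phi f = phi g) :=
  fun q : ideal_quotient E => phi (repr q).
Local Notation lift := (quot_lift phiE).

Lemma quot_liftE f : lift (\pi_(ideal_quotient E) f) = phi f.
Proof. by apply/eqP; rewrite -subr_eq0 -rmorphB (in_ideal_kernel (quot_rep E f)). Qed.

Lemma quot_liftB : {morph lift : x y / x - y}.
Proof.
by move=> x y; rewrite -[x]reprK -[y]reprK !piE !quot_liftE rmorphB.
Qed.

Lemma quot_liftM : {morph lift : x y / x * y}.
Proof. by move=> x y; rewrite -[x]reprK -[y]reprK !piE !quot_liftE rmorphM. Qed.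

Lemma quot_lift1 : lift 1 = 1.
Proof. by rewrite -[1]/(quot_one E) !piE quot_liftE rmorph1. Qed.

HB.instance Definition _ := GRing.isZmodMorphism.Build (ideal_quotient E) S lift quot_liftB.
HB.instance Definition _ := GRing.isMonoidMorphism.Build (ideal_quotient E) S lift
  (quot_lift1, quot_liftM).

End QuotientMorphism.

Lemma rmorph_T_monomial r (R S : comPzRingType) (f : {rmorphism R -> S})
    (t : 'I_r -> int -> R) N a u :
  f (T_monomial t N a u) = T_monomial (fun b v => f (t b v)) N a u.
Proof.
rewrite rmorph_prod; apply: eq_bigr => b _; rewrite rmorph_prod.
by apply: eq_bigr => k _; rewrite rmorphXn.
Qed.

Section UniversalProperty.
Variables (r : nat) (N0 Np Nm : 'M[{poly int}]_r) (F : fieldType) (t : 'I_r -> int -> F).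
Hypothesis t0 : forall a u, t a u != 0.
Hypothesis tsys : forall a u,
  T_monomial t N0 a u = T_monomial t Np a u + T_monomial t Nm a u.

Definition T_poly_eval : {rmorphism T_poly r -> F} :=
  int_eval (fun g : T_gen r => match g with inl i => t i.1 i.2 | inr i => (t i.1 i.2)^-1 end).

Lemma T_poly_eval_relation f g : T_relation N0 Np Nm f g -> T_poly_eval f = T_poly_eval g.
Proof.
have E b v : T_poly_eval (T_pos b v) = t b v by exact: int_evalU.
have E' b v : T_poly_eval (T_neg b v) = (t b v)^-1 by exact: int_evalU.
have EM N a u : T_poly_eval (T_monomial (@T_pos r) N a u) = T_monomial t N a u.
  rewrite rmorph_T_monomial; apply: eq_bigr => b _; apply: eq_bigr => k _.
  by rewrite E.
case=> a u; first by rewrite rmorphD !EM tsys.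
apply: etrans (rmorphM T_poly_eval (T_pos a u) (T_neg a u)) _.
apply: etrans (congr2 *%R (E a u) (E' a u)) _.
by apply: etrans (mulfV (t0 a u)) (esym (rmorph1 T_poly_eval)).
Qed.

Definition T_eval : {rmorphism T_algebra N0 Np Nm -> F} :=
  quot_lift T_poly_eval_relation.

Lemma T_evalE a u : T_eval (T_elt N0 Np Nm a u) = t a u.
Proof. by rewrite [LHS]quot_liftE; apply: int_evalU. Qed.

End UniversalProperty.

Section QuotientProjection.
Local Open Scope quotient_scope.
Variables (P : comPzRingType) (E : P -> P -> Prop).

Definition quot_pi (f : P) : ideal_quotient E := \pi_(ideal_quotient E) f.

Lemma quot_piB : {morph quot_pi : x y / x - y}.
Proof. by move=> x y; rewrite /quot_pi !piE. Qed.

Lemma quot_piM : {morph quot_pi : x y / x * y}.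
Proof. by move=> x y; rewrite /quot_pi !piE. Qed.

Lemma quot_pi1 : quot_pi 1 = 1.
Proof. by rewrite -[RHS]/(quot_one E) /quot_pi !piE. Qed.

HB.instance Definition _ := GRing.isZmodMorphism.Build P (ideal_quotient E) quot_pi quot_piB.
HB.instance Definition _ := GRing.isMonoidMorphism.Build P (ideal_quotient E) quot_pi
  (quot_pi1, quot_piM).

Lemma quot_pi_eq f g : E f g -> quot_pi f = quot_pi g.
Proof. by move=> fg; apply/eqP/quot_modP; constructor. Qed.

End QuotientProjection.

Section TAlgebraRelations.
Variables (r : nat) (N0 Np Nm : 'M[{poly int}]_r).
Local Notation T := (T_elt N0 Np Nm).

Lemma T_monomial_elt N a u : quot_pi (T_relation N0 Np Nm) (T_monomial (@T_pos r) N a u) =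
  T_monomial T N a u.
Proof. exact: rmorph_T_monomial. Qed.

Lemma T_elt_system a u : T_monomial T N0 a u = T_monomial T Np a u + T_monomial T Nm a u.
Proof.
rewrite -!T_monomial_elt -[RHS]rmorphD.
by apply: quot_pi_eq; constructor.
Qed.

Definition invertible (R : comPzRingType) (x : R) := exists y, x * y = 1.

Lemma T_elt_invertible a u : invertible (T a u).
Proof.
exists (quot_pi _ (T_neg a u)).
apply: etrans (esym (rmorphM (quot_pi _) (T_pos a u) (T_neg a u))) _.
apply: etrans _ (rmorph1 (quot_pi _)).
by apply: quot_pi_eq; constructor.
Qed.

Lemma T_circ_val_monomial N a u :
  subring_val (T_monomial (T_circ_elt N0 Np Nm) N a u) = T_monomial T N a u.
Proof.
pose f : {rmorphism T_circ N0 Np Nm -> T_algebra N0 Np Nm} := val.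
exact: (rmorph_T_monomial f).
Qed.

Lemma T_circ_system a u : T_monomial (T_circ_elt N0 Np Nm) N0 a u =
  T_monomial (T_circ_elt N0 Np Nm) Np a u + T_monomial (T_circ_elt N0 Np Nm) Nm a u.
Proof.
apply: val_inj; rewrite rmorphD /= !T_circ_val_monomial.
exact: T_elt_system.
Qed.

End TAlgebraRelations.

Section Windows.
Variables (r : nat) (N0 Np Nm : 'M[{poly int}]_r) (sigma : 'S_r) (p : 'I_r -> nat).
Hypothesis tri : T_triple N0 Np Nm sigma p.

Lemma T_monomialE (R : comPzRingType) (t : 'I_r -> int -> R) (N : 'M[{poly int}]_r) a u :
  (forall b k, ~~ (0 < k < p b)%N -> (N b a)`_k = 0) ->
  T_monomial t N a u =
  \prod_(b < r) \prod_(k < p b | (0 < k)%N) t b (u + k%:Z) ^+ absz (N b a)`_k.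
Proof.
move=> Nz; apply: eq_bigr => b _; set M := maxn (size (N b a)) (p b).
have -> : \prod_(k < size (N b a)) t b (u + k%:Z) ^+ absz (N b a)`_k =
    \prod_(k < M) t b (u + k%:Z) ^+ absz (N b a)`_k.
  rewrite (big_ord_widen_cond M xpredT
    (fun k => t b (u + k%:Z) ^+ absz (N b a)`_k)) ?leq_maxl //.
  by rewrite big_mkcond /=; apply: eq_bigr => k _; case: ltnP => // /(nth_default 0) ->.
rewrite (big_ord_widen_cond M (fun k => 0 < k)%N
    (fun k => t b (u + k%:Z) ^+ absz (N b a)`_k)) ?leq_maxr //.
rewrite [RHS]big_mkcond /=; apply: eq_bigr => k _.
by case: ifP => // /negbT /Nz ->.
Qed.

Lemma Np_window a b k : ~~ (0 < k < p b)%N -> (Np b a)`_k = 0.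
Proof. by move=> /(T_N3 tri) => /(_ a)[]. Qed.

Lemma Nm_window a b k : ~~ (0 < k < p b)%N -> (Nm b a)`_k = 0.
Proof. by move=> /(T_N3 tri) => /(_ a)[]. Qed.

(** Two-sided induction on the start [u] of the windows: each move by one step in either direction
    adds one new element per index. *)
Lemma window_ind (Pr : 'I_r -> int -> Prop) :
  (forall a k, (k < p a)%N -> Pr a k%:Z) ->
  (forall a u, (forall b k, (k < p b)%N -> Pr b (u + k%:Z)) ->
     Pr (sigma a) (u + (p (sigma a))%:Z)) ->
  (forall a u, (forall b k, (0 < k <= p b)%N -> Pr b (u + k%:Z)) -> Pr a u) ->
  forall a u, Pr a u.
Proof.
move=> init fwd bwd; have p0 := T_period_gt0 tri.
suff win u : forall b k, (k < p b)%N -> Pr b (u + k%:Z).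
  by move=> a u; have := win u a 0%N (p0 a); rewrite addr0.
have up v : (forall b k, (k < p b)%N -> Pr b (v + k%:Z)) ->
    forall b k, (k < p b)%N -> Pr b (v + 1 + k%:Z).
  move=> H b k kb; rewrite -addrA -PoszD add1n.
  move: kb; rewrite leq_eqVlt => /orP[/eqP ->|]; last exact: H.
  by rewrite -(permKV sigma b); apply: fwd.
have down v : (forall b k, (k < p b)%N -> Pr b (v + 1 + k%:Z)) ->
    forall b k, (k < p b)%N -> Pr b (v + k%:Z).
  move=> H b [|k] kb; last by have := H b k (ltnW kb); rewrite -addrA -PoszD add1n.
  rewrite addr0; apply: bwd => c [|k] // /andP[_ kc].
  by have := H c k kc; rewrite -addrA -PoszD add1n.
case: u => n; elim: n => [|n IH].
- by move=> b k kb; rewrite add0r; apply: init.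
- by rewrite -addn1 PoszD; apply: up.
- by apply: down => b k kb; rewrite (_ : Negz 0 + 1 = 0) // add0r; apply: init.
- by apply: down; rewrite (_ : Negz n.+1 + 1 = Negz n) // !NegzE; lia.
Qed.

Lemma eq_T_monomial (R : comPzRingType) (g h : 'I_r -> int -> R) (N : 'M[{poly int}]_r) a u :
  (forall b k, ~~ (0 < k < p b)%N -> (N b a)`_k = 0) ->
  (forall b k, (0 < k < p b)%N -> g b (u + k%:Z) = h b (u + k%:Z)) ->
  T_monomial g N a u = T_monomial h N a u.
Proof.
move=> Nz gh; rewrite !T_monomialE //; apply: eq_bigr => b _; apply: eq_bigr => k k0.
by rewrite gh // k0 ltn_ord.
Qed.

(** The right-hand side of a relation lies strictly inside the window, so the relation determines
    either factor of its left-hand side from the other. *)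
Lemma T_system_unique (F : fieldType) (g h : 'I_r -> int -> F) :
  (forall a u, g a u != 0) ->
  (forall a u, T_monomial g N0 a u = T_monomial g Np a u + T_monomial g Nm a u) ->
  (forall a u, T_monomial h N0 a u = T_monomial h Np a u + T_monomial h Nm a u) ->
  (forall a k, (k < p a)%N -> h a k%:Z = g a k%:Z) ->
  forall a u, h a u = g a u.
Proof.
move=> g0 gs hs init; have p0 := T_period_gt0 tri.
have rel a u : (forall b k, (0 < k < p b)%N -> h b (u + k%:Z) = g b (u + k%:Z)) ->
    h a u * h (sigma a) (u + (p (sigma a))%:Z) = g a u * g (sigma a) (u + (p (sigma a))%:Z).
  move=> E; rewrite -!(T_monomial_N0 _ _ _ tri) gs hs.
  by congr (_ + _); apply: eq_T_monomial => // b k; [exact: Np_window|exact: Nm_window].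
apply: window_ind => // a u E.
- have hgu : h a u = g a u by have := E a 0%N (p0 a); rewrite addr0.
  apply: (mulfI (g0 a u)); rewrite -{1}hgu.
  by apply: rel => b k /andP[_]; exact: E.
- apply: (mulIf (g0 (sigma a) (u + (p (sigma a))%:Z))).
  rewrite -{1}E ?p0 ?leqnn //; apply: rel => b k /andP[k0 kb]; apply: E.
  by rewrite k0 ltnW.
Qed.

End Windows.

Section Localisation.
Variables (Q : comPzRingType) (S : Q -> Prop).

(** Fractions over a ring not known to be a domain: denominators are units of [Q] lying in the
    subring. *)
Definition localised (z : Q) := exists s, [/\ in_subring S s, invertible s & in_subring S (s * z)].

Lemma invertible1 : invertible (1 : Q).
Proof. by exists 1; rewrite mulr1. Qed.

Lemma invertibleM (x y : Q) : invertible x -> invertible y -> invertible (x * y).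
Proof. by move=> [x' Ex] [y' Ey]; exists (x' * y'); rewrite mulrACA Ex Ey mulr1. Qed.

Lemma localised_gen z : S z -> localised z.
Proof.
move=> Sz; exists 1; rewrite mul1r; split; [exact: SubringOne|exact: invertible1|].
exact: SubringGen.
Qed.

Lemma localised1 : localised 1.
Proof. by exists 1; rewrite mulr1; split; [exact: SubringOne|exact: invertible1|exact: SubringOne]. Qed.

Lemma localisedB x y : localised x -> localised y -> localised (x - y).
Proof.
move=> [s [Ss Us Sx]] [t [St Ut Sy]]; exists (s * t); split.
- exact: SubringMul.
- exact: invertibleM.
- rewrite mulrBr (mulrAC s t x) -(mulrA s t) [s * x * t]mulrC.
  by apply: SubringSub; apply: SubringMul.
Qed.

Lemma localisedM x y : localised x -> localised y -> localised (x * y).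
Proof.
move=> [s [Ss Us Sx]] [t [St Ut Sy]]; exists (s * t); split.
- exact: SubringMul.
- exact: invertibleM.
- by rewrite mulrACA; apply: SubringMul.
Qed.

Lemma localisedD x y : localised x -> localised y -> localised (x + y).
Proof.
move=> Lx Ly; rewrite -[y]opprK; apply: localisedB => //.
(* Only differences are available: [0] is [y - y], and [- y] is [0 - y]. *)
rewrite -[- y]sub0r -(subrr y); do !apply: localisedB => //.
Qed.

Lemma localisedXn x n : localised x -> localised (x ^+ n).
Proof.
move=> Lx; elim: n => [|n IH]; first exact: localised1.
by rewrite exprS; apply: localisedM.
Qed.

Lemma localised_prod (J : finType) (Pr : pred J) (f : J -> Q) :
  (forall j, Pr j -> localised (f j)) -> localised (\prod_(j | Pr j) f j).
Proof. by move=> Lf; apply: big_ind => //; [exact: localised1|exact: localisedM]. Qed.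

Lemma localised_divl x y : invertible x -> localised x -> localised (x * y) -> localised y.
Proof.
move=> Ux [s [Ss Us Sx]] [t [St Ut Sxy]]; exists (t * (s * x)); split.
- exact: SubringMul.
- by apply: invertibleM => //; apply: invertibleM.
- by rewrite -mulrA -(mulrA s) (mulrCA t s) ; apply: SubringMul.
Qed.

End Localisation.

Section IntegerPolynomials.
Variable I : finType.

Definition poly_ev (R : comPzRingType) (y : I -> R) (s : seq (int * {ffun I -> nat})) : R :=
  \sum_(a <- s) a.1%:~R * \prod_j y j ^+ a.2 j.

Lemma subring_poly_ev (R : comPzRingType) (y : I -> R) z :
  in_subring (fun x => exists i, x = y i) z -> exists s, z = poly_ev y s.
Proof.
elim=> {z} [z [i ->]||x z _ [s ->] _ [t ->]|x z _ [s ->] _ [t ->]].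
- exists [:: (1, [ffun j => (j == i) : nat])]; rewrite /poly_ev big_seq1 mul1r.
  rewrite (bigD1 i) //= ffunE eqxx expr1 big1 ?mulr1 // => j /negPf ji.
  by rewrite ffunE ji.
- exists [:: (1, [ffun j => 0%N])]; rewrite /poly_ev big_seq1 mul1r.
  by rewrite big1 // => j _; rewrite ffunE.
- exists (s ++ [seq (- a.1, a.2) | a : int * {ffun I -> nat} <- t]); rewrite /poly_ev big_cat big_map /=.
  congr (_ + _); rewrite -sumrN; apply: eq_bigr => a _.
  by rewrite mulrNz mulNr.
- exists [seq (a.1 * b.1, [ffun j => (a.2 j + b.2 j)%N] : {ffun I -> nat})
    | a : int * {ffun I -> nat} <- s, b : int * {ffun I -> nat} <- t].
  rewrite /poly_ev big_allpairs_dep mulr_suml; apply: eq_bigr => a _.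
  rewrite mulr_sumr; apply: eq_bigr => b _ /=.
  rewrite intrM mulrACA -big_split /=; congr (_ * _).
  by apply: eq_bigr => j _; rewrite ffunE exprD.
Qed.

Lemma poly_ev_rmorph (R S : comPzRingType) (f : {rmorphism R -> S}) (y : I -> R) s :
  f (poly_ev y s) = poly_ev (fun i => f (y i)) s.
Proof.
rewrite rmorph_sum; apply: eq_bigr => a _.
rewrite rmorphM rmorph_int rmorph_prod; congr (_ * _).
by apply: eq_bigr => j _; rewrite rmorphXn.
Qed.

Definition poly_coef (s : seq (int * {ffun I -> nat})) m : int :=
  \sum_(a <- s | a.2 == m) a.1.

Lemma poly_ev_coef (R : comPzRingType) (y : I -> R) s : poly_ev y s =
  \sum_(m <- undup [seq a.2 | a <- s]) (poly_coef s m)%:~R * \prod_j y j ^+ m j.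
Proof.
under [RHS]eq_bigr => m _ do rewrite /poly_coef rmorph_sum mulr_suml big_mkcond.
rewrite exchange_big /= /poly_ev big_seq [RHS]big_seq; apply: eq_bigr => a sa.
rewrite (bigD1_seq a.2) ?undup_uniq ?mem_undup ?map_f //= eqxx.
rewrite [X in _ + X]big1 ?addr0 // => m.
by rewrite eq_sym => /negPf ->.
Qed.

(** After like terms are collected, a relation between free elements has zero coefficients, so it
    holds for any [y] in any ring. *)
Lemma poly_ev_free (F : fieldType) (X : {ffun I -> F}) (R : comPzRingType) (y : I -> R) s :
  char0 F -> free_tuple X -> poly_ev X s = 0 -> poly_ev y s = 0.
Proof.
move=> c0 fX sX; rewrite poly_ev_coef big1 // => m _.
pose lift (n : {ffun I -> nat}) : {ffun I -> int} := [ffun j => (n j)%:Z].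
have liftI : injective lift.
  by move=> n n' /ffunP E; apply/ffunP => j; have := E j; rewrite !ffunE => -[].
have evE : ev X [seq (a.1, lift a.2) | a <- s] = 0.
  rewrite -sX /ev big_map; apply: eq_bigr => a _ /=; congr (_ * _).
  by apply: eq_bigr => j _; rewrite ffunE.
suff -> : poly_coef s m = 0 by rewrite mul0r.
rewrite -(ev_coef0 c0 fX (lift m) evE) /coef big_map.
by apply: eq_bigl => a /=; rewrite (inj_eq liftI).
Qed.

(* A polynomial relation among free elements is trivial, and every localised element
   is a polynomial up to an invertible factor. *)
Lemma localised_injective (F : fieldType) (Q : comPzRingType) (phi : {rmorphism Q -> F})
    (y : I -> Q) (X : {ffun I -> F}) z :
  char0 F -> free_tuple X -> (forall i, phi (y i) = X i) ->
  localised (fun x => exists i, x = y i) z -> phi z = 0 -> z = 0.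
Proof.
move=> c0 fX phiy [s [_ [s' ss'] /subring_poly_ev[l E]]] z0.
suff sz : s * z = 0 by rewrite -[z]mul1r -ss' mulrAC sz mul0r.
rewrite E; apply: (poly_ev_free _ c0 fX).
have -> : poly_ev X l = phi (poly_ev y l).
  rewrite poly_ev_rmorph; apply: eq_bigr => a _; congr (_ * _).
  by apply: eq_bigr => j _; rewrite phiy.
by rewrite -E rmorphM z0 mulr0.
Qed.

End IntegerPolynomials.

Section TLocalised.
Variables (r : nat) (N0 Np Nm : 'M[{poly int}]_r) (sigma : 'S_r) (p : 'I_r -> nat).
Hypothesis tri : T_triple N0 Np Nm sigma p.
Local Notation T := (T_elt N0 Np Nm).
Local Notation initial := (fun x => exists i : R_in p, x = T (tag i) (pos_of i)%:Z).

(** All [T a u] are units of the T-algebra, so each relation can be solved for either factor on the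
    left. *)
Lemma T_elt_localised a u : localised initial (T a u).
Proof.
have p0 := T_period_gt0 tri.
have LM (N : 'M[{poly int}]_r) c v :
    (forall b k, ~~ (0 < k < p b)%N -> (N b c)`_k = 0) ->
    (forall b k, (0 < k < p b)%N -> localised initial (T b (v + k%:Z))) ->
    localised initial (T_monomial T N c v).
  move=> Nz H; rewrite (T_monomialE _ _ Nz); apply: localised_prod => b _.
  apply: localised_prod => k k0; apply: localisedXn; apply: H.
  by rewrite k0 ltn_ord.
have rel c v : (forall b k, (0 < k < p b)%N -> localised initial (T b (v + k%:Z))) ->
    localised initial (T c v * T (sigma c) (v + (p (sigma c))%:Z)).
  move=> H; rewrite -(T_monomial_N0 _ _ _ tri) T_elt_system.
  apply: localisedD; apply: LM => // b k.
    exact: (Np_window tri).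
  exact: (Nm_window tri).
move: a u; apply: (window_ind tri) => [a k kp|a u E|a u E].
- apply: localised_gen; exists (mkI p0 a k).
  by rewrite pos_mkI.
- apply: (localised_divl (T_elt_invertible N0 Np Nm a u)).
    by have := E a 0%N (p0 a); rewrite addr0.
  by apply: rel => b k /andP[_]; exact: E.
- apply: (localised_divl (T_elt_invertible N0 Np Nm (sigma a) (u + (p (sigma a))%:Z))).
    by apply: E; rewrite p0 leqnn.
  rewrite mulrC; apply: rel => b k /andP[k0 kb]; apply: E.
  by rewrite k0 ltnW.
Qed.

Lemma T_circ_localised z : in_subring (is_T_elt (Np := Np) (Nm := Nm) (N0 := N0)) z ->
  localised initial z.
Proof.
elim=> {z} [z [a [u ->]]||x y _ Lx _ Ly|x y _ Lx _ Ly].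
- exact: T_elt_localised.
- exact: localised1.
- exact: localisedB.
- exact: localisedM.
Qed.

End TLocalised.

(** * Embedding the T-algebra *)

Section TClusterAlgebra.
Variables (r : nat) (Ap Am : 'M[{poly int}]_r) (Dm : 'M[int]_r)
  (N0 Np Nm : 'M[{poly int}]_r) (sigma : 'S_r) (p : 'I_r -> nat).
Hypothesis alphaP : T_datum Ap Am Dm N0 Np Nm sigma p.
Let tri := T_datum_triple alphaP.
Let p0 := T_period_gt0 tri.
Local Notation x := (indets (R_in p)).
Local Notation F := (rat_fun (R_in p)).
Local Notation d := (dcoef Dm).

Definition T_exch_mx := Bmx p (ncoef Np) (ncoef Nm) d.
Local Notation B := T_exch_mx.
Definition T_zeros := zeros p0.
Local Notation Z := T_zeros.
Definition T_shift := nu sigma p0.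
Local Notation nuT := T_shift.

Let c0 : char0 F := @char0_rat_fun (R_in p).
Let d0 : forall a, 0 < d a. Proof. exact: (T_datum_pos alphaP). Qed.
Let Pz : forall b a k, ~~ (0 < k < p b)%N -> ncoef Np b a k = 0.
Proof. by move=> b a k; apply: (Np_window tri). Qed.
Let Mz : forall b a k, ~~ (0 < k < p b)%N -> ncoef Nm b a k = 0.
Proof. by move=> b a k; apply: (Nm_window tri). Qed.
Let P0 : forall b a k, 0 <= ncoef Np b a k.
Proof. by move=> b a k; have [] := T_N2 tri b a k. Qed.
Let M0 : forall b a k, 0 <= ncoef Nm b a k.
Proof. by move=> b a k; have [] := T_N2 tri b a k. Qed.
Let PM0 : forall b a k, ncoef Np b a k * ncoef Nm b a k = 0.
Proof. exact: (T_N4 tri). Qed.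
Let dvP := conj_integral_dvd alphaP (T_datum_conj_p alphaP).
Let dvM := conj_integral_dvd alphaP (T_datum_conj_m alphaP).

Lemma T_exch_skew : skew_by (fun i : R_in p => d (tag i)) B.
Proof. exact: Bmx_skew. Qed.

Lemma T_exch_col i a : B (i, mkI p0 a 0) = cdiff (ncoef Np) (ncoef Nm) (tag i) a (pos_of i).
Proof. exact: Bmx_col. Qed.

Lemma T_zeros_uniq : uniq Z. Proof. exact: zeros_uniq. Qed.

Lemma T_zeros_zero : {in Z &, forall k l, B (k, l) = 0}.
Proof. exact: Bmx_zeros. Qed.

Lemma T_exch_loop i j : B (nuT i, nuT j) = multi_mut Z B i j.
Proof.
apply: Bmx_nu => //; first exact: (dcoef_sigma alphaP).
by move=> a b q; apply: (sympl_coef alphaP).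
Qed.

Definition T_cluster := cluster_at B Z nuT x.

Lemma free_T_cluster u : free_tuple (T_cluster u).
Proof. by apply: free_cluster_at => //; [exact: T_exch_skew|exact: free_indets]. Qed.

Lemma T_cluster_succ u i : T_cluster (u + 1) (nuT i) =
  if i \in Z then exch B (T_cluster u) i / T_cluster u i else T_cluster u i.
Proof. exact: (cluster_at_succ c0 T_exch_skew T_zeros_uniq T_zeros_zero T_exch_loop (free_indets _)). Qed.

Lemma T_seed_at u : exists s, seed_rel (B, x) (relabel s (B, T_cluster u)).
Proof. exact: (seed_at c0 T_exch_skew T_zeros_uniq T_zeros_zero T_exch_loop (free_indets _)). Qed.

Definition T_value a u : F := T_cluster u (mkI p0 a 0).

Lemma T_value_neq0 a u : T_value a u != 0.
Proof. by have [H _] := free_T_cluster u; apply: H. Qed.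

(** A variable at position [k] is only moved, not mutated, until it reaches position 0, [k] steps
    later. *)
Lemma T_clusterE a k u : (k < p a)%N -> T_cluster u (mkI p0 a k) = T_value a (u + k%:Z).
Proof.
elim: k u => [|k IH] u ka; first by rewrite addr0.
have E : nuT (mkI p0 a k.+1) = mkI p0 a k.
  have [] := @pos_nuS _ sigma _ p0 (mkI p0 a k.+1) k; rewrite ?pos_mkI // => t1 t2.
  by apply: Rin_eq; rewrite permE ?t1 // t2 pos_mkI // ltnW.
have := T_cluster_succ u (mkI p0 a k.+1).
rewrite mem_zeros pos_mkI //= E => <-.
by rewrite IH ?(ltnW ka) // -addrA -PoszD add1n.
Qed.

Lemma T_cluster_monomial (N : 'M[{poly int}]_r) a u :
  (forall b k, ~~ (0 < k < p b)%N -> (N b a)`_k = 0) ->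
  \prod_j T_cluster u j ^+ absz (N (tag j) a)`_(pos_of j) = T_monomial T_value N a u.
Proof.
move=> Nz; rewrite (T_monomialE _ _ Nz).
under [RHS]eq_bigr => b _ do rewrite big_mkcond.
rewrite sig_big_dep; apply: eq_bigr => j _ /=.
rewrite -[j in T_cluster u j]mkI_of T_clusterE ?pos_lt //.
by case: ifP => // /negbT k0; rewrite Nz // negb_and k0.
Qed.

Lemma T_exch_pos a u : exch_pos B (T_cluster u) (mkI p0 a 0) = T_monomial T_value Np a u.
Proof.
rewrite -T_cluster_monomial => [|b k]; last exact: (Np_window tri).
by apply: eq_bigr => j _; rewrite T_exch_col pos_cdiff.
Qed.

Lemma T_exch_neg a u : exch_neg B (T_cluster u) (mkI p0 a 0) = T_monomial T_value Nm a u.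
Proof.
rewrite -T_cluster_monomial => [|b k]; last exact: (Nm_window tri).
by apply: eq_bigr => j _; rewrite T_exch_col neg_cdiff.
Qed.

Lemma T_value_next a u : T_value (sigma a) (u + (p (sigma a))%:Z) =
  (T_monomial T_value Np a u + T_monomial T_value Nm a u) / T_value a u.
Proof.
have q0 : pos_of (mkI p0 a 0) = 0%N by rewrite pos_mkI.
have := T_cluster_succ u (mkI p0 a 0); rewrite mem_zeros q0 eqxx.
have -> : nuT (mkI p0 a 0) = mkI p0 (sigma a) (p (sigma a)).-1.
  have [t1 t2] := @pos_nu0 _ sigma _ p0 _ q0.
  by apply: Rin_eq; rewrite permE ?t1 // t2 pos_mkI // pred_lt.
rewrite T_clusterE ?pred_lt // -addrA -PoszD add1n prednK // => ->.
by rewrite /exch -exch_posE -exch_negE T_exch_pos T_exch_neg.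
Qed.

Lemma T_value_system a u :
  T_monomial T_value N0 a u = T_monomial T_value Np a u + T_monomial T_value Nm a u.
Proof. by rewrite (T_monomial_N0 _ _ _ tri) T_value_next mulrC divfK ?T_value_neq0. Qed.

Lemma T_value_init a k : (k < p a)%N -> T_value a k%:Z = x (mkI p0 a k).
Proof. by move=> ka; rewrite -[k%:Z]add0r -T_clusterE. Qed.

Lemma T_value_exchange a u : exchange_relation B x (T_value a u)
  (T_value (sigma a) (u + (p (sigma a))%:Z))
  (T_monomial T_value Np a u) (T_monomial T_value Nm a u).
Proof.
have [s /seedP H] := T_seed_at u; exists (relabel s (B, T_cluster u)).1, (relabel s (B, T_cluster u)).2.
exists (s^-1%g (mkI p0 a 0)); split=> //=.
rewrite rel_exch_pos rel_exch_neg permKV T_exch_pos T_exch_neg; split=> //.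
  by rewrite ffunE permKV.
rewrite [RHS]ffunE eqxx rel_exch_pos rel_exch_neg permKV T_exch_pos T_exch_neg.
by rewrite ffunE permKV T_value_next.
Qed.

Lemma T_value_cluster a u : cluster_variable B x (T_value a u).
Proof.
have [B' [x' [k [H [-> _ _ _]]]]] := T_value_exchange a u.
by exists B', x', k.
Qed.

Lemma T_exch_unique B' : skew_symmetrizable B' ->
  (forall a u, exchange_relation B' x (T_value a u)
    (T_value (sigma a) (u + (p (sigma a))%:Z))
    (T_monomial T_value Np a u) (T_monomial T_value Nm a u)) ->
  B' = B.
Proof.
move=> [d' d'0 sk'] rel.
apply: (loop_unique c0 T_exch_skew T_zeros_uniq T_zeros_zero T_exch_loop (free_indets _)
  (y := @pos_of r p) (d' := d')).
- exact: mem_zeros.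
- move=> i; case E: (pos_of i) => [|n] // _.
  by have [_] := @pos_nuS _ sigma _ p0 i n E; rewrite permE.
- by split.
move=> B1 d1 u s sk1 H1 k j kZ.
have [a ->] : exists a, k = mkI p0 a 0.
  by move: kZ; rewrite mem_zeros => /eqP k0; exists (tag k); rewrite -k0 mkI_of.
set z := mkI p0 a 0; have [B2 [x2 [k2 [H2 [E1 E2 E3 E4]]]]] := rel a u.
have g1 : good d1 (B1, T_cluster u) by split=> //; apply: free_T_cluster.
have g' : good d' (B', x) by split; [split|exact: free_indets].
(* Both seeds are reachable from [(B', x)], and mutation sequences can be reversed. *)
have S12 : seed_rel (relabel s (B1, T_cluster u)) (B2, x2).
  apply: seed_rel_trans (seed_rel_sym c0 g' H1) _.
  by apply/seedP.
have := seed_rel_relabel s^-1%g S12; rewrite relabelVK => /seedP /= S1.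
rewrite (exchange_column c0 (@char0_rat_fun _) (free_T_cluster u) (free_indets ((R_in p + R_in p)%type : finType))
  sk1 (k := s k2) (i := z) (np := pcol B z) (nm := ncol B z) S1).
- by have := pncol B z => /ffunP /(_ j); rewrite !expE bcolE.
- by rewrite ffunE permK -E1.
- by rewrite rel_exch_pos permK -E3 -T_exch_pos exch_posE.
- by rewrite rel_exch_neg permK -E4 -T_exch_neg exch_negE.
- by move=> i; rewrite pcolE pos_part_ge0.
- by move=> i; rewrite ncolE pos_part_ge0.
- by rewrite pcol_diag // (skew_diag _ T_exch_skew).
- by rewrite ncol_diag // (skew_diag _ T_exch_skew).
Qed.

End TClusterAlgebra.

Section SubringMorphism.
Variables (Q R : comPzRingType) (S : Q -> Prop) (C : R -> Prop) (f : {rmorphism Q -> R}).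
Hypothesis fS : forall z, S z -> C (f z).

Lemma subring_map_mem z : z \in gen_subring S -> f z \in gen_subring C.
Proof.
move=> /gen_subringP Sz; apply/gen_subringP; elim: Sz => {z} [z /fS||x y _ Cx _ Cy|x y _ Cx _ Cy].
- exact: SubringGen.
- by rewrite rmorph1; apply: SubringOne.
- by rewrite rmorphB; apply: SubringSub.
- by rewrite rmorphM; apply: SubringMul.
Qed.

Definition subring_map (z : subring_of S) : subring_of C :=
  Subring (subring_map_mem (valP z)).

Lemma subring_mapB : {morph subring_map : x y / x - y}.
Proof. by move=> x y; apply: val_inj; rewrite /= !rmorphB. Qed.

Lemma subring_mapM : {morph subring_map : x y / x * y}.
Proof. by move=> x y; apply: val_inj; rewrite /= !rmorphM. Qed.

Lemma subring_map1 : subring_map 1 = 1.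
Proof. by apply: val_inj; rewrite /= !rmorph1. Qed.

HB.instance Definition _ := GRing.isZmodMorphism.Build (subring_of S) (subring_of C)
  (subring_map) subring_mapB.
HB.instance Definition _ := GRing.isMonoidMorphism.Build (subring_of S) (subring_of C)
  (subring_map) (subring_map1, subring_mapM).

Lemma eq_subring_rmorph (T : comPzRingType) (g h : {rmorphism subring_of S -> T}) :
  (forall z (Sz : S z), g (subring_gen Sz) = h (subring_gen Sz)) -> g =1 h.
Proof.
move=> gh z; have /gen_subringP := valP z; move E: (val z) => y Sy.
elim: Sy z E => {y} [y Sy||y y' Sy IH Sy' IH'|y y' Sy IH Sy' IH'] z E.
- by have -> : z = subring_gen Sy by apply: val_inj; rewrite /= E.
- have -> : z = 1 by apply: val_inj; rewrite E rmorph1.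
  by rewrite !rmorph1.
- have -> : z = Subring (introT (gen_subringP S y) Sy) - Subring (introT (gen_subringP S y') Sy').
    by apply: val_inj; rewrite E rmorphB.
  by rewrite !rmorphB IH ?IH'.
- have -> : z = Subring (introT (gen_subringP S y) Sy) * Subring (introT (gen_subringP S y') Sy').
    by apply: val_inj; rewrite E rmorphM.
  by rewrite !rmorphM IH ?IH'.
Qed.

End SubringMorphism.

Lemma eq_T_circ_rmorph r (N0 Np Nm : 'M[{poly int}]_r) (R : comPzRingType)
    (g h : {rmorphism T_circ N0 Np Nm -> R}) :
  (forall a u, g (T_circ_elt N0 Np Nm a u) = h (T_circ_elt N0 Np Nm a u)) -> g =1 h.
Proof.
by move=> gh; apply: eq_subring_rmorph => z [a [u E]]; subst z; apply: gh.
Qed.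

Section TEmbedding.
Variables (r : nat) (Ap Am : 'M[{poly int}]_r) (Dm : 'M[int]_r)
  (N0 Np Nm : 'M[{poly int}]_r) (sigma : 'S_r) (p : 'I_r -> nat).
Hypothesis alphaP : T_datum Ap Am Dm N0 Np Nm sigma p.
Let tri := T_datum_triple alphaP.
Local Notation x := (indets (R_in p)).
Local Notation B := (T_exch_mx Dm Np Nm p).
Local Notation value := (T_value alphaP).
Local Notation Tc := (T_circ_elt N0 Np Nm).

Section Values.
Variables (B' : {ffun R_in p * R_in p -> int})
  (f : {rmorphism T_circ N0 Np Nm -> cluster_algebra B' x}).
Hypothesis f_init : forall (a : 'I_r) (k : 'I_(p a)),
  subring_val (f (Tc a (k : nat)%:Z)) = x (Tagged (fun b => 'I_(p b)) k).

Let fval : {rmorphism T_circ N0 Np Nm -> rat_fun (R_in p)} := val \o f.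

(** [B'] is arbitrary: the T-system propagates the initial values. This gives uniqueness of the
    embedding, and condition (3) concerns the same rational functions for every matrix. *)
Lemma embedding_value a u : subring_val (f (Tc a u)) = value a u.
Proof.
rewrite -[LHS]/(fval (Tc a u)).
move: a u; apply: (T_system_unique tri).
- exact: T_value_neq0.
- exact: T_value_system.
- by move=> a u; rewrite -!(rmorph_T_monomial fval) T_circ_system rmorphD.
move=> a k ka; rewrite (T_value_init alphaP ka) -[LHS]/(subring_val (f (Tc a (Ordinal ka : nat)%:Z))).
rewrite f_init; congr (x _).
by apply: Rin_eq => //; rewrite pos_mkI.
Qed.

Lemma embedding_monomial N a u :
  subring_val (f (T_monomial Tc N a u)) = T_monomial value N a u.
Proof.
rewrite -[LHS]/(fval (T_monomial Tc N a u)) rmorph_T_monomial.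
by apply: eq_bigr => b _; apply: eq_bigr => k _; rewrite -embedding_value.
Qed.

End Values.

Let T_hom := T_eval (T_value_neq0 alphaP) (T_value_system alphaP).

Lemma T_hom_cluster z : is_T_elt z -> cluster_variable B x (T_hom z).
Proof. by move=> [a [u ->]]; rewrite T_evalE; apply: T_value_cluster. Qed.

Definition T_embedding : {rmorphism T_circ N0 Np Nm -> cluster_algebra B x} :=
  subring_map T_hom_cluster.

Lemma T_embedding_init (a : 'I_r) (k : 'I_(p a)) :
  subring_val (T_embedding (Tc a (k : nat)%:Z)) = x (Tagged (fun b => 'I_(p b)) k).
Proof.
rewrite [LHS]T_evalE (T_value_init alphaP (ltn_ord k)); congr (x _).
by apply: Rin_eq => //; rewrite pos_mkI.
Qed.

Lemma T_embedding_inj : injective T_embedding.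
Proof.
move=> y z yz; apply/eqP; rewrite -subr_eq0; apply/eqP.
apply: val_inj; rewrite [RHS]rmorph0.
apply: (localised_injective (@char0_rat_fun _) (free_indets _) (phi := T_hom)
  (y := fun i : R_in p => T_elt N0 Np Nm (tag i) (pos_of i)%:Z)).
- by move=> i; rewrite T_evalE (T_value_init alphaP (pos_lt i)) mkI_of.
- by apply: (T_circ_localised tri); apply/gen_subringP; apply: valP.
- have E : T_hom (val y) = T_hom (val z) := congr1 (@subring_val _ _) yz.
  have V : val (y - z) = val y - val z := rmorphB val y z.
  by apply: etrans (congr1 T_hom V) _; rewrite (rmorphB T_hom) E subrr.
Qed.

End TEmbedding.

Theorem theorem1p3 (r : nat) (Ap Am : 'M[{poly int}]_r) (D : 'M[int]_r)
    (N0 Np Nm : 'M[{poly int}]_r) (sigma : 'S_r) (p : 'I_r -> nat)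
    (alphaP : T_datum Ap Am D N0 Np Nm sigma p) :
  let x := indets (R_in p) in
  exists! B : {ffun R_in p * R_in p -> int},
    skew_symmetrizable B /\
    exists iota : {rmorphism T_circ N0 Np Nm -> cluster_algebra B x},
      let is_embedding (f : {rmorphism T_circ N0 Np Nm -> cluster_algebra B x}) :=
        injective f /\
        forall (a : 'I_r) (k : 'I_(p a)),
          subring_val (f (T_circ_elt N0 Np Nm a (k : nat)%:Z)) =
          x (Tagged (fun b => 'I_(p b)) k) in
      [/\ (* (1) *)
          is_embedding iota /\
          (forall iota' : {rmorphism T_circ N0 Np Nm -> cluster_algebra B x},
             is_embedding iota' -> iota' =1 iota),
          (* (2) *)
          forall a u, cluster_variable B x
            (subring_val (iota (T_circ_elt N0 Np Nm a u)))
        & (* (3) *)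
          forall a u, exchange_relation B x
            (subring_val (iota (T_circ_elt N0 Np Nm a u)))
            (subring_val (iota (T_circ_elt N0 Np Nm (sigma a) (u + (p (sigma a))%:Z))))
            (subring_val (iota (T_monomial (T_circ_elt N0 Np Nm) Np a u)))
            (subring_val (iota (T_monomial (T_circ_elt N0 Np Nm) Nm a u)))].
Proof.
move=> x; exists (T_exch_mx D Np Nm p); split; last first.
  move=> B' [skB' [f [[[_ f_init] _] _ f_exch]]].
  apply: esym; apply: (T_exch_unique (alphaP := alphaP) skB') => a u.
  rewrite -(embedding_value alphaP f_init a u) -(embedding_value alphaP f_init (sigma a)).
  rewrite -(embedding_monomial alphaP f_init Np) -(embedding_monomial alphaP f_init Nm).
  exact: f_exch.
have [d0 sk] := T_exch_skew alphaP; split; first by eexists; [exact: d0|exact: sk].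
have init := T_embedding_init alphaP.
exists (T_embedding alphaP); split=> [|a u|a u].
- split=> [|f [_ f_init]]; first by split; [exact: T_embedding_inj|exact: init].
  apply: eq_T_circ_rmorph => a u; apply: val_inj.
  by rewrite [LHS](embedding_value alphaP f_init) [RHS](embedding_value alphaP init).
- by have := T_value_cluster alphaP a u; rewrite -(embedding_value alphaP init).
have := T_value_exchange alphaP a u.
rewrite -(embedding_value alphaP init a u) -(embedding_value alphaP init (sigma a)).
by rewrite -(embedding_monomial alphaP init Np) -(embedding_monomial alphaP init Nm).
Qed.
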